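(* Assume the standing setting below with $h\in R_{k-1}$ for some $k>1$. Let $a_n\to\infty$, let $t_n$ solve $m(t_n)=a_n$, and assume: (i) $\lim_{n\to\infty}\psi(t_n)^2/\sqrt{n\psi'(t_n)}=0$; (ii) for some $\delta>0$, $\liminf_{n\to\infty}\log g(a_n)/\log n>\delta$; (iii) $\epsilon_n>0$ is a sequence with $\lim_{n\to\infty} n\log a_n/(a_n^{k-2}\epsilon_n^2)=0$. Let $P_{A_n}$ denote the conditional distribution of $X_1$ given $A_n:=(S_1^n\ge na_n)$ and $G_{a_n}=\Pi^{a_n}$ the tilted distribution at point $a_n$. Then for every sequence of Borel sets $B_n\subset\mathbb R$ with $\liminf_{n\to\infty}P_{A_n}(B_n)>0$, $$P_{A_n}(B_n)=(1+o(1))\,G_{a_n}(B_n)\quad(n\to\infty).$$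
   Context: Standing setting. $X_1,X_2,\dots$ are i.i.d. nonnegative real random variables with a uniformly bounded density $p$ (w.r.t. Lebesgue measure) of the form $p(x)=c\exp(-(g(x)-q(x)))$ for $x\ge 0$, where $c>0$ is a normalizing constant, $g$ is positive and differentiable with $g(x)/x\to\infty$ as $x\to\infty$, $h:=g'$, and for some $\vartheta>0$ and all large $x$, $\sup_{|v-x|<\vartheta x}|q(v)|\le 1/\sqrt{x h(x)}$. $R_0$ is the class of functions $l(x)=\exp\big(\int_1^x \epsilon(u)/u\,du\big)$, $x\ge 1$, with $\epsilon$ twice differentiable and $\epsilon(x)\to 0$ as $x\to\infty$. For $\beta>0$, $h\in R_\beta$ if for large $x$, $h(x)=x^\beta l(x)$ with $l\in R_0$ whose function $\epsilon$ satisfies $\limsup_{x\to\infty} x|\epsilon'(x)|<\infty$ and $\limsup_{x\to\infty}x^2|\epsilon''(x)|<\infty$. $\psi(u):=\inf\{x:h(x)\ge u\}$. Let $\phi(t)=E e^{tX_1}$, $m(t)=\frac{d}{dt}\log\phi(t)$, $s^2(t)=\frac{d^2}{dt^2}\log\phi(t)$. For $a$ in the range of $m$, the tilted density at point $a$ is $\pi^a(x)=e^{tx}p(x)/\phi(t)$ where $t$ solves $m(t)=a$; $\Pi^a$ denotes the corresponding probability measure. $S_1^n:=X_1+\dots+X_n$. *)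

(* Defs.v *)
From HB Require Import structures.
From mathcomp Require Import all_boot all_order all_algebra.
From mathcomp Require Import all_classical all_reals all_analysis.
Set Implicit Arguments. Unset Strict Implicit. Unset Printing Implicit Defensive.
Import Order.TTheory GRing.Theory Num.Theory.
Import numFieldNormedType.Exports.
Local Open Scope classical_set_scope.
Local Open Scope ring_scope.

Section defs.
Context {R : realType} {d : measure_display} {T : measurableType d}.
Variable P : probability T R.

Definition mutually_independent (X : nat -> {RV P >-> R}) : Prop :=
  forall (s : seq nat) (B : nat -> set R),
    uniq s -> (forall i, measurable (B i)) ->
    P (\big[setI/setT]_(i <- s) (X i @^-1` B i)) =
    (\prod_(i <- s) P (X i @^-1` B i))%E.

(** S_1^n = X_1 + ... + X_n (here X_1 is [X 0], ..., X_n is [X n.-1]). *)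
Definition partial_sum (X : nat -> {RV P >-> R}) (n : nat) (w : T) : R :=
  \sum_(i < n) X i w.

Definition event_A (X : nat -> {RV P >-> R}) (n : nat) (an : R) : set T :=
  [set w | n%:R * an <= partial_sum X n w].

Definition cond_law (X : nat -> {RV P >-> R}) (A : set T) (B : set R) : R :=
  fine (P (A `&` (X 0 @^-1` B))) / fine (P A).

Definition mgf (Y : {RV P >-> R}) (t : R) : R := fine ('M_P Y t).

Definition mgf_m (Y : {RV P >-> R}) (t : R) : R :=
  derive1 (fun u => ln (mgf Y u)) t.

End defs.

(** Tilted distribution Pi^a(B) = int_B e^{tx} p(x) dx / phi(t), where t solves m(t) = a. *)
Definition tilted {R : realType} (p : R -> R) (phi_t t : R) (B : set R) : R :=
  (\int[@lebesgue_measure R]_(x in B) (expR (t * x) * p x)) / phi_t.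

(** psi(u) = inf {x : h(x) >= u}  (h defined on (0, +oo)) *)
Definition psi {R : realType} (h : R -> R) (u : R) : R :=
  inf [set x | 0 < x /\ u <= h x].

Definition R0_rep {R : realType} (l eps : R -> R) : Prop :=
  (forall x : R, 1 <= x -> derivable eps x 1 /\ derivable (derive1 eps) x 1) /\
  (eps x @[x --> +oo] --> 0) /\
  (forall x : R, 1 <= x ->
     l x = expR (\int[@lebesgue_measure R]_(u in `[1, x]) (eps u / u))).

Definition in_Rbeta {R : realType} (beta : R) (h : R -> R) : Prop :=
  exists l eps : R -> R,
    R0_rep l eps /\
    (exists C : R, \forall x \near +oo, x * `|derive1 eps x| <= C) /\
    (exists C : R, \forall x \near +oo, x ^+ 2 * `|derive1 (derive1 eps) x| <= C) /\
    (\forall x \near +oo, h x = powR x beta * l x).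

Definition standing_setting {R : realType} {d : measure_display} {T : measurableType d}
  (P : probability T R) (X : nat -> {RV P >-> R}) (p : R -> R) (c : R)
  (g q : R -> R) : Prop :=
  mutually_independent X /\
  (forall i w, 0 <= X i w) /\
  measurable_fun setT p /\
  (forall i (B : set R), measurable B ->
     P (X i @^-1` B) = (\int[@lebesgue_measure R]_(x in B) (p x)%:E)%E) /\
  (exists M : R, forall x, 0 <= p x <= M) /\
  0 < c /\
  (forall x, 0 <= x -> p x = c * expR (- (g x - q x))) /\
  (forall x, 0 <= x -> 0 < g x) /\
  (forall x, 0 < x -> derivable g x 1) /\
  (g x / x @[x --> +oo] --> +oo) /\
  (exists theta : R, 0 < theta /\
     \forall x \near +oo, forall v, `|v - x| < theta * x ->
        `|q v| <= 1 / Num.sqrt (x * derive1 g x)).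
Arguments standing_setting {R d T} P X p c g q.

(* Main.v *)
(** Let [w = Pi^a] be the tilted density, with tilt [t] and scale [sg], let
    [N = n - 1] and let [u y] be the [w]-mean of [e^{-t (y + x - n a)}] over
    [y + x >= n a].  After tilting, the density of [X_1] given [A_n] is
    [w J / E J], where [J x] is the mean of [u (x + S)] for a sum [S] of [N - 1]
    independent variables of law [w].  So the total variation distance is at
    most [sqrt (Var J) / E J], and no local limit theorem is needed:
    - [J] is one of the [N] first-order projections of the function [u] of a sum
      of [N] i.i.d. variables, so [N * Var J <= E u^2 <= sup u * E J];
    - [sup u <= C / (t * sg)] and [E J >= c / (t * sg * sqrt N)]. The second bound
      follows by minorizing [u] near the mean by a function whose compactly
      supported Fourier transform is explicit, and by estimating the N-th power
      of the characteristic function of [w] near [0].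
    Hence the distance is [O(N^{-1/4})], uniformly for large [t].  The constants
    only depend on two-sided bounds for [sg * w(a + sg y)], which regular
    variation of [g'] gives around the saddle point [xs], where [g' xs = t], at
    the scale [sg = sqrt (xs / t)]. *)
Require Import Defs.
From HB Require Import structures.
From mathcomp Require Import all_boot all_order all_algebra.
From mathcomp Require Import all_classical all_reals all_analysis.
From mathcomp Require Import measurable_realfun ring lra.
Set Implicit Arguments. Unset Strict Implicit. Unset Printing Implicit Defensive.
Import Order.TTheory GRing.Theory Num.Theory.
Import numFieldNormedType.Exports.
Local Open Scope classical_set_scope.
Local Open Scope ring_scope.

(** * Bounded measurable functions and Fubini's theorem for weighted integrals *)

Section bounded_measurable.
Context d {T : measurableType d} {R : realType}.
Implicit Types f g : T -> R.

(** The tilted law changes with [n], so every estimate has to be uniform in the tilt. Hence only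
    orders of magnitude are compared: neither the normalization nor the density of a sum is computed
    asymptotically. The minorant is band-limited so that only frequencies up to a constant over the
    scale enter. There, moments up to order four control the characteristic function, and nothing is
    asked of it away from 0. Exact centring at [a], which is what m(t) = a provides, makes its
    imaginary part cubic in the frequency [u]: the phase of the N-th power is of order [N u^3],
    still small for [u] of order [1 / sqrt N], beyond which the modulus decays. The saddle point is
    only an approximate mean; bounds found around it are recentred at the cost of a constant. The
    product [t * sg] is not bounded above, but it cancels between [sup u] and [E J]. The lower bound
    on the conditional probabilities serves to turn the additive error into a relative one, and
    monotonicity of the mean in the tilt turns large [a] into large [t]. *)

Definition bounded_meas f := measurable_fun setT f /\ exists M, forall x, `|f x| <= M.

Lemma bounded_meas_cst c : bounded_meas (fun=> c).
Proof. by split; [exact: measurable_cst|exists `|c|]. Qed.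

Lemma bounded_measD f g : bounded_meas f -> bounded_meas g ->
  bounded_meas (fun x => f x + g x).
Proof.
move=> [mf [M Mf]] [mg [N Ng]]; split; first exact: measurable_funD.
by exists (M + N) => x; rewrite (le_trans (ler_normD _ _))// lerD.
Qed.

Lemma bounded_measN f : bounded_meas f -> bounded_meas (fun x => - f x).
Proof.
move=> [mf [M Mf]]; split; first exact: measurableT_comp.
by exists M => x; rewrite normrN.
Qed.

Lemma bounded_measB f g : bounded_meas f -> bounded_meas g ->
  bounded_meas (fun x => f x - g x).
Proof. by move=> ? ?; apply: bounded_measD => //; exact: bounded_measN. Qed.

Lemma bounded_measM f g : bounded_meas f -> bounded_meas g ->
  bounded_meas (fun x => f x * g x).
Proof.
move=> [mf [M Mf]] [mg [N Ng]]; split; first exact: measurable_funM.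
by exists (M * N) => x; rewrite normrM ler_pM.
Qed.

Lemma bounded_measX f n : bounded_meas f -> bounded_meas (fun x => f x ^+ n).
Proof.
move=> bf; elim: n => [|n ih]; first exact: bounded_meas_cst.
by under eq_fun do rewrite exprS; exact: bounded_measM.
Qed.

Lemma bounded_meas_indic (A : set T) : measurable A -> bounded_meas \1_A.
Proof.
move=> mA; split; first exact: measurable_indic.
by exists 1 => x; rewrite indicE; case: (_ \in _); rewrite ?normr1 ?normr0.
Qed.

End bounded_measurable.

Lemma bounded_meas_comp d d' {T : measurableType d} {T' : measurableType d'}
    {R : realType} (f : T' -> R) (g : T -> T') :
  bounded_meas f -> measurable_fun setT g -> bounded_meas (f \o g).
Proof.
move=> [mf [M Mf]] mg; split; first exact: measurableT_comp.
by exists M => x /=.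
Qed.

Section weighted_integral.
Context {R : realType}.
Notation mu := (@lebesgue_measure R).
Implicit Types (w f g : R -> R).

Lemma integrable_mul_bounded w f : mu.-integrable setT (EFin \o w) ->
  bounded_meas f -> mu.-integrable setT (EFin \o (fun x => w x * f x)).
Proof.
move=> iw [mf [M Mf]].
have := @integrableMl _ _ R mu setT measurableT (EFin \o w) f iw mf.
have -> : ((EFin \o w) \* (EFin \o f))%E = (EFin \o (fun x => w x * f x)).
  by apply/funext => x /=; rewrite EFinM.
apply; exists M; split; first exact: num_real.
by move=> y My x _ /=; rewrite (le_trans (Mf x))// ltW.
Qed.

Lemma integrable_cstM (c : R) f : mu.-integrable setT (EFin \o f) ->
  mu.-integrable setT (EFin \o (fun x => c * f x)).
Proof.
move=> i; have := integrable_mul_bounded i (bounded_meas_cst c).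
by under eq_fun do rewrite mulrC.
Qed.

Lemma EFin_RintegralZl (c : R) f : mu.-integrable setT (EFin \o f) ->
  (\int[mu]_x (c * f x)%:E = (c * \int[mu]_x f x)%:E)%E.
Proof.
move=> i; rewrite -RintegralZl// /Rintegral fineK//.
exact: (integrable_fin_num _ (integrable_cstM c i)).
Qed.

Lemma integrable_fubini_weights w1 w2 (H : R * R -> R) :
  mu.-integrable setT (EFin \o w1) -> mu.-integrable setT (EFin \o w2) ->
  bounded_meas H ->
  (mu \x mu)%E.-integrable setT (fun z => (w1 z.1 * (w2 z.2 * H z))%:E).
Proof.
move=> i1 i2 [mH [M MH]].
have m1 : measurable_fun setT w1.
  by apply/measurable_EFinP; exact: measurable_int i1.
have m2 : measurable_fun setT w2.
  by apply/measurable_EFinP; exact: measurable_int i2.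
have mF : measurable_fun setT (fun z : R * R => (w1 z.1 * (w2 z.2 * H z))%:E).
  apply/measurable_EFinP; apply: measurable_funM.
    exact: (measurableT_comp m1).
  by apply: measurable_funM => //; exact: (measurableT_comp m2).
apply/(@integrable12ltyP _ _ _ _ R mu mu _ mF).
pose I2 := (\int[mu]_y `|w2 y|%:E)%E.
have I2E : I2 \is a fin_num.
  by apply: integrable_fin_num => //; exact: (integrable_norm i2).
apply: (@le_lt_trans _ _ (\int[mu]_x (`|w1 x|%:E * ((M * fine I2)%:E)))%E).
  apply: ge0_le_integral => //.
  - by move=> x _; apply: integral_ge0.
  - have := @measurable_fun_fubini_tonelli_F _ _ _ _ R mu
      (fun z : R * R => `|(w1 z.1 * (w2 z.2 * H z))%:E|)%E.
    rewrite /fubini_F /=; apply => //; apply/measurable_EFinP; apply: measurableT_comp => //; exact/measurable_EFinP.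
  - apply: emeasurable_funM => //; apply/measurable_EFinP.
    exact: measurableT_comp.
  - move=> x _.
    have -> : (`|w1 x|%:E * (M * fine I2)%:E = \int[mu]_y ((`|w1 x| * M)%:E * `|w2 y|%:E))%E.
      rewrite ge0_integralZl_EFin //.
      - by rewrite -/I2 EFinM fineK// EFinM muleA.
      - by apply/measurable_EFinP; exact: measurableT_comp.
      - by rewrite mulr_ge0// (le_trans _ (MH (0, 0))).
    apply: ge0_le_integral => //.
    - apply/measurable_EFinP; apply: (measurableT_comp (@normr_measurable R setT)).
      apply: measurable_funM => //=; apply: measurable_funM => //.
      exact: (measurable_fun_pair2 x mH).
    - by apply: emeasurable_funM => //; apply/measurable_EFinP; exact: measurableT_comp.
    - move=> y _; rewrite -EFinM lee_fin !normrM -mulrA ler_wpM2l// mulrC.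
      by rewrite ler_wpM2r//.
rewrite ge0_integralZr//.
- rewrite lte_mul_pinfty//; first exact: integral_ge0.
    by apply: integrable_fin_num => //; exact: (integrable_norm i1).
  by rewrite ltry.
- by apply/measurable_EFinP; exact: measurableT_comp.
- rewrite lee_fin mulr_ge0 ?(le_trans _ (MH (0, 0)))//.
  by rewrite fine_ge0// integral_ge0.
Qed.

Lemma weighted_fubini w1 w2 (H : R * R -> R) :
  mu.-integrable setT (EFin \o w1) -> mu.-integrable setT (EFin \o w2) ->
  bounded_meas H ->
  \int[mu]_x (w1 x * \int[mu]_y (w2 y * H (x, y))) =
  \int[mu]_y (w2 y * \int[mu]_x (w1 x * H (x, y))).
Proof.
move=> i1 i2 bH.
have FF := Fubini (integrable_fubini_weights i1 i2 bH).
rewrite /Rintegral; congr fine.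
transitivity (\int[mu]_x \int[mu]_y (w1 x * (w2 y * H (x, y)))%:E)%E.
  apply: eq_integral => x _.
  have bHx : bounded_meas (fun y => H (x, y)).
    by case: bH => mH [M MH]; split; [exact: measurable_fun_pair2|exists M].
  have iH := integrable_mul_bounded i2 bHx.
  by rewrite EFin_RintegralZl.
rewrite FF /=; apply: eq_integral => y _.
have bHy : bounded_meas (fun x => H (x, y)).
  by case: bH => mH [M MH]; split; [exact: measurable_fun_pair1|exists M].
have iH := integrable_mul_bounded i1 bHy.
under eq_integral do rewrite mulrCA.
by rewrite EFin_RintegralZl.
Qed.

Lemma bounded_meas_weighted w (H : R * R -> R) :
  (forall x, 0 <= w x) -> mu.-integrable setT (EFin \o w) -> bounded_meas H ->
  bounded_meas (fun y => \int[mu]_x (w x * H (y, x))).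
Proof.
move=> w0 iw [mH [M MH]].
have mw : measurable_fun setT w.
  by apply/measurable_EFinP; exact: measurable_int iw.
have bHy y : bounded_meas (fun x => H (y, x)).
  by split; [exact: measurable_fun_pair2|exists M].
split; last first.
  exists (M * \int[mu]_x (w x)) => y.
  rewrite -RintegralZl//.
  rewrite (le_trans (le_normr_Rintegral _ _))//; first exact: integrable_mul_bounded.
  apply: le_Rintegral => //.
  - by apply: (integrable_norm (integrable_mul_bounded iw (bHy y))).
  - have := @integrable_mul_bounded w (cst M) iw (bounded_meas_cst _).
    by under eq_fun do rewrite mulrC.
  - by move=> x _; rewrite normrM mulrC (ger0_norm (w0 x)) ler_wpM2r.
(* Adding the bound [M] makes the integrand nonnegative, so that Tonelli's theorem yields
   measurability; the added term is a constant. *)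
have -> : (fun y => \int[mu]_x (w x * H (y, x))) =
    (fun y => fine (\int[mu]_x (w x * (H (y, x) + M))%:E)%E - M * \int[mu]_x w x).
  apply/funext => y; rewrite -/(Rintegral mu setT _).
  under [X in X - _]eq_Rintegral do rewrite mulrDr.
  rewrite RintegralD//; last 2 first.
  - exact: integrable_mul_bounded.
  - by have := @integrable_mul_bounded w (cst M) iw (bounded_meas_cst _).
  by rewrite RintegralZr// [X in _ = _ + X - _]mulrC addrK.
apply: measurable_funB => //; apply: measurableT_comp => //.
have := @measurable_fun_fubini_tonelli_F _ _ _ _ R mu
   (fun z : R * R => (w z.2 * (H z + M))%:E).
rewrite /fubini_F /=; apply.
- apply/measurable_EFinP; apply: measurable_funM.
    exact: (measurableT_comp mw).
  exact: measurable_funD.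
- move=> x; rewrite lee_fin mulr_ge0//.
  by have := MH x; rewrite ler_norml => /andP[+ _]; rewrite -subr_ge0 opprK.
Qed.

End weighted_integral.

(** * Averaging along a random walk *)

Section expectation.
Context {R : realType}.
Notation mu := (@lebesgue_measure R).
Implicit Types (w f g : R -> R).

Definition is_density w := [/\ forall x, 0 <= w x,
  mu.-integrable setT (EFin \o w) & \int[mu]_x w x = 1].

Definition expect w f := \int[mu]_x (w x * f x).

Variable w : R -> R.
Hypothesis dw : is_density w.

Let w0 x : 0 <= w x. Proof. by case: dw. Qed.
Let iw : mu.-integrable setT (EFin \o w). Proof. by case: dw. Qed.

Lemma expect_cst c : expect w (fun=> c) = c.
Proof. by rewrite /expect RintegralZr//; case: dw => _ _ ->; rewrite mul1r. Qed.

Lemma expectD f g : bounded_meas f -> bounded_meas g ->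
  expect w (fun x => f x + g x) = expect w f + expect w g.
Proof.
move=> bf bg; rewrite /expect -RintegralD//; try exact: integrable_mul_bounded.
by apply: eq_Rintegral => x _; rewrite mulrDr.
Qed.

Lemma expectZ c f : bounded_meas f ->
  expect w (fun x => c * f x) = c * expect w f.
Proof.
move=> bf; rewrite /expect -RintegralZl//; last exact: integrable_mul_bounded.
by apply: eq_Rintegral => x _; rewrite mulrCA.
Qed.

Lemma expectB f g : bounded_meas f -> bounded_meas g ->
  expect w (fun x => f x - g x) = expect w f - expect w g.
Proof.
move=> bf bg; rewrite /expect -RintegralB//; try exact: integrable_mul_bounded.
by apply: eq_Rintegral => x _; rewrite mulrBr.
Qed.

Lemma expect_ge0 f : (forall x, 0 <= f x) -> 0 <= expect w f.
Proof. by move=> f0; apply: Rintegral_ge0 => x _; rewrite mulr_ge0. Qed.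

Lemma le_expect f g : bounded_meas f -> bounded_meas g ->
  (forall x, f x <= g x) -> expect w f <= expect w g.
Proof.
move=> bf bg fg; rewrite -subr_ge0 -expectB//; apply: expect_ge0 => x.
by rewrite subr_ge0.
Qed.

Lemma eq_expect f g : f =1 g -> expect w f = expect w g.
Proof. by move=> fg; apply: eq_Rintegral => x _; rewrite fg. Qed.

Lemma expect_sqrB f c : bounded_meas f ->
  expect w (fun x => (f x - c) ^+ 2) =
  expect w (fun x => f x ^+ 2) - 2 * c * expect w f + c ^+ 2.
Proof.
move=> bf; have bf2 := bounded_measX 2 bf.
have -> : expect w (fun x => (f x - c) ^+ 2) =
    expect w (fun x => f x ^+ 2 - 2 * (c * f x) + c ^+ 2).
  by apply: eq_expect => x; ring.
have bZ : bounded_meas (fun x => 2 * (c * f x)).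
  apply: bounded_measM; first exact: bounded_meas_cst.
  by apply: bounded_measM => //; exact: bounded_meas_cst.
have bc2 : bounded_meas (fun _ : R => c ^+ 2) by exact: bounded_meas_cst.
rewrite (expectD (bounded_measB bf2 bZ) bc2) expect_cst expectB// expectZ ?expectZ ?mulrA//.
by apply: bounded_measM => //; exact: bounded_meas_cst.
Qed.

Lemma sqr_expect_le f : bounded_meas f ->
  expect w f ^+ 2 <= expect w (fun x => f x ^+ 2).
Proof.
move=> bf; have := expect_sqrB (expect w f) bf.
have : 0 <= expect w (fun x => (f x - expect w f) ^+ 2).
  by apply: expect_ge0 => x; exact: sqr_ge0.
by move=> + E; rewrite E => h; lra.
Qed.

Lemma expect_exchange (H : R * R -> R) : bounded_meas H ->
  expect w (fun x => expect w (fun y => H (x, y))) =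
  expect w (fun y => expect w (fun x => H (x, y))).
Proof. exact: weighted_fubini. Qed.

Lemma bounded_meas_expect (H : R * R -> R) : bounded_meas H ->
  bounded_meas (fun y => expect w (fun x => H (y, x))).
Proof. exact: bounded_meas_weighted. Qed.

(** Transition operator of the random walk with step density [w]: [iter n walk_op f y] is the mean
    of [f] at [y] plus [n] independent steps. Independence is thus encoded by iteration, without
    product spaces. *)
Definition walk_op f y := expect w (fun x => f (y + x)).

Lemma bounded_meas_shift f (y : R) : bounded_meas f -> bounded_meas (fun x : R => f (y + x)).
Proof. by move=> bf; apply: (bounded_meas_comp bf); exact: measurable_funD. Qed.

Lemma bounded_meas_add2 f : bounded_meas f ->
  bounded_meas (fun z : R * R => f (z.1 + z.2)).
Proof. by move=> bf; apply: (bounded_meas_comp bf); exact: measurable_funD. Qed.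

Lemma bounded_meas_walk f : bounded_meas f -> bounded_meas (walk_op f).
Proof. by move=> bf; apply: (bounded_meas_expect (bounded_meas_add2 bf)). Qed.

Lemma bounded_meas_iter_walk f n : bounded_meas f ->
  bounded_meas (iter n walk_op f).
Proof. by move=> bf; elim: n => //= n; exact: bounded_meas_walk. Qed.

Lemma walk_opD f g : bounded_meas f -> bounded_meas g ->
  walk_op (fun x => f x + g x) = (fun x => walk_op f x + walk_op g x).
Proof. by move=> bf bg; apply/funext => y; rewrite /walk_op expectD//; exact: bounded_meas_shift. Qed.

Lemma walk_opZ c f : bounded_meas f ->
  walk_op (fun x => c * f x) = (fun x => c * walk_op f x).
Proof. by move=> bf; apply/funext => y; rewrite /walk_op expectZ//; exact: bounded_meas_shift. Qed.

Lemma iter_walkD n f g : bounded_meas f -> bounded_meas g ->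
  iter n walk_op (fun x => f x + g x) = (fun x => iter n walk_op f x + iter n walk_op g x).
Proof.
by move=> bf bg; elim: n => //= n ->; rewrite walk_opD//; exact: bounded_meas_iter_walk.
Qed.

Lemma iter_walkZ n c f : bounded_meas f ->
  iter n walk_op (fun x => c * f x) = (fun x => c * iter n walk_op f x).
Proof.
by move=> bf; elim: n => //= n ->; rewrite walk_opZ//; exact: bounded_meas_iter_walk.
Qed.

Lemma iter_walk_ge0 n f : (forall x, 0 <= f x) -> forall x, 0 <= iter n walk_op f x.
Proof. by move=> f0; elim: n => //= n ih x; apply: expect_ge0. Qed.

Lemma le_iter_walk n f g : bounded_meas f -> bounded_meas g ->
  (forall x, f x <= g x) -> forall x, iter n walk_op f x <= iter n walk_op g x.
Proof.
move=> bf bg fg; elim: n => //= n ih x.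
by apply: le_expect => //; apply: bounded_meas_shift; exact: bounded_meas_iter_walk.
Qed.

(* Conditional variances decrease under averaging: with [G x z = g (y + x + z)],
   this is [E_z E_x (G - E_z G)^2 >= E_z (E_x (G - E_z G))^2]. *)
Lemma walk_op_convex g y : bounded_meas g ->
  0 <= walk_op (walk_op (fun x => g x ^+ 2)) y
       - 2 * walk_op (fun x => walk_op g x ^+ 2) y + walk_op (walk_op g) y ^+ 2.
Proof.
move=> bg.
have bTg := bounded_meas_walk bg.
have bg2 := bounded_measX 2 bg.
pose G (z : R * R) := g (y + z.1 + z.2).
have bG : bounded_meas G.
  apply: (bounded_meas_comp bg); apply: measurable_funD => //.
  by apply: measurable_funD.
pose G1 (z : R * R) := walk_op g (y + z.1).
have bG1 : bounded_meas G1.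
  by apply: (bounded_meas_comp bTg); apply: measurable_funD.
have bD := bounded_measB bG bG1.
have bD2 := bounded_measX 2 bD.
have bGx x : bounded_meas (fun z => G (x, z)) by exact: (@bounded_meas_shift g (y + x) bg).
have bGz z : bounded_meas (fun x => G (x, z)).
  apply: (bounded_meas_comp bg (g := fun x => y + x + z)).
  by apply: measurable_funD => //; apply: measurable_funD.
have bTy := bounded_meas_shift y bTg.
have E1 : expect w (fun x => expect w (fun z => (G (x, z) - G1 (x, z)) ^+ 2)) =
    walk_op (walk_op (fun x => g x ^+ 2)) y - walk_op (fun x => walk_op g x ^+ 2) y.
  rewrite /walk_op -expectB; last 2 first.
  - exact: (@bounded_meas_shift (walk_op (fun x => g x ^+ 2)) y (bounded_meas_walk bg2)).
  - exact: (@bounded_meas_shift (fun x => walk_op g x ^+ 2) y (bounded_measX 2 bTg)).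
  apply: eq_expect => x; rewrite (expect_sqrB (walk_op g (y + x)) (bGx x)).
  by rewrite -[expect w (fun z => G (x, z))]/(walk_op g (y + x)) /walk_op /G/=; ring.
have E2 : expect w (fun z => expect w (fun x => G (x, z) - G1 (x, z)) ^+ 2) =
    walk_op (fun x => walk_op g x ^+ 2) y - walk_op (walk_op g) y ^+ 2.
  have -> : (fun z => expect w (fun x => G (x, z) - G1 (x, z)) ^+ 2) =
      (fun z => (walk_op g (y + z) - walk_op (walk_op g) y) ^+ 2).
    apply/funext => z; rewrite expectB//; congr (( _ - _) ^+ _).
    by apply: eq_expect => x; rewrite /G/= addrAC.
  rewrite (expect_sqrB _ bTy) -[expect w (fun z => walk_op g (y + z))]/(walk_op (walk_op g) y).
  rewrite -[expect w (fun z => walk_op g (y + z) ^+ 2)]/(walk_op (fun x => walk_op g x ^+ 2) y).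
  ring.
have : expect w (fun z => expect w (fun x => G (x, z) - G1 (x, z)) ^+ 2) <=
       expect w (fun x => expect w (fun z => (G (x, z) - G1 (x, z)) ^+ 2)).
  rewrite (expect_exchange bD2); apply: le_expect.
  - apply: bounded_measX.
    apply: (bounded_meas_expect (H := fun z => G (z.2, z.1) - G1 (z.2, z.1))).
    apply: (bounded_meas_comp bD (g := fun z : R * R => (z.2, z.1))).
    exact: measurable_fun_pair.
  - apply: (bounded_meas_expect (H := fun z => (G (z.2, z.1) - G1 (z.2, z.1)) ^+ 2)).
    apply: (bounded_meas_comp bD2 (g := fun z : R * R => (z.2, z.1))).
    exact: measurable_fun_pair.
  - by move=> z; apply: sqr_expect_le; exact: bounded_measB.
by rewrite E1 E2; lra.
Qed.

End expectation.

(** Convexity makes the increments nondecreasing, so the first one is at most their average. *)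
Lemma convex_seq_chord {R : realType} (a : nat -> R) n :
  (forall j, (j.+2 <= n)%N -> 0 <= a j.+2 - 2 * a j.+1 + a j) ->
  (0 < n)%N -> n%:R * (a 1%N - a 0%N) <= a n - a 0%N.
Proof.
move=> cvx n0.
have inc j : (j < n)%N -> a 1%N - a 0%N <= a j.+1 - a j.
  elim: j => // j ih jn; apply: (le_trans (ih (ltnW jn))).
  by have := cvx j jn; lra.
suff H j : (j <= n)%N -> j%:R * (a 1%N - a 0%N) <= a j - a 0%N by exact: H.
elim: j => [|j ih] jn; first by rewrite mul0r subrr.
by have := ih (ltnW jn); have := inc j jn; rewrite -natr1 mulrDl mul1r; lra.
Qed.

Section efron_stein.
Context {R : realType}.
Variable w : R -> R.
Hypothesis dw : is_density w.

(* The [n] first-order projections of a function of the sum of [n] iid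
   variables are equal and their variances add up to at most its variance. *)
Lemma walk_projection_variance u n : bounded_meas u ->
  n.+1%:R * expect w (fun x => (iter n (walk_op w) u x - iter n.+1 (walk_op w) u 0) ^+ 2)
  <= iter n.+1 (walk_op w) (fun x => u x ^+ 2) 0.
Proof.
move=> bu.
pose T := walk_op w.
(* [a j] is the second moment of the conditional expectation of [u] of the sum given the first [j]
   variables. It goes from the squared mean at [j = 0] to the full second moment at [j = n.+1], and
   its first increment is the variance of one projection. *)
pose a j := iter j T (fun x => iter (n.+1 - j) T u x ^+ 2) 0.
have bi m : bounded_meas (iter m T u) by exact: bounded_meas_iter_walk.
have := @convex_seq_chord _ a n.+1 _ isT.
have -> : a n.+1 = iter n.+1 T (fun x => u x ^+ 2) 0 by rewrite /a subnn.
have -> : a 0%N = iter n.+1 T u 0 ^+ 2 by rewrite /a subn0.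
have -> : a 1%N = expect w (fun x => iter n T u x ^+ 2).
  by rewrite /a subn1/= /T /walk_op; apply: eq_expect => x; rewrite add0r.
move=> h.
have Eu : expect w (iter n T u) = iter n.+1 T u 0.
  by rewrite /= {2}/T /walk_op; apply: eq_expect => x; rewrite add0r.
rewrite expect_sqrB// -/T Eu.
have : forall x : R, x - 2 * iter n.+1 T u 0 * iter n.+1 T u 0 + iter n.+1 T u 0 ^+ 2
       = x - iter n.+1 T u 0 ^+ 2 by move=> x; ring.
move=> ->; apply: (le_trans (h _)); last by rewrite gerDl oppr_le0 sqr_ge0.
move=> j jn; rewrite /a.
have -> : (n.+1 - j)%N = (n.+1 - j.+2).+2 by rewrite -!subSn ?subSS ?(leqW jn).
have -> : (n.+1 - j.+1)%N = (n.+1 - j.+2).+1 by rewrite -subSn ?subSS.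
set g := iter (n.+1 - j.+2) T u.
have bg : bounded_meas g by exact: bounded_meas_iter_walk.
have bTg := bounded_meas_walk dw bg.
have bTTg := bounded_meas_walk dw bTg.
have b1 := bounded_meas_walk dw (bounded_meas_walk dw (bounded_measX 2 bg)).
have b2 := bounded_meas_walk dw (bounded_measX 2 bTg).
rewrite (iterSr j.+1) !(iterSr j) !iterS.
have -> : (iter j T (T (T (fun x => g x ^+ 2))) 0
  - 2 * iter j T (T (fun x => T g x ^+ 2)) 0 + iter j T (fun x => T (T g) x ^+ 2) 0) =
  iter j T (fun y => T (T (fun x => g x ^+ 2)) y + (-2) * T (fun x => T g x ^+ 2) y
     + T (T g) y ^+ 2) 0.
  rewrite iter_walkD//; last 2 first.
  - apply: bounded_measD => //; apply: bounded_measM => //; exact: bounded_meas_cst.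
  - exact: bounded_measX.
  rewrite iter_walkD//; last by apply: bounded_measM => //; exact: bounded_meas_cst.
  by rewrite iter_walkZ// mulNr.
apply: iter_walk_ge0 => // y.
by have := walk_op_convex dw y bg; rewrite -/T mulNr.
Qed.

End efron_stein.

(** * A Fourier minorant of an interval *)

Section calculus.
Context {R : realType}.
Notation mu := (@lebesgue_measure R).
Implicit Types (f F : R -> R).

Lemma is_derive_continuous F (x l : R) : is_derive x 1 F l -> {for x, continuous F}.
Proof. by case=> dF _; exact/differentiable_continuous/derivable1_diffP. Qed.

Lemma le_is_derive_ge0 F (dF : R -> R) (a b : R) : a <= b ->
  (forall x, a <= x <= b -> is_derive x 1 F (dF x)) ->
  (forall x, a < x < b -> 0 <= dF x) -> F a <= F b.
Proof.
rewrite le_eqVlt => /predU1P[->//|ab] dFx dF0.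
have [||c cab FE] := @MVT R F dF a b ab.
- by move=> x; rewrite in_itv/= => /andP[ax xb]; apply: dFx; rewrite !ltW.
- apply: continuous_in_subspaceT => x; rewrite inE/= in_itv/= => xab.
  exact/is_derive_continuous/dFx.
rewrite -subr_ge0 FE mulr_ge0 ?subr_ge0 ?(ltW ab)//.
by apply: dF0; move: cab; rewrite in_itv.
Qed.

Lemma is_derive_Rintegral f F (a b : R) : a < b ->
  (forall x, a <= x <= b -> is_derive x 1 F (f x)) ->
  {within `[a, b], continuous f} ->
  \int[mu]_(x in `[a, b]) f x = F b - F a.
Proof.
move=> ab dF cf; rewrite /Rintegral (@continuous_FTC2 _ f F)//.
- split.
  + by move=> x; rewrite in_itv/= => /andP[ax xb]; have /dF[] : a <= x <= b by rewrite !ltW.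
  + apply: cvg_at_right_filter; apply: is_derive_continuous.
    by apply: dF; rewrite lexx ltW.
  + apply: cvg_at_left_filter; apply: is_derive_continuous.
    by apply: dF; rewrite lexx ltW.
- move=> x; rewrite in_itv/= => /andP[ax xb]; rewrite derive1E.
  by have /dF[_ ->] : a <= x <= b by rewrite !ltW.
Qed.

(** This and the next three Taylor bounds are derived in a chain, each difference having the
    previous one as derivative; the start is [cos <= 1]. *)
Lemma sin_lex (x : R) : 0 <= x -> sin x <= x.
Proof.
move=> x0; rewrite -subr_ge0.
have := @le_is_derive_ge0 (fun y => y - sin y) (fun y => 1 - cos y) 0 x x0.
rewrite sin0 subr0; apply => y _.
by rewrite subr_ge0 cos_le1.
Qed.

Lemma cos_ge2 (x : R) : 1 - x ^+ 2 / 2 <= cos x.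
Proof.
wlog x0 : x / 0 <= x.
  move=> h; have [|/ltW x0] := leP 0 x; first exact: h.
  by have := h (- x); rewrite sqrrN cosN oppr_ge0; exact.
rewrite -subr_ge0.
have := @le_is_derive_ge0 (fun y => cos y - (1 - y ^+ 2 / 2)) (fun y => - sin y + y) 0 x x0.
rewrite cos0 expr0n/= mul0r subr0 subrr; apply => [y _|y /andP[/ltW y0 _]].
  by apply: is_derive_eq; rewrite /GRing.scale/=; field.
by rewrite addrC subr_ge0 sin_lex.
Qed.

Lemma sin_ge3 (x : R) : 0 <= x -> x - x ^+ 3 / 6 <= sin x.
Proof.
move=> x0; rewrite -subr_ge0.
have := @le_is_derive_ge0 (fun y => sin y - (y - y ^+ 3 / 6)) (fun y => cos y - (1 - y ^+ 2 / 2)) 0 x x0.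
rewrite sin0 expr0n/= mul0r !subr0; apply => [y _|y _].
  by apply: is_derive_eq; rewrite /GRing.scale/=; field.
by rewrite subr_ge0 cos_ge2.
Qed.

Lemma cos_le4 (x : R) : cos x <= 1 - x ^+ 2 / 2 + x ^+ 4 / 24.
Proof.
wlog x0 : x / 0 <= x.
  move=> h; have [|/ltW x0] := leP 0 x; first exact: h.
  have := h (- x); rewrite -[4%N]/(2 * 2)%N exprM sqrrN cosN oppr_ge0 -exprM; exact.
rewrite -subr_ge0.
have := @le_is_derive_ge0 (fun y => 1 - y ^+ 2 / 2 + y ^+ 4 / 24 - cos y)
  (fun y => sin y - (y - y ^+ 3 / 6)) 0 x x0.
rewrite cos0 !expr0n/= !mul0r subr0 addr0 subrr; apply => [y _|y /andP[/ltW y0 _]].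
  by apply: is_derive_eq; rewrite /GRing.scale/=; field.
by rewrite subr_ge0 sin_ge3.
Qed.

Lemma sin_near3 (x : R) : `|sin x - x| <= `|x| ^+ 3 / 6.
Proof.
wlog x0 : x / 0 <= x.
  move=> h; have [|/ltW x0] := leP 0 x; first exact: h.
  by have := h (- x); rewrite sinN -opprD !normrN oppr_ge0; exact.
rewrite (ger0_norm x0) ler_norml; have := sin_lex x0; have := sin_ge3 x0.
by have := exprn_ge0 3 x0; lra.
Qed.

End calculus.

(* [vhat] is the Fourier transform (up to a constant) of
   [(1 + cos (pi x)) (4 - 2 x^2) / (1 - x^2)^2], nonpositive for [x^2 >= 2]. *)
Section minorant.
Context {R : realType}.
Notation mu := (@lebesgue_measure R).

Definition vhat (s : R) := (pi - s) * cos s + 3 * sin s.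

Lemma continuous_vhat : continuous vhat.
Proof.
move=> s; apply: (@is_derive_continuous _ _ _ (- cos s - (pi - s) * sin s + 3 * cos s)).
by apply: is_derive_eq; rewrite /GRing.scale/=; ring.
Qed.

Lemma vhat_le s : 0 <= s <= pi -> vhat s <= pi + 3.
Proof.
move=> /andP[s0 sp]; apply: lerD; last by rewrite ler_piMr// sin_le1.
rewrite (le_trans (_ : _ <= (pi - s) * 1))//; last by rewrite mulr1 gerBl.
by rewrite ler_wpM2l ?subr_ge0 ?cos_le1.
Qed.

(** Where the cosine is negative, put [u = pi - s]: then [vhat s = (sin u - u * cos u) + 2 * sin u],
    and the bracket has derivative [u * sin u]. Nonnegativity lets [vhat] serve as a weight on
    frequencies. *)
Lemma vhat_ge0 s : 0 <= s <= pi -> 0 <= vhat s.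
Proof.
move=> /andP[s0 sp].
have si0 : 0 <= sin s by apply: sin_ge0_pi; rewrite s0 sp.
have [c0|/ltW c0] := leP 0 (cos s).
  by rewrite addr_ge0// mulr_ge0// subr_ge0.
pose u := pi - s.
have u0 : 0 <= u by rewrite subr_ge0.
have cu : cos s = - cos u by rewrite cosB cospi sinpi; ring.
have su : sin s = sin u by rewrite sinB cospi sinpi; ring.
have : 0 <= sin u - u * cos u.
  have := @le_is_derive_ge0 R (fun y => sin y - y * cos y) (fun y => y * sin y) 0 u u0.
  rewrite sin0 mul0r subrr; apply => [y _|y /andP[y0 yu]].
    by apply: is_derive_eq; rewrite /GRing.scale/=; ring.
  by rewrite mulr_ge0 ?(ltW y0)// sin_ge0_pi// !ltW//= (lt_le_trans yu)// gerBl.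
by rewrite /vhat -/u cu; rewrite su in si0 *; lra.
Qed.

Lemma vhat_ge1 s : 0 <= s <= 1 -> 1 <= vhat s.
Proof.
move=> /andP[s0 s1]; have := pi_ge2 R; have := cos_ge2 s; have := sin_ge3 s0.
rewrite /vhat => h1 h2 h3.
have p0 : 0 <= s ^+ 2 by exact: sqr_ge0.
have p1 : s ^+ 2 <= s by rewrite expr2 ler_piMr.
have p3 : s ^+ 3 <= s by rewrite exprS ler_piMr// exprn_ile1.
have : (2 - s) * (1 - s ^+ 2 / 2) <= (pi - s) * cos s.
  by apply: ler_pM => //; lra.
by nra.
Qed.

Lemma vhat_cos_integral (x : R) : 2 <= x ^+ 2 ->
  \int[mu]_(s in `[0, pi]) (vhat s * cos (x * s)) <= 0.
Proof.
move=> x2.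
(* The closed form of the integral has removable singularities at 1 and -1, which [x ^+ 2 >= 2]
   excludes. *)
have p0 : 1 + x != 0 by apply/eqP => p0; move: x2; (have -> : x = -1 by lra); lra.
have q0 : 1 - x != 0 by apply/eqP => q0; move: x2; (have -> : x = 1 by lra); lra.
pose p := 1 + x; pose q := 1 - x.
(* Antiderivative obtained from the product-to-sum formulas, with one integration by parts for the
   factor [pi - s]. *)
pose F s := ((pi - s) * (sin (p * s) / p + sin (q * s) / q)
    - cos (p * s) / p ^+ 2 - cos (q * s) / q ^+ 2) / 2
    - 3 / 2 * (cos (p * s) / p + cos (q * s) / q).
have dF s : 0 <= s <= pi -> is_derive s 1 F (vhat s * cos (x * s)).
  move=> _; apply: is_derive_eq; rewrite /GRing.scale/= /vhat.
  have cc (u v : R) : cos u * cos v = (cos (u + v) + cos (u - v)) / 2.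
    by rewrite cosD cosB; field.
  have sc (u v : R) : sin u * cos v = (sin (u + v) + sin (u - v)) / 2.
    by rewrite sinD sinB; field.
  have -> : p * s = s + x * s by rewrite /p; ring.
  have -> : q * s = s - x * s by rewrite /q; ring.
  have -> : ((pi - s) * cos s + 3 * sin s) * cos (x * s) =
      (pi - s) * (cos s * cos (x * s)) + 3 * (sin s * cos (x * s)) by ring.
  by rewrite cc sc; field; rewrite p0 q0.
have cf : {within `[0, pi], continuous (fun s => vhat s * cos (x * s))}.
  apply: continuous_subspaceT => s; apply: continuousM; first exact: continuous_vhat.
  apply: (@is_derive_continuous _ _ _ (- x * sin (x * s))).
  by apply: is_derive_eq; rewrite /GRing.scale/=; ring.
rewrite (is_derive_Rintegral (pi_gt0 R) dF cf).
rewrite /F subrr !mul0r !subr0 !mulr0 !sin0 !cos0 !mul0r addr0 mulr0.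
have -> : cos (p * pi) = - cos (x * pi) by rewrite mulrDl mul1r cosD cospi sinpi; ring.
have -> : cos (q * pi) = - cos (x * pi) by rewrite mulrBl mul1r cosB cospi sinpi; ring.
set c := cos (x * pi).
have -> : (0 - - c / p ^+ 2 - - c / q ^+ 2) / 2 - 3 / 2 * (- c / p + - c / q) -
  ((0 - 1 / p ^+ 2 - 1 / q ^+ 2) / 2 - 3 / 2 * (1 / p + 1 / q)) =
  - ((1 + c) * (2 * x ^+ 2 - 4) / (p * q) ^+ 2).
  by rewrite /p /q; field; rewrite p0 q0.
rewrite oppr_le0 divr_ge0 ?sqr_ge0// mulr_ge0//.
  by have := cos_geN1 (x * pi); rewrite -/c; lra.
lra.
Qed.

End minorant.

(** * Powers of a complex number *)

Section rotation.
Context {R : realType}.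
Implicit Types (al be : R).

(* Real and imaginary parts of [(al + i be)^n]. *)
Definition rot al be n : R * R :=
  iter n (fun z => (al * z.1 - be * z.2, al * z.2 + be * z.1)) (1, 0).

Lemma rotS al be n : rot al be n.+1 = (al * (rot al be n).1 - be * (rot al be n).2,
  al * (rot al be n).2 + be * (rot al be n).1).
Proof. by []. Qed.

Lemma rot_norm al be n :
  (rot al be n).1 ^+ 2 + (rot al be n).2 ^+ 2 = (al ^+ 2 + be ^+ 2) ^+ n.
Proof.
elim: n => [|n ih]; first by rewrite /= expr1n !expr0 expr0n addr0.
by rewrite rotS [in RHS]exprS -ih /=; ring.
Qed.

Lemma rot1_le1 al be n : al ^+ 2 + be ^+ 2 <= 1 -> `|(rot al be n).1| <= 1.
Proof.
move=> ab1; rewrite -(@ler_pXn2r _ 2)// ?nnegrE// expr1n real_normK ?num_real//.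
have : (rot al be n).1 ^+ 2 + (rot al be n).2 ^+ 2 <= 1.
  by rewrite rot_norm exprn_ile1// addr_ge0 ?sqr_ge0.
by have := sqr_ge0 (rot al be n).2; lra.
Qed.

Lemma rot2_le al be n : 0 <= al <= 1 -> al ^+ 2 + be ^+ 2 <= 1 ->
  `|(rot al be n).2| <= n%:R * `|be|.
Proof.
move=> /andP[a0 a1] ab1; elim: n => [|n ih]; first by rewrite normr0 mul0r.
rewrite rotS /= (le_trans (ler_normD _ _))// !normrM (ger0_norm a0).
rewrite -natr1 mulrDl mul1r lerD//.
  by rewrite (le_trans _ ih)// ler_piMl.
by rewrite ler_piMr// rot1_le1.
Qed.

(** Each step multiplies the real part by [al] and subtracts [be] times the imaginary part, which by
    [rot2_le] is a loss of at most [n%:R * be ^+ 2]. These losses add up to less than the square. *)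
Lemma rot1_ge al be n : 0 <= al <= 1 -> al ^+ 2 + be ^+ 2 <= 1 ->
  al ^+ n - (n%:R * be) ^+ 2 <= (rot al be n).1.
Proof.
move=> /andP[a0 a1] ab1; elim: n => [|n ih].
  by rewrite /= mul0r expr0n/= subr0.
rewrite rotS /=.
have b2 : be * (rot al be n).2 <= n%:R * be ^+ 2.
  rewrite (le_trans (ler_norm _))// normrM.
  rewrite -(real_normK (num_real be)) expr2 mulrA [X in _ <= X]mulrC.
  by rewrite ler_wpM2l// rot2_le// a0 a1.
have : al * (al ^+ n - (n%:R * be) ^+ 2) <= al * (rot al be n).1 by rewrite ler_wpM2l.
rewrite mulrBr -exprS => h.
have : al * (n%:R * be) ^+ 2 <= (n%:R * be) ^+ 2 by rewrite ler_piMl// sqr_ge0.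
have : 0 <= n%:R * be ^+ 2 by rewrite mulr_ge0// sqr_ge0.
have : (n.+1%:R * be) ^+ 2 = (n%:R * be) ^+ 2 + 2 * (n%:R * be ^+ 2) + be ^+ 2.
  by rewrite -natr1; ring.
by have := sqr_ge0 be; lra.
Qed.

(** [al] and [be] stand for the real and imaginary part of a characteristic function at frequency
    [u], known through Taylor bounds. Since [be] is cubic in [u], it does not spoil the quadratic
    decrease of the modulus. *)
Lemma small_frequency_bounds (v0 C2 C4 D al be u : R) n :
  0 < v0 -> 0 < C2 -> 0 < C4 -> 0 < D ->
  0 <= u -> u <= 1 -> C4 * u ^+ 2 <= 6 * v0 -> C2 * u ^+ 2 <= 1 ->
  8 * D ^+ 2 * u <= v0 -> v0 * u ^+ 2 <= 8 ->
  1 - C2 * u ^+ 2 / 2 <= al <= 1 - v0 * u ^+ 2 / 2 + C4 * u ^+ 4 / 24 ->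
  `|be| <= D * u ^+ 3 ->
  [/\ 0 <= al, al <= 1, al ^+ 2 + be ^+ 2 <= 1 - v0 * u ^+ 2 / 8 &
      (n%:R * be) ^+ 2 <= D ^+ 2 * (n%:R * u ^+ 2) ^+ 2 * u ^+ 2].
Proof.
move=> v00 C20 C40 D0 u0 u1 h4 h2 hD hv /andP[al_ge al_le] be_le.
have u20 := sqr_ge0 u.
have al0 : 0 <= al by lra.
have al1' : al <= 1 - v0 * u ^+ 2 / 4.
  have : C4 * u ^+ 2 * u ^+ 2 <= 6 * v0 * u ^+ 2 by rewrite ler_wpM2r.
  have -> : C4 * u ^+ 2 * u ^+ 2 = C4 * u ^+ 4 by ring.
  lra.
have vu : 0 <= v0 * u ^+ 2 by rewrite mulr_ge0// ltW.
have al1 : al <= 1 by lra.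
have be2 : be ^+ 2 <= D ^+ 2 * u ^+ 6.
  have -> : D ^+ 2 * u ^+ 6 = (D * u ^+ 3) ^+ 2 by ring.
  rewrite -(real_normK (num_real be)) ler_pXn2r// ?nnegrE//.
  by rewrite mulr_ge0 ?exprn_ge0// ltW.
split => //.
- have : al ^+ 2 <= al by rewrite expr2 ler_piMr.
  have : D ^+ 2 * u ^+ 6 <= D ^+ 2 * u ^+ 3.
    rewrite ler_wpM2l ?sqr_ge0// -[6%N]/(3 + 3)%N exprD ler_piMr ?exprn_ge0//.
    by rewrite exprn_ile1.
  have : 8 * D ^+ 2 * u * u ^+ 2 <= v0 * u ^+ 2 by rewrite ler_wpM2r.
  have -> : 8 * D ^+ 2 * u * u ^+ 2 = 8 * (D ^+ 2 * u ^+ 3) by ring.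
  lra.
- rewrite exprMn (le_trans (ler_wpM2l (sqr_ge0 _) be2))//.
  by rewrite le_eqVlt; apply/orP; left; apply/eqP; ring.
Qed.

End rotation.

(** * Characteristic functions and the walk operator *)

Section characteristic_function.
Context {R : realType}.
Notation mu := (@lebesgue_measure R).
Variables (w : R -> R) (a sg : R).
Hypothesis dw : is_density w.

Definition ecos u := expect w (fun x => cos (u * ((x - a) / sg))).
Definition esin u := expect w (fun x => sin (u * ((x - a) / sg))).

Lemma measurable_fun_cos d (T : measurableType d) (f : T -> R) :
  measurable_fun setT f -> bounded_meas (fun x => cos (f x)).
Proof.
move=> mf; split; last by exists 1 => x; exact: cos_max.
by apply: measurableT_comp mf; apply: continuous_measurable_fun; exact: continuous_cos.
Qed.

Lemma measurable_fun_sin d (T : measurableType d) (f : T -> R) :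
  measurable_fun setT f -> bounded_meas (fun x => sin (f x)).
Proof.
move=> mf; split; last by exists 1 => x; exact: sin_max.
by apply: measurableT_comp mf; apply: continuous_measurable_fun; exact: continuous_sin.
Qed.

Let mphase u : measurable_fun setT (fun x : R => u * ((x - a) / sg)).
Proof.
by apply: measurable_funM => //; apply: measurable_funM => //; exact: measurable_funB.
Qed.

Lemma bounded_meas_ecos r : bounded_meas (fun s : R => ecos (r * s)).
Proof.
apply: (bounded_meas_expect dw (H := fun z : R * R => cos (r * z.1 * ((z.2 - a) / sg)))).
apply: measurable_fun_cos; apply: measurable_funM; first exact: measurable_funM.
by apply: measurable_funM => //; apply: measurable_funB.
Qed.

Lemma bounded_meas_esin r : bounded_meas (fun s : R => esin (r * s)).
Proof.
apply: (bounded_meas_expect dw (H := fun z : R * R => sin (r * z.1 * ((z.2 - a) / sg)))).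
apply: measurable_fun_sin; apply: measurable_funM; first exact: measurable_funM.
by apply: measurable_funM => //; apply: measurable_funB.
Qed.

Definition erot u n := rot (ecos u) (esin u) n.

Lemma bounded_meas_erot r n :
  bounded_meas (fun s : R => (erot (r * s) n).1) /\ bounded_meas (fun s : R => (erot (r * s) n).2).
Proof.
have bc := bounded_meas_ecos r; have bs := bounded_meas_esin r.
elim: n => [|n [ih1 ih2]]; first by split; exact: bounded_meas_cst.
rewrite /erot; split; under eq_fun do rewrite rotS /=.
  by apply: bounded_measB; exact: bounded_measM.
by apply: bounded_measD; exact: bounded_measM.
Qed.

(** Integrating out one step multiplies [A + i B] by the characteristic function
    [ecos u + i esin u]; this is the recursion of [rot]. *)
Lemma expect_phase u c A B :
  expect w (fun x => A * cos (u * ((x - a) / sg) + c) - B * sin (u * ((x - a) / sg) + c)) =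
  (ecos u * A - esin u * B) * cos c - (ecos u * B + esin u * A) * sin c.
Proof.
have bc := measurable_fun_cos (mphase u); have bs := measurable_fun_sin (mphase u).
have -> : expect w (fun x => A * cos (u * ((x - a) / sg) + c) - B * sin (u * ((x - a) / sg) + c))
    = expect w (fun x => (A * cos c - B * sin c) * cos (u * ((x - a) / sg))
        + (- (A * sin c + B * cos c)) * sin (u * ((x - a) / sg))).
  by apply: eq_expect => x; rewrite cosD sinD; ring.
rewrite (expectD dw); last 2 first.
  by apply: bounded_measM => //; exact: bounded_meas_cst.
  by apply: bounded_measM => //; exact: bounded_meas_cst.
by rewrite !(expectZ dw)// -/(ecos u) -/(esin u); ring.
Qed.

(** The walk operator is diagonal in frequency: [n] steps multiply each mode by the n-th power of
    the characteristic function. As the steps are centred at [a], the argument moves by [n%:R * a].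
    Fubini exchanges the frequency integral with each step. *)
Lemma iter_walk_trig (om : R -> R) (r th : R) n y :
  mu.-integrable setT (EFin \o om) ->
  iter n (walk_op w) (fun y => \int[mu]_s (om s * cos (r * s * ((y - th) / sg)))) y =
  \int[mu]_s (om s * ((erot (r * s) n).1 * cos (r * s * ((y + n%:R * a - th) / sg))
                    - (erot (r * s) n).2 * sin (r * s * ((y + n%:R * a - th) / sg)))).
Proof.
move=> iom; elim: n y => [|n ih] y.
  by apply: eq_Rintegral => s _; rewrite /erot /rot/= !mul0r subr0 mul1r addr0.

rewrite iterS /walk_op /expect.
under eq_Rintegral do rewrite ih.
pose H (z : R * R) :=
  (erot (r * z.2) n).1 * cos (r * z.2 * ((y + z.1 + n%:R * a - th) / sg))
  - (erot (r * z.2) n).2 * sin (r * z.2 * ((y + z.1 + n%:R * a - th) / sg)).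
have [b1 b2] := bounded_meas_erot r n.
have mph : measurable_fun setT (fun z : R * R => r * z.2 * ((y + z.1 + n%:R * a - th) / sg)).
  apply: measurable_funM; first exact: measurable_funM.
  apply: measurable_funM => //; apply: measurable_funB => //.
  by apply: measurable_funD => //; exact: measurable_funD.
have bH : bounded_meas H.
  apply: bounded_measB; apply: bounded_measM.
  - by apply: (bounded_meas_comp b1 (g := snd)); exact: measurable_snd.
  - exact: measurable_fun_cos.
  - by apply: (bounded_meas_comp b2 (g := snd)); exact: measurable_snd.
  - exact: measurable_fun_sin.
have [_ iw _] := dw.
rewrite (weighted_fubini iw iom bH); apply: eq_Rintegral => s _; congr (_ * _).
pose c := r * s * ((y + n.+1%:R * a - th) / sg).
rewrite /erot rotS -/(erot _ _)/= -(expect_phase (r * s) c) /expect.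
apply: eq_Rintegral => x _; congr (_ * _); rewrite /H/=.
have -> // : r * s * ((y + x + n%:R * a - th) / sg) = r * s * ((x - a) / sg) + c.
by rewrite /c -natr1; ring.
Qed.

End characteristic_function.

(** * Decay of powers of a characteristic function *)

Section decay.
Context {R : realType}.
Notation mu := (@lebesgue_measure R).

Lemma bernoulli_ge (x : R) n : 0 <= x <= 1 -> 1 - n%:R * x <= (1 - x) ^+ n.
Proof.
move=> /andP[x0 x1]; elim: n => [|n ih]; first by rewrite mul0r subr0.
have : (1 - x) * (1 - n%:R * x) <= (1 - x) ^+ n.+1 by rewrite exprS ler_wpM2l ?subr_ge0.
have : 0 <= n%:R * (x * x) by rewrite mulr_ge0// mulr_ge0.
by rewrite -natr1; lra.
Qed.

Variables (v0 C2 C4 D rho : R).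
Hypotheses (v00 : 0 < v0) (C20 : 0 < C2) (C40 : 0 < C4) (D0 : 0 < D) (rho0 : 0 < rho).
Hypotheses (rpi : rho * pi <= 1) (r4 : C4 * (rho * pi) <= 6 * v0)
  (r2 : C2 * (rho * pi) <= 1) (rD : 8 * D ^+ 2 * (rho * pi) <= v0)
  (rv : v0 * (rho * pi) <= 8) (rh2 : 2 * C2 * rho ^+ 2 <= 1) (rhD : 2 * D * rho ^+ 2 <= 1).

(** The second summand bounds the fourth power of the quantity estimated in [rot1_ge_decay]. The 1
    ensures that the constant is at most its own fourth power. *)
Definition decay_const := 1 + 16 * D ^+ 4 * (1 + 80 / v0) ^+ 10.

Lemma decay_const_ge1 : 1 <= decay_const.
Proof.
by rewrite lerDl mulr_ge0 ?exprn_ge0 ?mulr_ge0 ?addr_ge0 ?divr_ge0 ?exprn_ge0// ltW.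
Qed.

(** The geometric factor is at most [expR (- v0 * X / 8)], split here into ten equal factors, one
    against each [1 + X]: with [c = v0 / 80], [(1 + X) * expR (- c * X) <= 1 + 1 / c]. *)
Lemma geom_poly_decay (X : R) n : 0 <= X -> v0 * X <= 8 * n.+1%:R ->
  (1 - v0 * X / (8 * n.+1%:R)) ^+ n.+1 * (1 + X) ^+ 10 <= (1 + 80 / v0) ^+ 10.
Proof.
move=> X0 XN.
have N0 : (0 : R) < n.+1%:R by rewrite ltr0n.
pose c := v0 / 80; have c0 : 0 < c by rewrite divr_gt0.
have q0 : 0 <= 1 - v0 * X / (8 * n.+1%:R).
  by rewrite subr_ge0 ler_pdivrMr ?mulr_gt0// mul1r.
have qe : 1 - v0 * X / (8 * n.+1%:R) <= expR (- (v0 * X / (8 * n.+1%:R))).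
  exact: expR_ge1Dx.
have qN : (1 - v0 * X / (8 * n.+1%:R)) ^+ n.+1 <= expR (- (c * X)) ^+ 10.
  apply: (le_trans (lerXn2r _ _ _ qe)); rewrite ?nnegrE ?expR_ge0//.
  rewrite -!expRM_natl ler_expR le_eqVlt; apply/orP; left; apply/eqP.
  by rewrite /c; move: (n.+1%:R : R) N0 => N N0; field; rewrite gt_eqF.
apply: (le_trans (ler_wpM2r _ qN)); first by rewrite exprn_ge0// addr_ge0.
rewrite -exprMn lerXn2r ?nnegrE ?mulr_ge0 ?expR_ge0 ?addr_ge0 ?divr_ge0 ?(ltW v00)//.
rewrite expRN mulrC ler_pdivrMr ?expR_gt0//.
apply: (le_trans _ (ler_wpM2l _ (expR_ge1Dx (c * X)))); last first.
  by rewrite addr_ge0// divr_ge0// ltW.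
have -> : (1 + 80 / v0) * (1 + c * X) = 1 + X + (c * X + 80 / v0).
  by rewrite /c; field; rewrite gt_eqF.
by rewrite lerDl; apply: addr_ge0; [rewrite mulr_ge0// ltW|rewrite divr_ge0// ltW].
Qed.

Section fixed_frequency.
Variables (al be s : R).
Hypothesis s0pi : 0 <= s <= pi.
Let u := rho * s.
Hypothesis al_b : 1 - C2 * u ^+ 2 / 2 <= al <= 1 - v0 * u ^+ 2 / 2 + C4 * u ^+ 4 / 24.
Hypothesis be_b : `|be| <= D * u ^+ 3.

Let u0 : 0 <= u. Proof. by case/andP: s0pi => s0 _; rewrite mulr_ge0// ltW. Qed.
Let upi : u <= rho * pi. Proof. by case/andP: s0pi => _ ?; rewrite ler_pM2l. Qed.
Let u1 : u <= 1. Proof. exact: le_trans rpi. Qed.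
Let u2u : u ^+ 2 <= rho * pi.
Proof. by rewrite (le_trans _ upi)// expr2 ler_piMr. Qed.

Let bounds n : [/\ 0 <= al, al <= 1, al ^+ 2 + be ^+ 2 <= 1 - v0 * u ^+ 2 / 8 &
      (n%:R * be) ^+ 2 <= D ^+ 2 * (n%:R * u ^+ 2) ^+ 2 * u ^+ 2].
Proof.
apply: (@small_frequency_bounds R v0 C2 C4 D) => //.
- by rewrite (le_trans _ r4)// ler_pM2l.
- by rewrite (le_trans _ r2)// ler_pM2l.
- by rewrite (le_trans _ rD)// ler_pM2l// mulr_gt0// exprn_gt0.
- by rewrite (le_trans _ rv)// ler_pM2l.
Qed.

(** For such frequencies [al ^+ n] is at least 3/4 by Bernoulli's inequality, and the loss due to
    the phase is at most 1/4; the last two conditions on [rho] are made for this. *)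
Lemma rot1_ge_half n : n%:R * u ^+ 2 <= rho ^+ 2 -> 1 / 2 <= (rot al be n).1.
Proof.
move=> nu; have [a0 a1 ab be2] := bounds n.
have vu : 0 <= v0 * u ^+ 2 by rewrite mulr_ge0 ?sqr_ge0// ltW.
have ab1 : al ^+ 2 + be ^+ 2 <= 1 by lra.
have := @rot1_ge _ al be n; rewrite a0 a1 => /(_ isT ab1) h.
have aln : 1 - n%:R * (C2 * u ^+ 2 / 2) <= al ^+ n.
  have x01 : 0 <= C2 * u ^+ 2 / 2 <= 1.
    have : 0 <= C2 * u ^+ 2 by rewrite mulr_ge0 ?sqr_ge0// ltW.
    have : C2 * u ^+ 2 <= 1 by rewrite (le_trans _ r2)// ler_pM2l.
    lra.
  apply: (le_trans (bernoulli_ge n x01)); rewrite lerXn2r ?nnegrE//.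
    by case/andP: x01; lra.
  by case/andP: al_b.
have e1 : n%:R * (C2 * u ^+ 2 / 2) <= 1 / 4.
  have : C2 * (n%:R * u ^+ 2) <= C2 * rho ^+ 2 by rewrite ler_pM2l.
  by have := rh2; lra.
have e2 : (n%:R * be) ^+ 2 <= 1 / 4.
  apply: (le_trans be2).
  have nu0 : 0 <= n%:R * u ^+ 2 by rewrite mulr_ge0 ?sqr_ge0.
  have Dr : D * rho ^+ 2 <= 1 / 2 by have := rhD; lra.
  have Dn : D * (n%:R * u ^+ 2) <= 1 / 2 by rewrite (le_trans _ Dr)// ler_pM2l.
  have Dn0 : 0 <= D * (n%:R * u ^+ 2) by rewrite mulr_ge0// ltW.
  have -> : D ^+ 2 * (n%:R * u ^+ 2) ^+ 2 * u ^+ 2 =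
    (D * (n%:R * u ^+ 2)) ^+ 2 * u ^+ 2 by ring.
  have u21 : u ^+ 2 <= 1 by rewrite expr_le1.
  apply: (@le_trans _ _ ((D * (n%:R * u ^+ 2)) ^+ 2)).
    by rewrite ler_piMr// sqr_ge0.
  have -> : 1 / 4 = (1 / 2) ^+ 2 :> R by field.
  by rewrite lerXn2r ?nnegrE.
lra.
Qed.

(** Only the negative part matters, and it has two bounds. The phase bound
    [D ^+ 2 * X ^+ 2 * u ^+ 2], with [X] the frequency squared times [n.+1], is small because
    [u ^+ 2 = X / n.+1]; the modulus bound decays exponentially in [X]. Their geometric mean gains a
    factor [1 / sqrt n.+1] and keeps integrability in [s]. *)
Lemma rot1_ge_decay n :
  - (decay_const / (Num.sqrt n.+1%:R * (1 + rho * Num.sqrt n.+1%:R * s) ^+ 2))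
  <= (rot al be n.+1).1.
Proof.
set r := Num.sqrt n.+1%:R; set A := (rot al be n.+1).1.
have N0 : (0 : R) < n.+1%:R by rewrite ltr0n.
have r0 : 0 < r by rewrite sqrtr_gt0.
have r2N : r ^+ 2 = n.+1%:R by rewrite sqr_sqrtr// ltW.
have s0 : 0 <= s by case/andP: s0pi.
have K0 : 0 < decay_const by apply: lt_le_trans decay_const_ge1.
have y0 : 0 <= rho * r * s by rewrite !mulr_ge0// ltW.
have den0 : 0 < r * (1 + rho * r * s) ^+ 2.
  by rewrite mulr_gt0// exprn_gt0// ltr_pwDl.
have [A0|A0] := leP 0 A.
  by apply: le_trans A0; rewrite oppr_le0 divr_ge0// ltW.
have [a0 a1 ab be2] := bounds n.+1.
have vu : 0 <= v0 * u ^+ 2 by rewrite mulr_ge0 ?sqr_ge0// ltW.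
have ab1 : al ^+ 2 + be ^+ 2 <= 1 by lra.
pose X := n.+1%:R * u ^+ 2.
have X0 : 0 <= X by rewrite mulr_ge0 ?sqr_ge0.
have A1 : - A <= D ^+ 2 * X ^+ 2 * u ^+ 2.
  have := @rot1_ge _ al be n.+1; rewrite a0 a1 => /(_ isT ab1).
  by have := exprn_ge0 n.+1 a0; rewrite -/A /X; lra.
have A2 : (- A) ^+ 2 <= (1 - v0 * u ^+ 2 / 8) ^+ n.+1.
  rewrite sqrrN; apply: (@le_trans _ _ ((al ^+ 2 + be ^+ 2) ^+ n.+1)).
    by rewrite -rot_norm lerDl sqr_ge0.
  have ab0 : 0 <= al ^+ 2 + be ^+ 2 by rewrite addr_ge0 ?sqr_ge0.
  by rewrite lerXn2r ?nnegrE//; exact: le_trans ab.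
rewrite lerNl ler_pdivlMr//.
have nA0 : 0 <= - A by rewrite oppr_ge0 ltW.
(* In fourth powers the two bounds on [(- A) ^+ 2] can simply be multiplied. *)
rewrite -(@ler_pXn2r _ 4)// ?nnegrE ?(ltW K0)//; last by rewrite mulr_ge0 ?(ltW den0).
apply: (@le_trans _ _ decay_const); last first.
  rewrite -{1}[decay_const]expr1 ler_weXn2l//; exact: decay_const_ge1.
have yX : (rho * r * s) ^+ 2 = X by rewrite /X -r2N /u; ring.
have E1 : ((1 + rho * r * s) ^+ 2) ^+ 4 <= 16 * (1 + X) ^+ 4.
  have -> : 16 * (1 + X) ^+ 4 = (2 * (1 + X)) ^+ 4 by rewrite exprMn; congr (_ * _); ring.
  rewrite lerXn2r ?nnegrE ?sqr_ge0 ?mulr_ge0 ?addr_ge0//.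
  by rewrite -yX; have := sqr_ge0 (1 - rho * r * s); lra.
have A4 : (- A) ^+ 4 * r ^+ 4 <= D ^+ 4 * X ^+ 6 * (1 - v0 * u ^+ 2 / 8) ^+ n.+1.
  have A1' : (- A) ^+ 2 <= (D ^+ 2 * X ^+ 2 * u ^+ 2) ^+ 2.
    by rewrite lerXn2r// nnegrE// !mulr_ge0 ?exprn_ge0// ltW.
  have -> : (- A) ^+ 4 * r ^+ 4 = (- A) ^+ 2 * (- A) ^+ 2 * (r ^+ 2) ^+ 2 by ring.
  have -> : D ^+ 4 * X ^+ 6 * (1 - v0 * u ^+ 2 / 8) ^+ n.+1 =
     (D ^+ 2 * X ^+ 2 * u ^+ 2) ^+ 2 * (1 - v0 * u ^+ 2 / 8) ^+ n.+1 * (r ^+ 2) ^+ 2.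
    by rewrite r2N /X; ring.
  by rewrite ler_wpM2r ?sqr_ge0// ler_pM ?sqr_ge0.
have -> : (- A * (r * (1 + rho * r * s) ^+ 2)) ^+ 4 =
  ((- A) ^+ 4 * r ^+ 4) * ((1 + rho * r * s) ^+ 2) ^+ 4 by ring.
have G : (1 - v0 * u ^+ 2 / 8) ^+ n.+1 * (1 + X) ^+ 10 <= (1 + 80 / v0) ^+ 10.
  have := @geom_poly_decay X n X0.
  have -> : v0 * X / (8 * n.+1%:R) = v0 * u ^+ 2 / 8 by rewrite /X; move: (n.+1%:R : R) N0 => N N0; field; rewrite gt_eqF.
  apply; have -> : v0 * X = v0 * u ^+ 2 * n.+1%:R by rewrite /X; ring.
  by rewrite ler_wpM2r// (le_trans _ rv)// ler_pM2l.
have q0 : 0 <= (1 - v0 * u ^+ 2 / 8) ^+ n.+1 by rewrite (le_trans _ A2)// sqr_ge0.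
apply: (@le_trans _ _ (D ^+ 4 * X ^+ 6 * (1 - v0 * u ^+ 2 / 8) ^+ n.+1 * (16 * (1 + X) ^+ 4))).
  apply: ler_pM => //.
  - by apply: mulr_ge0; apply: exprn_ge0 => //; exact: ltW.
  - by apply: exprn_ge0; exact: sqr_ge0.
have X6 : X ^+ 6 <= (1 + X) ^+ 6 by rewrite lerXn2r ?nnegrE ?addr_ge0// lerDr.
apply: (@le_trans _ _ (16 * D ^+ 4 * ((1 - v0 * u ^+ 2 / 8) ^+ n.+1 * (1 + X) ^+ 10))).
  have -> : 16 * D ^+ 4 * ((1 - v0 * u ^+ 2 / 8) ^+ n.+1 * (1 + X) ^+ 10) =
    D ^+ 4 * (1 + X) ^+ 6 * (1 - v0 * u ^+ 2 / 8) ^+ n.+1 * (16 * (1 + X) ^+ 4) by ring.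
  apply: ler_wpM2r; first by rewrite mulr_ge0// exprn_ge0// addr_ge0.
  by apply: ler_wpM2r => //; apply: ler_wpM2l => //; exact/exprn_ge0/ltW.
apply: (@le_trans _ _ (16 * D ^+ 4 * (1 + 80 / v0) ^+ 10)).
  by rewrite ler_wpM2l// mulr_ge0// exprn_ge0// ltW.
by rewrite /decay_const lerDr.
Qed.

End fixed_frequency.
End decay.

(** * Integrals of exponentials *)

Section exponential_integrals.
Context {R : realType}.
Notation mu := (@lebesgue_measure R).

Lemma continuous_expR_affine (r b : R) : continuous (fun x => expR (r * (x - b))).
Proof.
move=> x; apply: (@is_derive_continuous _ _ _ (r * expR (r * (x - b)))).
by apply: is_derive_eq; rewrite /GRing.scale/=; ring.
Qed.

Lemma integral_expR_ray (r b : R) : 0 < r ->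
  (\int[mu]_(x in `[b, +oo[) (expR (- r * (x - b)))%:E = r^-1%:E)%E.
Proof.
move=> r0.
have dF (x : R) : is_derive x 1 (fun x => - (expR (- r * (x - b)) / r)) (expR (- r * (x - b))).
  by apply: is_derive_eq; rewrite /GRing.scale/=; field; rewrite gt_eqF.
rewrite (@ge0_continuous_FTC2y _ _ (fun x => - (expR (- r * (x - b)) / r)) b 0).
- by rewrite subrr mulr0 expR0 mul1r sub0e EFinN oppeK.
- by move=> x _; exact: expR_ge0.
- by apply: continuous_subspaceT; exact: continuous_expR_affine.
- rewrite -oppr0; apply: cvgN; rewrite -(mul0r r^-1); apply: cvgMl.
  have -> : (fun x => expR (- r * (x - b))) = (fun x => expR (- x)) \o (fun x => r * (x - b)).
    by apply/funext => x/=; rewrite mulNr.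
  apply: cvg_comp; last exact: cvgr_expR.
  by apply: gt0_cvgMry => //; exact: cvg_addrr.
- by move=> x _; case: (dF x).
- by apply: cvg_at_right_filter; exact: is_derive_continuous.
- by move=> x _; rewrite derive1E; case: (dF x).
Qed.

Lemma integral_expR_norm (r b : R) : 0 < r ->
  (\int[mu]_x (expR (- (r * `|x - b|)))%:E = (2 / r)%:E)%E.
Proof.
move=> r0.
have cn (c : R) : continuous (fun x => expR (- (r * `|x - c|))).
  move=> x; apply: continuous_comp; last exact: continuous_expR.
  apply: continuousN; apply: continuousM; first exact: cst_continuous.
  apply: continuous_comp; last exact: norm_continuous.
  by apply: continuousB => //; exact: cst_continuous.
have d1 : derive1 (fun x : R => x + b) = cst 1.
  apply/funext => x; rewrite derive1E.
  have dx : is_derive x 1 (fun x : R => x + b) 1 by apply: is_derive_eq; rewrite addr0.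
  by case: dx.
rewrite (@increasing_ge0_integration_by_substitutionT R (fun x => x + b)).
- under eq_integral do rewrite fctE d1 /= mulr1 addrK.
  rewrite ge0_symfun_integralT.
  + rewrite -set_itvcy EFinM -(integral_expR_ray 0 r0); congr (_ * _)%E.
    apply: eq_integral => x; rewrite inE/= in_itv/= andbT => x0.
    by rewrite subr0 ger0_norm// mulNr.
  + by move=> x; exact: expR_ge0.
  + by have := cn 0; under eq_fun do rewrite subr0.
  + by move=> x; rewrite /= normrN.
- by move=> x y; rewrite ltrD2r.
- by rewrite d1; exact: cst_continuous.
- by rewrite d1; exact: is_cvg_cst.
- by rewrite d1; exact: is_cvg_cst.
- by move=> x.
- exact: cvg_addrr_Ny.
- exact: cvg_addrr.
- exact: cn.
- by move=> x; exact: expR_ge0.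
Qed.

End exponential_integrals.

(** * Lower bound for the frequency integral *)

Section fejer_lower_bound.
Context {R : realType}.
Notation mu := (@lebesgue_measure R).

Lemma continuous_integrable_itv (f : R -> R) (a b : R) : continuous f ->
  mu.-integrable `[a, b] (EFin \o f).
Proof.
move=> cf; apply: continuous_compact_integrable; first exact: segment_compact.
exact: continuous_subspaceT.
Qed.

Lemma bounded_integrable_itv (f : R -> R) (a b : R) : bounded_meas f ->
  mu.-integrable `[a, b] (EFin \o f).
Proof.
move=> [mf [M Mf]]; apply: measurable_bounded_integrable => //.
- by rewrite /= lebesgue_measure_itv/=; case: ifP => _; rewrite ltry.
- exact: measurable_funTS.
- exists M; split; first exact: num_real.
  by move=> y My x _ /=; rewrite (le_trans (Mf x))// ltW.
Qed.

(** Frequencies up to [1 / r] contribute at least [1 / (2 * r)], as [vhat >= 1] there. Elsewhere the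
    negative part is integrated against [vhat <= pi + 3]. With [kap] proportional to [r] the loss is
    of order [1 / r ^+ 2], hence negligible. *)
Lemma vhat_integral_ge (A : R -> R) (r K kap : R) : bounded_meas A ->
  1 <= r -> 0 < kap -> 0 <= K ->
  (forall s : R, 0 <= s <= pi -> s * r <= 1 -> 1 / 2 <= A s) ->
  (forall s : R, 0 <= s <= pi -> - (K / (r * (1 + kap * s) ^+ 2)) <= A s) ->
  1 / (2 * r) - (pi + 3) * K / (r * kap) <= \int[mu]_(s in `[0, pi]) (vhat s * A s).
Proof.
move=> bA r1 k0 K0 A1 A2.
have r0 : 0 < r by apply: lt_le_trans r1.
have p0 := pi_gt0 R.
pose f1 (s : R) : R := \1_(`[0, r^-1]%classic) s.
pose f2 (s : R) : R := ((1 + kap * s) ^+ 2)^-1.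
have den (s : R) : 0 <= s -> 0 < 1 + kap * s.
  by move=> s0; rewrite ltr_pwDl// mulr_ge0// ltW.
have df2 (s : R) : 0 <= s <= pi -> is_derive s 1 (fun s => s / (1 + kap * s)) (f2 s).
  move=> /andP[s0 _]; have d0 := den s s0.
  have d0' : 1 + kap * s != 0 by rewrite gt_eqF.
  have dA : is_derive s 1 (fun s => 1 + kap * s) kap.
    by apply: is_derive_eq; rewrite /GRing.scale/=; ring.
  have dV := @is_deriveV R (fun s : R => 1 + kap * s) s kap 1 d0' dA.
  apply: (is_derive_eq (is_deriveM (is_derive_id s 1) dV)).
  by rewrite /GRing.scale/= /f2; field.
have cf2 : {within `[0, pi], continuous f2}.
  apply: continuous_in_subspaceT => s; rewrite inE/= in_itv/= => /andP[s0 _].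
  have d0 : (1 + kap * s) ^+ 2 != 0 by rewrite gt_eqF// exprn_gt0// den.
  have dA : is_derive s 1 (fun s => (1 + kap * s) ^+ 2) (2 * kap * (1 + kap * s)).
    by apply: is_derive_eq; rewrite /GRing.scale/=; ring.
  apply: is_derive_continuous.
  exact: (@is_deriveV R (fun s : R => (1 + kap * s) ^+ 2) s _ 1 d0 dA).
have i1 : mu.-integrable `[0, pi] (EFin \o f1).
  by apply: bounded_integrable_itv; exact: bounded_meas_indic.
have i2 : mu.-integrable `[0, pi] (EFin \o f2).
  by apply: continuous_compact_integrable => //; exact: segment_compact.
have I1 : \int[mu]_(s in `[0, pi]) f1 s = r^-1.
  rewrite /Rintegral /f1 integral_indic//= setIidl; last first.
    apply: subset_itvl; rewrite bnd_simp (@le_trans _ _ 1)//; last first.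
      by have := pi_ge2 R; lra.
    by rewrite invf_le1.
  by rewrite lebesgue_measure_itv/= lte_fin invr_gt0 r0 oppr0 adde0.
have I2 : \int[mu]_(s in `[0, pi]) f2 s <= kap^-1.
  rewrite (is_derive_Rintegral p0 df2 cf2) mul0r subr0.
  rewrite ler_pdivrMr ?den ?(ltW p0)// mulrDr mulr1 mulKf ?gt_eqF//.
  by rewrite lerDr invr_ge0 ltW.
pose M := (pi + 3) * K / r.
have M0 : 0 <= M by apply: divr_ge0; [apply: mulr_ge0 => //; apply: addr_ge0 => //; exact: ltW|exact: ltW].
have iZ c (f : R -> R) : mu.-integrable `[0, pi] (EFin \o f) ->
    mu.-integrable `[0, pi] (EFin \o (fun s => c * f s)).
  move=> i; have -> : EFin \o (fun s => c * f s) = (fun s => c%:E * (EFin \o f) s)%E.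
    by apply/funext => s /=; rewrite EFinM.
  exact: integrableZl.
apply: (@le_trans _ _ (\int[mu]_(s in `[0, pi]) (1 / 2 * f1 s - M * f2 s))).
  rewrite RintegralB//; last 2 first.
    exact: iZ.
    exact: iZ.
  rewrite !RintegralZl// I1.
  have -> : 1 / (2 * r) = 1 / 2 * r^-1 by field; rewrite gt_eqF.
  apply: lerB => //; have -> : (pi + 3) * K / (r * kap) = M * kap^-1.
    by rewrite /M; field; rewrite !gt_eqF.
  by rewrite ler_wpM2l.
have bv : mu.-integrable `[0, pi] (EFin \o vhat).
  by apply: continuous_integrable_itv; exact: continuous_vhat.
apply: le_Rintegral => //.
- have -> : EFin \o (fun s => 1 / 2 * f1 s - M * f2 s) =
     ((EFin \o (fun s => (1 / 2 * f1 s)%R)) \- (EFin \o (fun s => (M * f2 s)%R)))%E.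
    by apply/funext => s.
  by apply: integrableB => //; exact: iZ.
- have := @integrableMl _ _ R mu `[0, pi]%classic (measurable_itv _) (EFin \o vhat) A bv.
  have -> : ((EFin \o vhat) \* (EFin \o A))%E = (EFin \o (fun s => vhat s * A s)).
    by apply/funext => x /=; rewrite EFinM.
  case: bA => mA [B AB]; apply; first exact: measurable_funTS.
  exists B; split; first exact: num_real.
  by move=> y My x _ /=; rewrite (le_trans (AB x))// ltW.
- move=> s; rewrite /= in_itv/= => spi; have /andP[s0 sp] := spi.
  have v0 := vhat_ge0 spi; have vl := vhat_le spi.
  have f20 : 0 <= f2 s by rewrite invr_ge0 sqr_ge0.
  rewrite /f1 indicE; have [sr|/negP sr] := boolP (s * r <= 1).
    have -> : s \in `[0, r^-1]%classic.
      by rewrite inE/= in_itv/= s0/= -[r^-1]mul1r ler_pdivlMr.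
    have As := A1 s spi sr.
    have v1 : 1 <= vhat s.
      by apply: vhat_ge1; rewrite s0/= (le_trans _ sr)// ler_peMr.
    have : 0 <= M * f2 s by rewrite mulr_ge0.
    have : 1 * (1 / 2) <= vhat s * A s by apply: ler_pM.
    by rewrite mulr1 /=; lra.
  have -> : (s \in `[0, r^-1]%classic) = false.
    apply/negP; rewrite inE/= in_itv/= => /andP[_ h]; apply: sr.
    by rewrite -ler_pdivlMr// mul1r.
  rewrite mulr0 sub0r.
  have As := A2 s spi.
  have AB : - (K * f2 s / r) <= A s.
    apply: le_trans As; rewrite lerN2 le_eqVlt; apply/orP; left; apply/eqP.
    by rewrite /f2; field; rewrite !gt_eqF// den.
  have Kf : 0 <= K * f2 s / r by rewrite !mulr_ge0// invr_ge0 ltW.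
  have [Ap|An] := leP 0 (A s).
    by apply: (@le_trans _ _ 0); [rewrite oppr_le0 mulr_ge0|exact: mulr_ge0].
  have : vhat s * - A s <= (pi + 3) * (K * f2 s / r).
    by apply: ler_pM => //; lra.
  rewrite /M; have -> : (pi + 3) * K / r * f2 s = (pi + 3) * (K * f2 s / r) by ring.
  by lra.
Qed.

End fejer_lower_bound.

(** * Taylor bounds for the characteristic function from moments *)

Section moments.
Context {R : realType}.
Notation mu := (@lebesgue_measure R).
Variables (w : R -> R) (a sg C2 C4 v0 : R).
Hypothesis dw : is_density w.
Let z x := (x - a) / sg.
Hypotheses (i4 : mu.-integrable setT (EFin \o (fun x => w x * z x ^+ 4)))
  (i2 : mu.-integrable setT (EFin \o (fun x => w x * z x ^+ 2)))
  (i1 : mu.-integrable setT (EFin \o (fun x => w x * z x))).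
Hypotheses (m1 : \int[mu]_x (w x * z x) = 0)
  (m2 : v0 <= \int[mu]_x (w x * z x ^+ 2) <= C2)
  (m4 : \int[mu]_x (w x * z x ^+ 4) <= C4).

Let iw : mu.-integrable setT (EFin \o w). Proof. by case: dw. Qed.
Let w0 x : 0 <= w x. Proof. by case: dw. Qed.

Let integrable_D (f g : R -> R) : mu.-integrable setT (EFin \o f) ->
  mu.-integrable setT (EFin \o g) -> mu.-integrable setT (EFin \o (fun x => f x + g x)).
Proof.
move=> jf jg; have -> : EFin \o (fun x => f x + g x) = ((EFin \o f) \+ (EFin \o g))%E.
  by apply/funext.
exact: integrableD.
Qed.

Let quartic p q : mu.-integrable setT (EFin \o (fun x => w x * (1 + p * z x ^+ 2 + q * z x ^+ 4)))
  /\ \int[mu]_x (w x * (1 + p * z x ^+ 2 + q * z x ^+ 4)) =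
     1 + p * \int[mu]_x (w x * z x ^+ 2) + q * \int[mu]_x (w x * z x ^+ 4).
Proof.
have -> : (fun x => w x * (1 + p * z x ^+ 2 + q * z x ^+ 4)) =
    (fun x => w x + p * (w x * z x ^+ 2) + q * (w x * z x ^+ 4)).
  by apply/funext => x; ring.
have j2 := integrable_cstM p i2; have j4 := integrable_cstM q i4.
have j24 := integrable_D iw j2; split; first exact: integrable_D.
by rewrite RintegralD// RintegralD// !RintegralZl//; case: dw => _ _ ->.
Qed.

Let mphase u : measurable_fun setT (fun x : R => u * ((x - a) / sg)).
Proof.
by apply: measurable_funM => //; apply: measurable_funM => //; exact: measurable_funB.
Qed.

Lemma ecos_bounds u :
  1 - C2 * u ^+ 2 / 2 <= ecos w a sg u <= 1 - v0 * u ^+ 2 / 2 + C4 * u ^+ 4 / 24.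
Proof.
have bc := integrable_mul_bounded iw (measurable_fun_cos (mphase u)).
have /andP[m2l m2u] := m2; have u20 := sqr_ge0 u.
have u40 : 0 <= u ^+ 4 by rewrite -[4%N]/(2 * 2)%N exprM sqr_ge0.
apply/andP; split.
  have [jl El] := quartic (- (u ^+ 2 / 2)) 0.
  apply: (@le_trans _ _ (\int[mu]_x (w x * (1 + (- (u ^+ 2 / 2)) * z x ^+ 2 + 0 * z x ^+ 4)))).
    rewrite El mul0r addr0.
    have : u ^+ 2 * \int[mu]_x (w x * z x ^+ 2) <= u ^+ 2 * C2 by rewrite ler_wpM2l.
    by lra.
  apply: le_Rintegral => // x _; rewrite ler_wpM2l//.
  have := cos_ge2 (u * z x); rewrite exprMn -/(z x).
  by lra.
have [jl El] := quartic (- (u ^+ 2 / 2)) (u ^+ 4 / 24).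
apply: (@le_trans _ _ (\int[mu]_x (w x * (1 + (- (u ^+ 2 / 2)) * z x ^+ 2 + u ^+ 4 / 24 * z x ^+ 4)))).
  apply: le_Rintegral => // x _; rewrite ler_wpM2l//.
  have := cos_le4 (u * z x); rewrite !exprMn -/(z x).
  by lra.
rewrite El.
have : u ^+ 2 * v0 <= u ^+ 2 * \int[mu]_x (w x * z x ^+ 2) by rewrite ler_wpM2l.
have : u ^+ 4 * \int[mu]_x (w x * z x ^+ 4) <= u ^+ 4 * C4 by rewrite ler_wpM2l.
by lra.
Qed.

(** The linear term integrates to 0 because [a] is the mean. The remainder [|z|^3 / 6] is bounded
    through [2 |z|^3 <= z^2 + z^4], whence the 12; no third moment is needed. *)
Lemma esin_bound u : 0 <= u -> `|esin w a sg u| <= (C2 + C4) / 12 * u ^+ 3.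
Proof.
move=> u0; have /andP[m2l m2u] := m2.
have bs := integrable_mul_bounded iw (measurable_fun_sin (mphase u)).
have j1 := integrable_cstM u i1.
have jB : mu.-integrable setT (EFin \o (fun x => w x * (sin (u * z x) - u * z x))).
  have -> : (fun x => w x * (sin (u * z x) - u * z x)) =
      (fun x => w x * sin (u * z x) + (-1) * (u * (w x * z x))).
    by apply/funext => x; ring.
  by apply: integrable_D => //; exact: integrable_cstM.
have -> : esin w a sg u = \int[mu]_x (w x * (sin (u * z x) - u * z x)).
  transitivity (\int[mu]_x (w x * sin (u * z x) - u * (w x * z x))).
    by rewrite RintegralB// RintegralZl// m1 mulr0 subr0.
  by apply: eq_Rintegral => x _; ring.
apply: (le_trans (le_normr_Rintegral _ jB)) => //.
have ji : mu.-integrable setT (EFin \o (fun x => u ^+ 3 / 12 * (w x * z x ^+ 2 + w x * z x ^+ 4))).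
  by apply: integrable_cstM; exact: integrable_D.
apply: (@le_trans _ _ (\int[mu]_x (u ^+ 3 / 12 * (w x * z x ^+ 2 + w x * z x ^+ 4)))).
  apply: le_Rintegral => //; first exact: (integrable_norm jB).
  move=> x _; rewrite normrM (ger0_norm (w0 x)).
  have -> : u ^+ 3 / 12 * (w x * z x ^+ 2 + w x * z x ^+ 4) =
    w x * (u ^+ 3 / 12 * (z x ^+ 2 + z x ^+ 4)) by ring.
  rewrite ler_wpM2l//.
  apply: (le_trans (sin_near3 _)); rewrite normrM (ger0_norm u0) exprMn.
  have z2 : z x ^+ 2 = `|z x| ^+ 2 by rewrite real_normK ?num_real.
  have -> : z x ^+ 4 = (z x ^+ 2) ^+ 2 by ring.
  rewrite z2; set y := `|z x|; have y0 : 0 <= y by exact: normr_ge0.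
  have u30 : 0 <= u ^+ 3 by rewrite exprn_ge0.
  have : u ^+ 3 * (2 * y ^+ 3) <= u ^+ 3 * (y ^+ 2 + (y ^+ 2) ^+ 2).
    rewrite ler_wpM2l// -subr_ge0.
    have -> : y ^+ 2 + (y ^+ 2) ^+ 2 - 2 * y ^+ 3 = (y - y ^+ 2) ^+ 2 by ring.
    exact: sqr_ge0.
  by lra.
rewrite RintegralZl//; last exact: integrable_D.
rewrite RintegralD//.
have : u ^+ 3 * (\int[mu]_x (w x * z x ^+ 2) + \int[mu]_x (w x * z x ^+ 4)) <= u ^+ 3 * (C2 + C4).
  by rewrite ler_wpM2l ?exprn_ge0// lerD.
by lra.
Qed.

End moments.

(** * Comparison of the conditional and the tilted law *)

Section overshoot.
Context {R : realType}.
Notation mu := (@lebesgue_measure R).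
Implicit Types (w : R -> R) (t b y : R).

(** What the indicator of [y >= b] becomes after tilting: it is divided by the exponential weight,
    normalized to be 1 at [b]. *)
Definition overshoot t b y : R := expR (- t * (y - b)) * \1_(`[b, +oo[%classic) y.

Lemma bounded_meas_overshoot t b : 0 <= t -> bounded_meas (overshoot t b).
Proof.
move=> t0; split.
  apply: measurable_funM; last exact: measurable_indic.
  by apply: continuous_measurable_fun; exact: continuous_expR_affine.
exists 1 => y; rewrite /overshoot indicE; case: (boolP (_ \in _)).
  rewrite inE/= in_itv/= andbT => yb; rewrite mulr1 ger0_norm ?expR_ge0//.
  by rewrite -expR0 ler_expR mulNr oppr_le0 mulr_ge0// subr_ge0.
by rewrite mulr0 normr0.
Qed.

Lemma overshoot_ge0 t b y : 0 <= overshoot t b y.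
Proof. by rewrite mulr_ge0 ?expR_ge0// indicE. Qed.

Lemma overshoot_shift t b y : (fun x => overshoot t b (y + x)) =
  (fun x => expR (- t * (x - (b - y)))) \_ `[b - y, +oo[.
Proof.
apply/funext => x; rewrite /overshoot patchE indicE !mem_setE !in_itv/= !andbT.
rewrite lerBlDl; case: ifPn => _; rewrite ?mulr1 ?mulr0//.
by congr (expR (_ * _)); ring.
Qed.

Lemma integral_overshoot t b y : 0 < t ->
  mu.-integrable setT (EFin \o (fun x => overshoot t b (y + x))) /\
  \int[mu]_x overshoot t b (y + x) = t^-1.
Proof.
move=> t0; have bo := bounded_meas_overshoot b (ltW t0).
have E : (\int[mu]_x (overshoot t b (y + x))%:E = t^-1%:E)%E.
  rewrite -(integral_expR_ray (b - y) t0) [RHS]integral_mkcond.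
  apply: eq_integral => x _.
  rewrite -[overshoot t b (y + x)]/((fun x => overshoot t b (y + x)) x).
  by rewrite overshoot_shift !patchE; case: ifP.
split; last by rewrite /Rintegral E.
apply/integrableP; split.
  apply/measurable_EFinP; case: bo => mo _; apply: measurableT_comp mo _.
  exact: measurable_funD.
under eq_integral do rewrite /= ger0_norm ?overshoot_ge0//.
by rewrite E ltry.
Qed.

Lemma walk_overshoot_le w C t b y : is_density w -> 0 < t -> 0 <= C ->
  (forall x, w x <= C) -> walk_op w (overshoot t b) y <= C / t.
Proof.
move=> dw t0 C0 wC; have [io Eo] := integral_overshoot b y t0.
have bo := bounded_meas_shift y (bounded_meas_overshoot b (ltW t0)).
rewrite -Eo -RintegralZl//; apply: le_Rintegral => //.
- by apply: integrable_mul_bounded bo; case: dw.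
- exact: integrable_cstM.
- by move=> x _; rewrite ler_wpM2r// overshoot_ge0.
Qed.

(** Only the interval of length [1 / t] just above [b - y] is kept, where the exponential is at
    least [1 / e]. As [1 / t <= sg], it overruns the window for [y] by at most one [sg], hence
    [L - 1]. *)
Lemma walk_overshoot_ge w t b a sg L c0 y : is_density w -> 0 < t -> 0 < sg ->
  1 <= t * sg -> 0 <= c0 ->
  (forall x, `|x - a| <= L * sg -> c0 / sg <= w x) ->
  `|y - (b - a)| <= (L - 1) * sg ->
  c0 / (expR 1 * (t * sg)) <= walk_op w (overshoot t b) y.
Proof.
move=> dw t0 s0 ts c00 wc yL.
have bo := bounded_meas_shift y (bounded_meas_overshoot b (ltW t0)).
pose I := `[b - y, b - y + t^-1]%classic.
pose e := c0 / sg * expR (- 1).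
have EI : \int[mu]_x (\1_I x : R) = t^-1.
  rewrite /Rintegral integral_indic//; last exact: measurable_itv.
  rewrite (setIT I : I `&` _ = I) /I /= lebesgue_measure_itv/= lte_fin.
  by rewrite ltrDl invr_gt0 t0/= addrAC subrr add0r.
have iI : mu.-integrable setT (EFin \o (\1_I : R -> R)).
  by apply: integrable_indic_itv.
have -> : c0 / (expR 1 * (t * sg)) = \int[mu]_x (e * (\1_I x : R)).
  rewrite RintegralZl// EI /e expRN; field.
  by rewrite !gt_eqF ?expR_gt0.
apply: le_Rintegral => //.
- exact: integrable_cstM.
- by apply: integrable_mul_bounded bo; case: dw.
move=> x _; have w0 : 0 <= w x by case: dw.
rewrite indicE; case: (boolP (x \in I)); last first.
  by move=> _; rewrite mulr0 mulr_ge0// overshoot_ge0.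
rewrite /I inE/= in_itv/= => /andP[xb xt]; rewrite mulr1.
apply: ler_pM.
- by rewrite divr_ge0// ltW.
- exact: expR_ge0.
- apply: wc; have -> : x - a = (x - (b - y)) - (y - (b - a)) by ring.
  apply: (le_trans (ler_normB _ _)).
  have -> : L * sg = sg + (L - 1) * sg by ring.
  apply: lerD => //; rewrite ger0_norm ?subr_ge0//.
  apply: (@le_trans _ _ t^-1); first by rewrite lerBlDl.
  by rewrite -[t^-1]mul1r ler_pdivrMr// mulrC.
- have -> : overshoot t b (y + x) = expR (- t * (x - (b - y))).
    by rewrite -[LHS]/((fun x => overshoot t b (y + x)) x) overshoot_shift patchE mem_setE in_itv/= xb.
  rewrite ler_expR mulNr lerN2 mulrC -ler_pdivlMr// mul1r lerBlDl//.
Qed.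

End overshoot.

Section total_variation.
Context {R : realType}.
Notation mu := (@lebesgue_measure R).

(* A bound on [E J] from below turns into a total variation bound, by the
   variance inequality for projections and [E u^2 <= sup u * E u]. *)
Lemma tilt_by_projection w (u : R -> R) (U : R) n : is_density w ->
  bounded_meas u -> (forall x, 0 <= u x <= U) ->
  0 < iter n.+1 (walk_op w) u 0 ->
  forall B : set R, measurable B ->
  (expect w (fun x => \1_B x * iter n (walk_op w) u x) / iter n.+1 (walk_op w) u 0
     - expect w \1_B) ^+ 2 <= U / (n.+1%:R * iter n.+1 (walk_op w) u 0).
Proof.
move=> dw bu u0U; set J := iter n (walk_op w) u; set EJ := iter n.+1 (walk_op w) u 0.
move=> EJ0 B mB.
have bJ : bounded_meas J by exact: bounded_meas_iter_walk.
have bB : bounded_meas (\1_B : R -> R) by exact: bounded_meas_indic.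
have N0 : (0 : R) < n.+1%:R by rewrite ltr0n.
have bJE : bounded_meas (fun x => J x - EJ).
  by apply: bounded_measB => //; exact: bounded_meas_cst.
have E1 : expect w (fun x => \1_B x * J x) - EJ * expect w \1_B =
    expect w (fun x => \1_B x * (J x - EJ)).
  have -> : expect w (fun x => \1_B x * (J x - EJ)) =
      expect w (fun x => \1_B x * J x - EJ * \1_B x).
    by apply: eq_expect => x; ring.
  rewrite expectB//; first by rewrite expectZ.
  - exact: bounded_measM.
  - by apply: bounded_measM => //; exact: bounded_meas_cst.
have E2 : expect w (fun x => \1_B x * (J x - EJ)) ^+ 2 <= U * EJ / n.+1%:R.
  apply: (le_trans (sqr_expect_le dw (bounded_measM bB bJE))).
  apply: (@le_trans _ _ (expect w (fun x => (J x - EJ) ^+ 2))).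
    apply: le_expect => //; [apply: bounded_measX; exact: bounded_measM|exact: bounded_measX|].
    move=> x; rewrite exprMn ler_piMl ?sqr_ge0// indicE.
  rewrite ler_pdivlMr// mulrC; apply: (le_trans (walk_projection_variance dw n bu)).
  have -> : U * EJ = iter n.+1 (walk_op w) (fun x => U * u x) 0 by rewrite iter_walkZ.
  apply: le_iter_walk => //; first exact: bounded_measX.
    by apply: bounded_measM => //; exact: bounded_meas_cst.
  by move=> x; have /andP[ux0 uxU] := u0U x; rewrite expr2 ler_wpM2r.
have -> : expect w (fun x => \1_B x * J x) / EJ - expect w \1_B =
    expect w (fun x => \1_B x * (J x - EJ)) / EJ.
  by rewrite -E1; field; rewrite gt_eqF.
rewrite expr_div_n ler_pdivrMr ?exprn_gt0//.
apply: (le_trans E2); rewrite le_eqVlt; apply/orP; left; apply/eqP.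
by field; rewrite !gt_eqF.
Qed.

End total_variation.

(** * Total variation bound for densities regular at a scale *)

Section core.
Context {R : realType}.
Notation mu := (@lebesgue_measure R).

(** All that the variance and Fourier arguments use of the tilted law with mean [a]. The six
    constants are kept apart from [w], [a] and [sg], so that the final bound is uniform over
    tilts. *)
Record regular_density (C C2 C4 v0 L c0 : R) (w : R -> R) (a sg : R) : Prop :=
  RegularDensity {
  reg_dens : is_density w;
  reg_sg : 0 < sg;
  reg_ub : forall x, w x <= C / sg;
  reg_lb : forall x, `|x - a| <= L * sg -> c0 / sg <= w x;
  reg_i1 : mu.-integrable setT (EFin \o (fun x => w x * ((x - a) / sg)));
  reg_i2 : mu.-integrable setT (EFin \o (fun x => w x * ((x - a) / sg) ^+ 2));
  reg_i4 : mu.-integrable setT (EFin \o (fun x => w x * ((x - a) / sg) ^+ 4));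
  reg_m1 : \int[mu]_x (w x * ((x - a) / sg)) = 0;
  reg_m2 : v0 <= \int[mu]_x (w x * ((x - a) / sg) ^+ 2) <= C2;
  reg_m4 : \int[mu]_x (w x * ((x - a) / sg) ^+ 4) <= C4 }.

Variables (C C2 C4 v0 : R).
Hypotheses (C0 : 0 < C) (C20 : 0 < C2) (C40 : 0 < C4) (v00 : 0 < v0).

Let D := (C2 + C4) / 12.
Let D0 : 0 < D. Proof. by rewrite divr_gt0// addr_gt0. Qed.
(** The sum dominates every ratio that the smallness conditions on the frequency range impose; the 4
    in [small_freq] absorbs [pi], which is less than 4. *)
Let Q := 1 + C4 / v0 + C2 + 8 * D ^+ 2 / v0 + v0 + D.
Definition small_freq := (4 * Q)^-1.
Let rho := small_freq.
Let K := decay_const v0 D.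
Let om := vhat \_ `[0, pi : R].
(** Upper bound for the minorant, whose weight is [om]; the 1 gives positivity without evaluating
    the integral. *)
Let VM := 1 + \int[mu]_s om s.

Let Qparts : [/\ 1 <= Q, C4 <= v0 * Q, C2 <= Q, 8 * D ^+ 2 <= v0 * Q & v0 <= Q /\ D <= Q].
Proof.
have h1 : 0 < C4 / v0 by rewrite divr_gt0.
have h2 : 0 < 8 * D ^+ 2 / v0 by rewrite divr_gt0// mulr_gt0// exprn_gt0.
have h3 : 0 < D by exact: D0.
have key (x y z : R) : 0 < x -> 0 < y -> 0 < z ->
    [/\ 1 <= 1 + x + C2 + y + v0 + z, C2 <= 1 + x + C2 + y + v0 + z,
      v0 <= 1 + x + C2 + y + v0 + z, z <= 1 + x + C2 + y + v0 + z &
      0 <= 1 + C2 + y + v0 + z /\ 0 <= 1 + x + C2 + v0 + z].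
  by have := C20; have := v00 => h4 h5 x0 y0 z0; do !split; lra.
have [k1 k2 k3 k4 [k5 k6]] := key _ _ _ h1 h2 h3.
split => //.
- have -> : v0 * Q = C4 + v0 * (1 + C2 + 8 * D ^+ 2 / v0 + v0 + D).
    by rewrite /Q; field; rewrite gt_eqF.
  by rewrite lerDl mulr_ge0// ltW.
- have -> : v0 * Q = 8 * D ^+ 2 + v0 * (1 + C4 / v0 + C2 + v0 + D).
    by rewrite /Q; field; rewrite gt_eqF.
  by rewrite lerDl mulr_ge0// ltW.
Qed.

Let Q1 : 1 <= Q. Proof. by case: Qparts. Qed.
Let Q0 : 0 < Q. Proof. exact: lt_le_trans Q1. Qed.
Let rho0 : 0 < rho. Proof. by rewrite invr_gt0 mulr_gt0. Qed.
Let rhoE : rho * (4 * Q) = 1. Proof. by rewrite mulVf// gt_eqF// mulr_gt0. Qed.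
Let rpiQ : rho * pi * Q <= 1.
Proof.
rewrite -rhoE -mulrA ler_pM2l// ler_wpM2r ?(ltW Q0)//.
by have := pihalf_lt2 R; lra.
Qed.
Let rpi0 : 0 <= rho * pi. Proof. by rewrite mulr_ge0 ?(ltW rho0)// pi_ge0. Qed.

Lemma small_freq_conditions :
  [/\ 0 < rho, rho * pi <= 1, C4 * (rho * pi) <= 6 * v0, C2 * (rho * pi) <= 1 &
   [/\ 8 * D ^+ 2 * (rho * pi) <= v0, v0 * (rho * pi) <= 8,
       2 * C2 * rho ^+ 2 <= 1 & 2 * D * rho ^+ 2 <= 1]].
Proof.
have [_ q4 q2 qD [qv qDD]] := Qparts.
have sc (x y : R) : x <= y * Q -> 0 <= y -> x * (rho * pi) <= y.
  move=> xy y0; apply: (le_trans (ler_wpM2r rpi0 xy)).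
  have -> : y * Q * (rho * pi) = y * (rho * pi * Q) by ring.
  by rewrite ler_piMr.
have rq : rho <= 1 / 4.
  have : rho * (4 * 1) <= rho * (4 * Q) by rewrite ler_pM2l// ler_pM2l.
  by rewrite rhoE; lra.
have sc2 (x : R) : x <= Q -> 2 * x * rho ^+ 2 <= 1.
  move=> xQ; have : x * rho ^+ 2 <= Q * rho ^+ 2 by rewrite ler_wpM2r ?sqr_ge0.
  have -> : Q * rho ^+ 2 = rho * (4 * Q) * rho / 4 by field.
  by rewrite rhoE; lra.
split => //; first by rewrite -[rho * pi]mul1r sc ?mul1r.
- by apply: (@le_trans _ _ v0); [apply: sc => //; exact: ltW|have := v00; lra].
- by apply: sc; rewrite ?mul1r.
split; [by apply: sc => //; exact: ltW| |exact: sc2|exact: sc2].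
by apply: (@le_trans _ _ 1); [apply: sc; rewrite ?mul1r|lra].
Qed.

(** In units of [sg], the minorant is nonpositive beyond [2 / rho]; the extra 1 is the one lost in
    [walk_overshoot_ge]. *)
Definition window := 2 / rho + 1.

Variable c0 : R.
Hypothesis c00 : 0 < c0.

Let om_ge0 s : 0 <= om s.
Proof.
rewrite /om patchE mem_setE; case: ifPn => //.
by rewrite in_itv/=; exact: vhat_ge0.
Qed.

Let i_om : mu.-integrable setT (EFin \o om).
Proof.
rewrite /om -restrict_EFin; apply/integrable_restrict => //=.
by rewrite setTI; apply: continuous_integrable_itv; exact: continuous_vhat.
Qed.

Let VM1 : 1 <= VM.
Proof. by rewrite lerDl; apply: Rintegral_ge0 => x _. Qed.

Let omE (f : R -> R) : \int[mu]_s (om s * f s) = \int[mu]_(s in `[0, pi]) (vhat s * f s).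
Proof.
rewrite [RHS]Rintegral_mkcond; apply: eq_Rintegral => s _.
by rewrite /om !patchE; case: ifP => // _; rewrite mul0r.
Qed.

(** The quotient of [sup u <= C / (t * sg)] by the lower bound for [E J], in which [t * sg]
    cancels. *)
Definition tv_const := 4 * C * expR 1 * VM / c0.
(** From this value of the root on, the loss in [vhat_integral_ge] is at most half of its main
    term. *)
Definition min_root := 1 + 4 * (pi + 3) * K / rho.

Lemma tv_const_gt0 : 0 < tv_const.
Proof.
rewrite divr_gt0// !mulr_gt0 ?expR_gt0//; exact: lt_le_trans VM1.
Qed.

Section density.
Variables (w : R -> R) (a sg t : R) (n : nat).
Hypothesis reg : regular_density C C2 C4 v0 window c0 w a sg.
Hypotheses (t0 : 0 < t) (ts : 1 <= t * sg).
Hypothesis nbig : min_root <= Num.sqrt n.+1%:R.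
Let dw := reg_dens reg.
Let sg0 := reg_sg reg.
(** Of [n.+2] variables one is averaged into [u]; the sum of the other [n.+1] has mean
    [n.+1%:R * a], the centre of the minorant [V]. *)
Let b := n.+2%:R * a.
Let u := walk_op w (overshoot t b).
Let V y := \int[mu]_s (om s * cos (rho * s * ((y - n.+1%:R * a) / sg))).
Let r := Num.sqrt (n.+1%:R : R).

Let r0 : 0 < r. Proof. by rewrite sqrtr_gt0 ltr0n. Qed.
Let K1 : 1 <= K. Proof. exact: decay_const_ge1. Qed.
Let K0 : 0 < K. Proof. exact: lt_le_trans K1. Qed.

Let bV : bounded_meas V.
Proof.
apply: (bounded_meas_weighted om_ge0 i_om
  (H := fun z => cos (rho * z.2 * ((z.1 - n.+1%:R * a) / sg)))).
apply: measurable_fun_cos; apply: measurable_funM; first exact: measurable_funM.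
by apply: measurable_funM => //; exact: measurable_funB.
Qed.

Let V_le y : V y <= VM.
Proof.
rewrite (@le_trans _ _ (\int[mu]_s om s))//; last by rewrite lerDr.
apply: le_Rintegral => //.
- apply: integrable_mul_bounded => //; apply: measurable_fun_cos.
  by apply: measurable_funM => //; exact: measurable_funM.
- by move=> s _; rewrite ler_piMr// cos_le1.
Qed.

Let V_le0 y : (2 / rho) * sg < `|y - n.+1%:R * a| -> V y <= 0.
Proof.
move=> yr; rewrite /V omE; set z := (y - n.+1%:R * a) / sg.
have -> : \int[mu]_(s in `[0, pi]) (vhat s * cos (rho * s * z)) =
    \int[mu]_(s in `[0, pi]) (vhat s * cos (rho * z * s)).
  by apply: eq_Rintegral => s _; rewrite mulrAC.
apply: vhat_cos_integral.
have z2 : 2 / rho <= `|z| by rewrite normrM normfV (gtr0_norm sg0) ler_pdivlMr// ltW.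
have : 2 <= `|rho * z|.
  by rewrite normrM (gtr0_norm rho0) mulrC -ler_pdivrMr.
move=> h; rewrite -real_normK ?num_real//.
have : 2 * 2 <= `|rho * z| * `|rho * z| by apply: ler_pM.
by rewrite -expr2; lra.
Qed.

Let bu : bounded_meas u.
Proof. by apply: bounded_meas_walk => //; apply: bounded_meas_overshoot; exact: ltW. Qed.

Let u_ge0 y : 0 <= u y.
Proof. by apply: expect_ge0 => // x; exact: overshoot_ge0. Qed.

Let c1 := c0 / (expR 1 * (t * sg)) / VM.
Let c1_gt0 : 0 < c1.
Proof. by rewrite !divr_gt0 ?mulr_gt0 ?expR_gt0//; exact: lt_le_trans VM1. Qed.

(** Far from the centre [V] is nonpositive while [u] is not negative; near it [V <= VM] and the
    window bound for [u] applies. *)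
Let u_ge y : c1 * V y <= u y.
Proof.
have [yr|yr] := ltP ((2 / rho) * sg) `|y - n.+1%:R * a|.
  rewrite (le_trans _ (u_ge0 y))// mulr_ge0_le0 ?(ltW c1_gt0)//; exact: V_le0.
apply: (@le_trans _ _ (c0 / (expR 1 * (t * sg)))).
  rewrite /c1 -mulrA mulrC -ler_pdivlMr ?divr_gt0 ?mulr_gt0 ?expR_gt0//.
  rewrite divff ?gt_eqF ?divr_gt0 ?mulr_gt0 ?expR_gt0// mulrC ler_pdivrMr ?mul1r//.
  exact: lt_le_trans VM1.
apply: (walk_overshoot_ge dw t0 sg0 ts (ltW c00) (reg_lb reg)).
by rewrite /b /window addrK -natr1 mulrDl mul1r addrK.
Qed.

(** Started at 0, the walk has its mean at the centre of [V], so all phases vanish and only real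
    parts remain. *)
Let V_iter : iter n.+1 (walk_op w) V 0 =
  \int[mu]_(s in `[0, pi]) (vhat s * (erot w a sg (rho * s) n.+1).1).
Proof.
rewrite (@iter_walk_trig R w a sg dw om)// omE; apply: eq_Rintegral => s _.
by rewrite add0r subrr mul0r mulr0 cos0 sin0 mulr0 subr0 mulr1.
Qed.

Let V_iter_ge : 1 / (4 * r) <= iter n.+1 (walk_op w) V 0.
Proof.
have [_ p1 p2 p3 [p4 p5 p6 p7]] := small_freq_conditions.
have kap0 : 0 < rho * r by rewrite mulr_gt0.
have rmin : 4 * (pi + 3) * K / rho <= r by have := nbig; rewrite -/r /min_root; lra.
have r1 : 1 <= r.
  apply: le_trans nbig; rewrite /min_root lerDl divr_ge0 ?(ltW rho0)//.
  by rewrite !mulr_ge0 ?(ltW K0)// addr_ge0 ?pi_ge0.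
rewrite V_iter.
have := @vhat_integral_ge R (fun s => (erot w a sg (rho * s) n.+1).1) r K (rho * r) _ r1 kap0 (ltW K0).
have [be1 be2] := bounded_meas_erot a sg dw rho n.+1.
move=> /(_ be1) h; apply: (le_trans _ (h _ _)).
- have e : (pi + 3) * K / (r * (rho * r)) <= 1 / (4 * r).
    rewrite ler_pdivrMr ?mulr_gt0//.
    have -> : 1 / (4 * r) * (r * (rho * r)) = rho * r / 4 by field; rewrite gt_eqF.
    have := rmin; rewrite ler_pdivrMr//; lra.
  have -> : 1 / (2 * r) = 2 * (1 / (4 * r)) by field; rewrite gt_eqF.
  by lra.
- move=> s spi sr; apply: (rot1_ge_half v00 C20 C40 D0 rho0 p1 p2 p3 p4 p5 p6 p7 spi).
  + exact: (ecos_bounds dw (reg_i4 reg) (reg_i2 reg) (reg_m2 reg) (reg_m4 reg)).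
  + apply: (esin_bound dw (reg_i4 reg) (reg_i2 reg) (reg_i1 reg) (reg_m1 reg) (reg_m2 reg) (reg_m4 reg)).
    by case/andP: spi => s0 _; rewrite mulr_ge0// ltW.
  + have -> : n.+1%:R * (rho * s) ^+ 2 = rho ^+ 2 * (s * r) ^+ 2.
      by rewrite exprMn [in RHS]exprMn sqr_sqrtr//; ring.
    rewrite ler_piMr ?sqr_ge0// expr_le1// mulr_ge0 ?(ltW r0)//.
    by case/andP: spi.
- move=> s spi.
  apply: (rot1_ge_decay v00 C20 C40 D0 rho0 p1 p2 p3 p4 p5 spi).
  + exact: (ecos_bounds dw (reg_i4 reg) (reg_i2 reg) (reg_m2 reg) (reg_m4 reg)).
  + apply: (esin_bound dw (reg_i4 reg) (reg_i2 reg) (reg_i1 reg) (reg_m1 reg) (reg_m2 reg) (reg_m4 reg)).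
    by case/andP: spi => s0 _; rewrite mulr_ge0// ltW.
Qed.

Let EJ_ge : c1 / (4 * r) <= iter n.+1 (walk_op w) u 0.
Proof.
apply: (@le_trans _ _ (iter n.+1 (walk_op w) (fun y => c1 * V y) 0)); last first.
  apply: le_iter_walk => //; apply: bounded_measM => //; exact: bounded_meas_cst.
by rewrite iter_walkZ// ler_pM2l// -[(4 * r)^-1]mul1r.
Qed.

Lemma conditional_tilt_tv : 0 < iter n.+2 (walk_op w) (overshoot t b) 0 /\
  forall B : set R, measurable B ->
  (expect w (fun x => \1_B x * iter n.+1 (walk_op w) (overshoot t b) x)
      / iter n.+2 (walk_op w) (overshoot t b) 0 - expect w \1_B) ^+ 2
  <= tv_const / r.
Proof.
have -> : iter n.+2 (walk_op w) (overshoot t b) = iter n.+1 (walk_op w) u by rewrite iterSr.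
have -> : iter n.+1 (walk_op w) (overshoot t b) = iter n (walk_op w) u by rewrite iterSr.
have EJ0 : 0 < iter n.+1 (walk_op w) u 0.
  by apply: lt_le_trans EJ_ge; rewrite divr_gt0// mulr_gt0.
split => // B mB.
have U0 : 0 <= C / sg by rewrite divr_ge0// ltW.
have uU x : 0 <= u x <= C / sg / t.
  by rewrite u_ge0/=; apply: walk_overshoot_le => //; exact: reg_ub reg.
apply: (le_trans (tilt_by_projection dw bu uU EJ0 mB)).
have N0 : (0 : R) < n.+1%:R by rewrite ltr0n.
apply: (@le_trans _ _ (C / sg / t / (n.+1%:R * (c1 / (4 * r))))).
  apply: ler_wpM2l; first by rewrite divr_ge0// ltW.
  have h1 : 0 < n.+1%:R * (c1 / (4 * r)) by rewrite mulr_gt0// divr_gt0// mulr_gt0.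
  by rewrite lef_pV2 ?posrE// ?ler_pM2l// mulr_gt0.
rewrite le_eqVlt; apply/orP; left; apply/eqP.
have -> : n.+1%:R = r * r :> R by rewrite -expr2 sqr_sqrtr// ltW.
rewrite /tv_const /c1; field.
by rewrite !gt_eqF ?expR_gt0//; exact: lt_le_trans VM1.
Qed.

End density.
End core.

(** * The conditional law as an integral *)

Section density_integral.
Context {R : realType}.
Notation mu := (@lebesgue_measure R).
Variables (nu : {measure set (measurableTypeR R) -> \bar R}) (p : R -> R).
Hypotheses (mp : measurable_fun setT p) (p0 : forall x, 0 <= p x).
Hypothesis nuE : forall B : set R, measurable B -> nu B = (\int[mu]_(x in B) (p x)%:E)%E.

Import HBNNSimple.

Let density_integral_nnsfun (f : {nnsfun (measurableTypeR R) >-> R}) :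
  (\int[nu]_x (f x)%:E = \int[mu]_x (f x * p x)%:E)%E.
Proof.
under [LHS]eq_integral do rewrite fimfunE -fsumEFin//.
rewrite [LHS]ge0_integral_fsum//; last 2 first.
  - by move=> r; exact/measurable_EFinP/measurableT_comp.
  - by move=> n x _; rewrite EFinM nnfun_muleindic_ge0.
under [RHS]eq_integral.
  move=> x xD; rewrite EFinM fimfunE -fsumEFin// muleC ge0_mule_fsumr; last first.
    by move=> r; rewrite EFinM nnfun_muleindic_ge0.
  over.
rewrite [RHS]ge0_integral_fsum//; last 2 first.
  - move=> r; apply: emeasurable_funM; first exact/measurable_EFinP.
    exact/measurable_EFinP/measurableT_comp.
  - move=> n x _; apply: mule_ge0; first by rewrite lee_fin.
    by rewrite EFinM nnfun_muleindic_ge0.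
apply: eq_fsbigr => r _.
have mfr : measurable (f @^-1` [set r]) by [].
rewrite integralZl_indic_nnsfun// integral_indic// setIT nuE//.
rewrite [X in (_ * X)%E = _]integral_mkcond.
have [r0|r0] := leP 0 r.
  rewrite -ge0_integralZl_EFin//.
  - apply: eq_integral => x _; rewrite patchE indicE; case: ifPn => _.
      by rewrite mulr1 muleC.
    by rewrite mulr0 mule0 mule0.
  - by move=> x _; rewrite patchE; case: ifP; rewrite ?lee_fin.
  - by apply/measurable_restrict => //; apply/measurable_EFinP; exact: measurable_funTS.
rewrite preimage_nnfun0// integral0_eq ?mule0 ?integral0_eq//.
- by move=> x _; rewrite indic0 mulr0 mule0.
- by move=> x _; rewrite patchE in_set0.
Qed.

(** The density is known only through the values of [nu] on sets; simple functions and monotone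
    convergence extend this to integrals. *)
Lemma density_integral (f : measurableTypeR R -> \bar R) : measurable_fun setT f ->
  (forall x, 0 <= f x)%E -> (\int[nu]_x f x = \int[mu]_x (f x * (p x)%:E))%E.
Proof.
move=> mf f0; pose f_ := nnsfun_approx measurableT mf.
transitivity (lim (\int[nu]_x (f_ n x)%:E @[n --> \oo])%E).
  rewrite -monotone_convergence//=.
  - apply: eq_integral => ? /[!inE] xD; apply/esym/cvg_lim => //=.
    exact: cvg_nnsfun_approx.
  - by move=> n; apply/measurable_EFinP; exact: (measurable_funPT (f_ n)).
  - by move=> n ? _; rewrite lee_fin.
  - move=> x _ i j ij; rewrite lee_fin.
    by have /lefP/(_ x) := nd_nnsfun_approx measurableT mf ij.
transitivity (lim (\int[mu]_x (f_ n x * p x)%:E @[n --> \oo])%E).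
  by apply: congr_lim; apply/funext => n /=; exact: density_integral_nnsfun.
rewrite -monotone_convergence//=.
- apply: eq_integral => x _; apply/cvg_lim => //=.
  under eq_fun do rewrite EFinM.
  apply: cvgeZr => //; exact: cvg_nnsfun_approx.
- by move=> n; apply/measurable_EFinP/measurable_funM => //; exact: (measurable_funPT (f_ n)).
- by move=> n x _; rewrite lee_fin mulr_ge0.
- move=> x _ i j ij; rewrite lee_fin ler_wpM2r//.
  by have /lefP/(_ x) := nd_nnsfun_approx measurableT mf ij.
Qed.

End density_integral.

(** * Laws of sums of independent variables *)

Section independent_sums.
Context {R : realType} d {T : measurableType d} (P : probability T R).
Notation mu := (@lebesgue_measure R).

(** The law of the pair restricted to [D] and divided by [P D] agrees with the product law on
    rectangles, and product measures are unique. The event [D] carries the earlier variables along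
    in the induction; the case [P D = 0] is split off because of the division. *)
Lemma independent_pair (D : set T) (Y Z : {mfun T >-> R}) : measurable D ->
  (forall B C : set R, measurable B -> measurable C ->
     P (D `&` (Y @^-1` B `&` Z @^-1` C)) = P D * (P (Y @^-1` B) * P (Z @^-1` C)))%E ->
  forall A : set (R * R), measurable A ->
  P (D `&` [set w | A (Y w, Z w)]) =
  (P D * (distribution P Y \x distribution P Z) A)%E.
Proof.
move=> mD DYZ A mA.
have mYZ : measurable_fun setT (fun w => (Y w, Z w)) by exact: measurable_fun_pair.
have mpre : measurable [set w | A (Y w, Z w)].
  by have := mYZ measurableT A mA; rewrite setTI.
have PDfin : P D \is a fin_num by rewrite fin_num_measure.
have [PD0|PD0] := eqVneq (P D) 0%E.
  rewrite PD0 mul0e; apply/eqP; rewrite -measure_le0 -PD0.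
  by apply: le_measure; [rewrite inE; exact: measurableI|rewrite inE|exact: subIsetl].
have fD0 : 0 < fine (P D).
  by rewrite fine_gt0// lt0e PD0 measure_ge0/= ltey_eq PDfin.
pose h w := (Y w, Z w).
have k0 : 0 <= (fine (P D))^-1 by rewrite invr_ge0 ltW.
have PDV : ((fine (P D))^-1%:E * P D = 1)%E.
  by rewrite -[X in (_ * X)%E](fineK PDfin) -EFinM mulVf ?gt_eqF.
pose m' := mscale (NngNum k0)
  (measure_function_pushforward__canonical__measure_function_Measure (mrestr P mD) mYZ).
have := @product_measure_unique _ _ _ _ R (distribution P Y) (distribution P Z) m' _ A mA.
move=> ->; last first.
  move=> B C mB mC; rewrite /= /mscale /= /pushforward /mrestr.
  have -> : h @^-1` (B `*` C) `&` D = D `&` (Y @^-1` B `&` Z @^-1` C).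
    by rewrite setIC; congr (_ `&` _); apply/seteqP; split.
  by rewrite DYZ// muleA PDV mul1e.
rewrite /= /mscale /= /pushforward /mrestr.
by rewrite muleA [X in (X * _)%E]muleC PDV mul1e setIC.
Qed.

Variables (p : R -> R).
Hypotheses (mp : measurable_fun setT p) (p0 : forall x, 0 <= p x).

Lemma integral_comp_density (Y : {mfun T >-> R}) :
  (forall B : set R, measurable B -> P (Y @^-1` B) = (\int[mu]_(x in B) (p x)%:E)%E) ->
  forall f : R -> \bar R, measurable_fun setT f -> (forall x, 0 <= f x)%E ->
  (\int[P]_w f (Y w) = \int[mu]_x (f x * (p x)%:E))%E.
Proof.
move=> Yp f mf f0.
have mY0 : measurable_fun setT Y by exact: measurable_funPT.
have mY : @measurable_fun _ _ T (measurableTypeR R) setT Y := mY0.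
pose nu := measure_function_pushforward__canonical__measure_function_Measure P mY.
rewrite -(@density_integral R nu p mp p0 Yp)// (@ge0_integral_pushforward _ _ _ _ R _ mY P)//.
Qed.

Lemma independent_pair_sum (D : set T) (Y Z : {mfun T >-> R}) : measurable D ->
  (forall B : set R, measurable B -> P (Y @^-1` B) = (\int[mu]_(x in B) (p x)%:E)%E) ->
  (forall B C : set R, measurable B -> measurable C ->
     P (D `&` (Y @^-1` B `&` Z @^-1` C)) = P D * (P (Y @^-1` B) * P (Z @^-1` C)))%E ->
  forall B C : set R, measurable B -> measurable C ->
  P (D `&` (Y @^-1` B `&` [set w | C (Y w + Z w)])) =
  (P D * \int[mu]_x ((\1_B x)%:E * P [set w | C (x + Z w)%R] * (p x)%:E))%E.
Proof.
move=> mD Yp DYZ B C mB mC.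
pose A : set (R * R) := [set z | B z.1 /\ C (z.1 + z.2)].
have mA : measurable A.
  have m1 : measurable (fst @^-1` B : set (R * R)).
    by rewrite -[X in measurable X]setTI; exact: measurable_fst.
  have m2 : measurable ((fun z : R * R => z.1 + z.2) @^-1` C).
    rewrite -[X in measurable X]setTI.
    by apply: (_ : measurable_fun setT (fun z : R * R => z.1 + z.2)) => //; exact: measurable_funD.
  exact: measurableI m1 m2.
rewrite -[X in P (_ `&` X)]/[set w | A (Y w, Z w)] (independent_pair mD DYZ mA).
congr (_ * _)%E; rewrite /product_measure1.
have mx : measurable_fun setT (fun x => distribution P Z (xsection A x)).
  exact: measurable_fun_xsection.
rewrite (ge0_integral_distribution Y mx)// (integral_comp_density Yp mx)//.
apply: eq_integral => x _; congr (_ * _)%E.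
rewrite /= /distribution /pushforward indicE; case: (boolP (x \in B)) => xB.
  rewrite mul1e; congr (P _); apply/seteqP; split => w /=.
    by rewrite /xsection/= inE => -[].
  by rewrite /xsection/= inE => Cw; split => //; rewrite inE in xB.
rewrite mul0e -(measure0 P); congr (P _); apply/seteqP; split => w //=.
by rewrite /xsection/= inE => -[/= xB' _]; rewrite notin_setE in xB.
Qed.

Variable X : nat -> {RV P >-> R}.
Hypothesis indX : mutually_independent X.
Hypothesis Xp : forall i (B : set R), measurable B ->
  P (X i @^-1` B) = (\int[mu]_(x in B) (p x)%:E)%E.

Let dp : is_density p.
Proof.
have E : (\int[mu]_x (p x)%:E = 1)%E.
  by rewrite -(Xp 0 measurableT) preimage_setT probability_setT.
split => //; last by rewrite /Rintegral E.
apply/integrableP; split; first exact/measurable_EFinP.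
under eq_integral do rewrite /= ger0_norm//.
by rewrite E ltry.
Qed.

Definition tail_sum n j w : R := \sum_(j <= i < n) X i w.

Lemma measurable_tail_sum n j : measurable_fun setT (tail_sum n j).
Proof. by apply: measurable_sum. Qed.

Let head (B : nat -> set R) j := \big[setI/setT]_(i <- iota 0 j) (X i @^-1` B i).

Let measurable_preX i (B : set R) : measurable B -> measurable (X i @^-1` B).
Proof. by move=> mB; rewrite -[X in measurable X]setTI; exact: measurable_funP. Qed.

Let measurable_head B j : (forall i, measurable (B i)) -> measurable (head B j).
Proof. by move=> mB; apply: bigsetI_measurable => i _; exact: measurable_preX. Qed.

Let headS B j : head B j.+1 = head B j `&` X j @^-1` B j.
Proof. by rewrite /head -addn1 iotaD big_cat/= big_seq1 add0n. Qed.

Let head_eq B B' j : (forall i, (i < j)%N -> B i = B' i) -> head B j = head B' j.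
Proof.
move=> BB; apply: eq_big_seq => i; rewrite mem_iota/= add0n => ij.
by rewrite BB.
Qed.

Let P_headS B j : (forall i, measurable (B i)) ->
  (P (head B j.+1) = P (head B j) * P (X j @^-1` B j))%E.
Proof.
move=> mB; rewrite (indX (iota_uniq 0 j.+1) mB) (indX (iota_uniq 0 j) mB).
by rewrite -addn1 iotaD big_cat/= big_seq1 add0n.
Qed.

Let tail_sumS n j w : (j < n)%N -> tail_sum n j w = X j w + tail_sum n j.+1 w.
Proof. by move=> jn; rewrite /tail_sum big_ltn. Qed.

Let tailRV n j : {mfun T >-> R} := mfun_Sub (mem_set (measurable_tail_sum n j)).

Let rect n j B : (j < n)%N -> (forall i, measurable (B i)) ->
  (forall B C, (forall i, measurable (B i)) -> measurable C ->
    P (head B j.+1 `&` tail_sum n j.+1 @^-1` C) =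
    P (head B j.+1) * P (tail_sum n j.+1 @^-1` C))%E ->
  forall E C : set R, measurable E -> measurable C ->
     (P (head B j `&` (X j @^-1` E `&` tail_sum n j.+1 @^-1` C)) =
     P (head B j) * (P (X j @^-1` E) * P (tail_sum n j.+1 @^-1` C)))%E.
Proof.
move=> jn mB ih E C mE mC.
(* Replacing the [j]-th set by [E] turns the event on [X j] into the last factor of a longer
   head. *)
pose B' i := if i == j then E else B i.
have mB' i : measurable (B' i) by rewrite /B'; case: ifP.
have hB : head B' j = head B j.
  by apply: head_eq => i ij; rewrite /B' ltn_eqF.
have B'j : B' j = E by rewrite /B' eqxx.
have := ih B' C mB' mC; rewrite P_headS// headS hB B'j -setIA => ->.
by rewrite muleA.
Qed.

(** Mutual independence is given for events on single coordinates only. Independence of a sum from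
    the variables before it is gained by induction on the length of the sum, prepending one variable
    at a time. *)
Lemma independent_tail_sum n j : (j <= n)%N ->
  forall (B : nat -> set R) (C : set R), (forall i, measurable (B i)) -> measurable C ->
  (P (\big[setI/setT]_(i <- iota 0 j) (X i @^-1` B i) `&` tail_sum n j @^-1` C) =
   P (\big[setI/setT]_(i <- iota 0 j) (X i @^-1` B i)) * P (tail_sum n j @^-1` C))%E.
Proof.
move=> jn; rewrite -(subKn jn); move: (n - j)%N (leq_subr j n) => k {j jn}.
elim: k => [|k ih] kn B C mB mC.
  rewrite subn0 -/(head B n).
  have [C0|C0] := pselect (C 0).
    have -> : tail_sum n n @^-1` C = setT.
      by apply/seteqP; split => // w _ /=; rewrite /tail_sum big_geq.
    by rewrite setIT probability_setT mule1.
  have -> : tail_sum n n @^-1` C = set0.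
    by apply/seteqP; split => // w /=; rewrite /tail_sum big_geq.
  by rewrite setI0 measure0 mule0.
have {}ih := ih (ltnW kn).
set j := (n - k.+1)%N.
have jS : (n - k)%N = j.+1 by rewrite /j -subSn// subSS.
have jn : (j < n)%N by rewrite -jS leq_subr.
rewrite jS in ih; rewrite -/(head B j).
have mhead := measurable_head j mB.
have rBE := rect jn mB ih.
have sumE D : P (D `&` tail_sum n j @^-1` C) =
    P (D `&` (X j @^-1` setT `&` [set w | C (X j w + tailRV n j.+1 w)])).
  congr (P (D `&` _)); rewrite preimage_setT setTI.
  by apply/funext => w; rewrite /preimage/= tail_sumS.
rewrite sumE (@independent_pair_sum _ (X j) (tailRV n j.+1) mhead (Xp j) rBE setT C)//.
(* The integral does not involve the head event. The same formula with the sure event in its place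
   identifies this integral with the unconditional probability. *)
congr (_ * _)%E; rewrite -[X in _ = P X]setTI sumE.
rewrite (@independent_pair_sum setT (X j) (tailRV n j.+1) measurableT (Xp j) _ setT C)//.
  by rewrite probability_setT mul1e.
move=> E C' mE mC'; have := @rect n j (fun=> setT) jn (fun=> measurableT) ih E C' mE mC'.
suff -> : head (fun=> setT) j = setT by [].
by rewrite /head big1.
Qed.

Lemma joint_law_sum n j : (j < n)%N -> forall B C : set R, measurable B -> measurable C ->
  P (X j @^-1` B `&` [set w | C (X j w + tail_sum n j.+1 w)]) =
  (\int[mu]_x ((\1_B x)%:E * P [set w | C (x + tail_sum n j.+1 w)%R] * (p x)%:E))%E.
Proof.
move=> jn B C mB mC.
have h0 : head (fun=> setT) j = setT by rewrite /head big1.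
have ind E C' : measurable E -> measurable C' ->
    (P (setT `&` (X j @^-1` E `&` tailRV n j.+1 @^-1` C')) =
    P setT * (P (X j @^-1` E) * P (tailRV n j.+1 @^-1` C')))%E.
  move=> mE mC'; rewrite -h0.
  exact: (@rect n j (fun=> setT) jn (fun=> measurableT) (independent_tail_sum jn) E C' mE mC').
have := @independent_pair_sum setT (X j) (tailRV n j.+1) measurableT (Xp j) ind B C mB mC.
by rewrite probability_setT mul1e setTI.
Qed.

Lemma law_tail_sum n k (C : set R) (x : R) : (k <= n)%N -> measurable C ->
  P [set w | C (x + tail_sum n (n - k)%N w)] = (iter k (walk_op p) \1_C x)%:E.
Proof.
elim: k C x => [|k ih] C x kn mC.
  rewrite subn0 /= indicE; case: (boolP (x \in C)); rewrite (inE, notin_setE) => xC.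
    rewrite -(probability_setT P); congr (P _); apply/seteqP; split => // w _ /=.
    by rewrite /tail_sum big_geq// addr0.
  transitivity (P set0); last by rewrite measure0.
  congr (P _); apply/seteqP; split => // w /=.
  by rewrite /tail_sum big_geq// addr0.
set j := (n - k.+1)%N.
have jS : (n - k)%N = j.+1 by rewrite /j -subSn// subSS.
have jn : (j < n)%N by rewrite -jS leq_subr.
pose C' : set R := [set y | C (x + y)].
have mC' : measurable C'.
  rewrite -[X in measurable X]setTI.
  by apply: (_ : measurable_fun setT (fun y => x + y)) => //; exact: measurable_funD.
have -> : [set w | C (x + tail_sum n j w)] =
    X j @^-1` setT `&` [set w | C' (X j w + tail_sum n j.+1 w)].
  by rewrite preimage_setT setTI; apply/funext => w; rewrite /C'/= tail_sumS.
rewrite (joint_law_sum jn measurableT mC').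
transitivity (\int[mu]_y (p y * iter k (walk_op p) \1_C (x + y))%:E)%E.
  apply: eq_integral => y _; rewrite indicE in_setT mul1e mulrC EFinM; congr (_ * _)%E.
  rewrite -(ih C (x + y) (ltnW kn) mC) jS; congr (P _).
  by apply/funext => w; rewrite /C'/= addrA.
have bC : bounded_meas (\1_C : R -> R) by exact: bounded_meas_indic.
have := bounded_meas_shift x (bounded_meas_iter_walk dp k bC).
move=> bi; have [_ ip _] := dp.
rewrite iterS /walk_op /expect /Rintegral fineK//.
exact: (integrable_fin_num _ (integrable_mul_bounded ip bi)).
Qed.

Lemma law_first_and_sum n (B C : set R) : measurable B -> measurable C ->
  P (X 0 @^-1` B `&` [set w | C (partial_sum X n.+1 w)]) =
  (expect p (fun x => \1_B x * iter n (walk_op p) \1_C x))%:E.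
Proof.
move=> mB mC.
have -> : X 0 @^-1` B `&` [set w | C (partial_sum X n.+1 w)] =
    X 0 @^-1` B `&` [set w | C (X 0 w + tail_sum n.+1 1 w)].
  congr (_ `&` _); apply/funext => w /=.
  by rewrite -tail_sumS// /tail_sum /partial_sum big_mkord.
rewrite (joint_law_sum (ltn0Sn n) mB mC).
have bC : bounded_meas (\1_C : R -> R) by exact: bounded_meas_indic.
have bB : bounded_meas (\1_B : R -> R) by exact: bounded_meas_indic.
have [_ ip _] := dp.
have bi := bounded_measM bB (bounded_meas_iter_walk dp n bC).
rewrite /expect /Rintegral fineK; last first.
  exact: (integrable_fin_num _ (integrable_mul_bounded ip bi)).
apply: eq_integral => x _.
have := @law_tail_sum n.+1 n C x (leqnSn n) mC; rewrite subSnn => ->.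
by rewrite -!EFinM mulrC.
Qed.

End independent_sums.

(** * Exponential change of measure *)

Section tilting.
Context {R : realType}.
Notation mu := (@lebesgue_measure R).
Variables (p : R -> R) (t phi : R).
Hypothesis phi0 : 0 < phi.
Let w x := expR (t * x) * p x / phi.
Hypothesis dw : is_density w.

(** Each step yields a factor [phi], and the exponentials along the path telescope to the two
    endpoints. Boundedness is asked of the tilted function, which is what the ray indicator
    satisfies. *)
Lemma iter_walk_tilt (f : R -> R) n y : bounded_meas (fun z => expR (- t * z) * f z) ->
  iter n (walk_op p) f y =
  phi ^+ n * expR (t * y) * iter n (walk_op w) (fun z => expR (- t * z) * f z) y.
Proof.
move=> bf; elim: n y => [|n ih] y.
  by rewrite /= expr0 mul1r mulrA -expRD mulNr subrr expR0 mul1r.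
rewrite !iterS {1}/walk_op /expect.
under eq_Rintegral do rewrite ih.
set G := iter n (walk_op w) _.
have bG : bounded_meas (fun x => G (y + x)).
  by apply: bounded_meas_shift; exact: bounded_meas_iter_walk.
have [_ iw _] := dw.
rewrite /walk_op /expect -RintegralZl//; last exact: integrable_mul_bounded.
apply: eq_Rintegral => x _; rewrite mulrDr expRD /w exprS.
by field; rewrite gt_eqF.
Qed.

Lemma iter_walk_tilt_ray n b y : 0 <= t ->
  iter n (walk_op p) \1_(`[b, +oo[%classic) y =
  phi ^+ n * expR (t * (y - b)) * iter n (walk_op w) (overshoot t b) y.
Proof.
move=> t0; have bo := bounded_meas_overshoot b t0.
have E : (fun z => expR (- t * z) * \1_(`[b, +oo[%classic) z) =
    (fun z => expR (- t * b) * overshoot t b z).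
  apply/funext => z; rewrite /overshoot mulrA -expRD; congr (expR _ * _).
  by ring.
rewrite iter_walk_tilt E; last by apply: bounded_measM => //; exact: bounded_meas_cst.
rewrite iter_walkZ// mulrA -[_ * _ * expR (- t * b)]mulrA -expRD.
by congr (_ * expR _ * _); ring.
Qed.

Lemma expect_tilt_ray n b (B : set R) : 0 <= t -> measurable B ->
  expect p (fun x => \1_B x * iter n (walk_op p) \1_(`[b, +oo[%classic) x) =
  phi ^+ n.+1 * expR (- t * b) * expect w (fun x => \1_B x * iter n (walk_op w) (overshoot t b) x).
Proof.
move=> t0 mB; have bo := bounded_meas_overshoot b t0.
have bi := bounded_measM (bounded_meas_indic mB) (bounded_meas_iter_walk dw n bo).
have [_ iw _] := dw.
rewrite /expect -RintegralZl//; last exact: integrable_mul_bounded.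
apply: eq_Rintegral => x _; rewrite iter_walk_tilt_ray//.
have -> : t * (x - b) = t * x + - t * b by ring.
by rewrite expRD /w exprS; field; rewrite gt_eqF.
Qed.

End tilting.

Section conditional_law.
Context {R : realType} d {T : measurableType d} (P : probability T R).
Notation mu := (@lebesgue_measure R).
Variables (p : R -> R) (X : nat -> {RV P >-> R}).
Hypotheses (mp : measurable_fun setT p) (p0 : forall x, 0 <= p x).
Hypothesis indX : mutually_independent X.
Hypothesis Xp : forall i (B : set R), measurable B ->
  P (X i @^-1` B) = (\int[mu]_(x in B) (p x)%:E)%E.
Variables (t phi : R).
Hypotheses (phi0 : 0 < phi) (t0 : 0 <= t).
Let w x := expR (t * x) * p x / phi.
Hypothesis dw : is_density w.

(** Numerator and denominator carry the same factor [phi ^+ n.+1 * expR (- t * b)], which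
    cancels. *)
Lemma cond_law_tilt n a (B : set R) : measurable B ->
  cond_law X (event_A X n.+1 a) B =
  expect w (fun x => \1_B x * iter n (walk_op w) (overshoot t (n.+1%:R * a)) x)
  / iter n.+1 (walk_op w) (overshoot t (n.+1%:R * a)) 0.
Proof.
move=> mB; set b := n.+1%:R * a; set C := `[b, +oo[%classic.
have mC : measurable C by exact: measurable_itv.
have AE : event_A X n.+1 a = [set w | C (partial_sum X n.+1 w)].
  by apply/seteqP; split => x; rewrite /event_A /C/= in_itv/= andbT.
have EB (B' : set R) : measurable B' -> fine (P (event_A X n.+1 a `&` X 0 @^-1` B')) =
    phi ^+ n.+1 * expR (- t * b) * expect w (fun x => \1_B' x * iter n (walk_op w) (overshoot t b) x).
  move=> mB'; rewrite setIC AE (law_first_and_sum mp p0 indX Xp n mB' mC)/=.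
  exact: expect_tilt_ray.
have ET := EB setT measurableT.
rewrite preimage_setT setIT in ET.
rewrite /cond_law EB// ET -mulf_div divff ?mul1r//; last first.
  by rewrite gt_eqF// mulr_gt0 ?exprn_gt0 ?expR_gt0.
congr (_ / _); rewrite iterS /walk_op; apply: eq_expect => x.
by rewrite indicE in_setT mul1r add0r.
Qed.

End conditional_law.

(** * Exponential moments *)

Section exponential_moments.
Context {R : realType}.
Notation mu := (@lebesgue_measure R).
Variable p : R -> R.
Hypotheses (mp : measurable_fun setT p) (p0 : forall x : R, 0 <= p x).
Hypothesis pneg : forall x : R, x < 0 -> p x = 0.
Hypothesis p1 : \int[mu]_x p x = 1.
Hypothesis iexp : forall t, mu.-integrable setT (EFin \o (fun x => expR (t * x) * p x)).

Definition laplace t := \int[mu]_x (expR (t * x) * p x).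
Definition laplace1 t := \int[mu]_x (x * (expR (t * x) * p x)).

Let ip : mu.-integrable setT (EFin \o p).
Proof.
have := iexp 0; congr (mu.-integrable _ _); apply/funext => x /=.
by rewrite mul0r expR0 mul1r.
Qed.

(** By the inequality of means, [2 * p x] is at most [la] times the density weighted by
    [expR (t * x)] plus [1 / la] times the one weighted by [expR (- t * x)]. If the first integral
    vanished, a large [la] would give [2 < 1]. *)
Lemma laplace_gt0 t : 0 < laplace t.
Proof.
have l0 s : 0 <= laplace s by apply: Rintegral_ge0 => x _; rewrite mulr_ge0 ?expR_ge0.
rewrite lt0r l0 andbT; apply/eqP => Lt.
pose la := laplace (- t) + 1.
have la0 : 0 < la by rewrite ltr_wpDl.
have iD : mu.-integrable setT (EFin \o (fun x => la * (expR (t * x) * p x) + la^-1 * (expR (- t * x) * p x))).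
  have -> : EFin \o (fun x => la * (expR (t * x) * p x) + la^-1 * (expR (- t * x) * p x)) =
    ((EFin \o (fun x => (la * (expR (t * x) * p x))%R)) \+ (EFin \o (fun x => (la^-1 * (expR (- t * x) * p x))%R)))%E.
    by apply/funext.
  by apply: integrableD => //; exact: integrable_cstM.
have : \int[mu]_x (2 * p x) <= \int[mu]_x (la * (expR (t * x) * p x) + la^-1 * (expR (- t * x) * p x)).
  apply: le_Rintegral => //; first exact: integrable_cstM.
  move=> x _; rewrite !mulrA -mulrDl ler_wpM2r// mulNr expRN.
  set e := expR (t * x); have e0 : 0 < e by exact: expR_gt0.
  have -> : la * e + la^-1 / e = 2 + (la * e - 1) ^+ 2 / (la * e).
    by field; rewrite !gt_eqF.
  by rewrite lerDl divr_ge0 ?sqr_ge0// mulr_ge0// ltW.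
rewrite RintegralD//; try exact: integrable_cstM.
rewrite !RintegralZl// p1 -/(laplace t) Lt mulr0 add0r -/(laplace (- t)).
have : la^-1 * laplace (- t) < 1 by rewrite mulrC ltr_pdivrMr// mul1r ltrDl.
lra.
Qed.

Lemma le_expR_mul (x : R) : 0 <= x -> x <= expR x.
Proof. by move=> x0; have := expR_ge1Dx x; lra. Qed.

Lemma moment_bound t x : `|x * (expR (t * x) * p x)| <= expR ((t + 1) * x) * p x.
Proof.
have [x0|x0] := leP 0 x; last by rewrite pneg// !mulr0 normr0.
rewrite ger0_norm ?mulr_ge0 ?expR_ge0// mulrA ler_wpM2r//.
by rewrite mulrDl mul1r expRD mulrC ler_wpM2l ?expR_ge0// le_expR_mul.
Qed.

Lemma integrable_moment1 t : mu.-integrable setT (EFin \o (fun x => x * (expR (t * x) * p x))).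
Proof.
apply: (le_integrable measurableT _ _ (iexp (t + 1))).
  apply/measurable_EFinP; apply: measurable_funM => //.
  by apply/measurable_EFinP; exact: measurable_int (iexp t).
move=> x _ /=; rewrite lee_fin [leRHS]ger0_norm ?mulr_ge0 ?expR_ge0//.
exact: moment_bound.
Qed.

Lemma is_derive_laplace (t : R) : is_derive t 1 laplace (laplace1 t).
Proof.
pose f (s x : R) := expR (s * x) * p x.
have dfx (s x : R) : is_derive s 1 (f ^~ x) (x * f s x).
  have -> : x * f s x = (x * expR (s * x)) * p x by rewrite mulrA.
  by apply: is_derive_eq; rewrite /GRing.scale/=; ring.
have It : `]t - 1, t + 1[%classic t by rewrite /= in_itv/= ltrBlDr !ltrDl ltr01.
have d1E s x : partial1of2 f s x = x * f s x.
  by rewrite /partial1of2 derive1E; case: (dfx s x).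
have h1 s : `]t - 1, t + 1[%classic s -> mu.-integrable setT (EFin \o f s).
  by move=> _; exact: iexp.
have h2 s x : `]t - 1, t + 1[%classic s -> setT x -> derivable (f ^~ x) s 1.
  by move=> _ _; case: (dfx s x).
(* The dominating tilt is [t + 2]: one unit for the neighbourhood [s < t + 1], one for
   [x <= expR x]. *)
have h3 x : 0 <= f (t + 2) x by rewrite mulr_ge0 ?expR_ge0.
have h4 s x : `]t - 1, t + 1[%classic s -> setT x -> `|partial1of2 f s x| <= f (t + 2) x.
  rewrite /= in_itv/= => /andP[_ st] _; rewrite d1E.
  apply: (le_trans (moment_bound s x)); have [x0|x0] := leP 0 x; last by rewrite /f pneg// !mulr0.
  by rewrite /f ler_wpM2r// ler_expR ler_wpM2r//; lra.
have D := derivable_under_integral measurableT It h1 h2 h3 (iexp (t + 2)) h4.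
have E := differentiation_under_integral measurableT It h1 h2 h3 (iexp (t + 2)) h4.
split; first exact: D.
rewrite -derive1E; transitivity (\int[mu]_y partial1of2 f t y); first exact: E.
by apply: eq_Rintegral => x _; rewrite d1E.
Qed.

Lemma centered_moment t a :
  \int[mu]_x ((x - a) * (expR (t * x) * p x)) = laplace1 t - a * laplace t.
Proof.
under eq_Rintegral do rewrite mulrBl.
rewrite RintegralB//; last 2 first.
- exact: integrable_moment1.
- exact: integrable_cstM.
by rewrite RintegralZl.
Qed.

(** [x - a] and [expR ((t - s) * (x - a)) - 1] have the same sign. So the mean is nondecreasing in
    the tilt, which is how a large mean forces a large tilt. *)
Lemma laplace_mean_mono s t a : s <= t -> laplace1 s = a * laplace s ->
  a * laplace t <= laplace1 t.
Proof.
move=> st ms; rewrite -subr_ge0 -centered_moment.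
have c0 : \int[mu]_x (expR ((t - s) * a) * ((x - a) * (expR (s * x) * p x))) = 0.
  rewrite RintegralZl//; last first.
    have -> : EFin \o (fun x => (x - a) * (expR (s * x) * p x)) =
      ((EFin \o (fun x => (x * (expR (s * x) * p x))%R)) \- (EFin \o (fun x => (a * (expR (s * x) * p x))%R)))%E.
      by apply/funext => x /=; rewrite mulrBl.
    by apply: integrableB => //; [exact: integrable_moment1|exact: integrable_cstM].
  by rewrite centered_moment ms subrr mulr0.
have iB u : mu.-integrable setT (EFin \o (fun x => (x - a) * (expR (u * x) * p x))).
  have -> : EFin \o (fun x => (x - a) * (expR (u * x) * p x)) =
    ((EFin \o (fun x => (x * (expR (u * x) * p x))%R)) \- (EFin \o (fun x => (a * (expR (u * x) * p x))%R)))%E.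
    by apply/funext => x /=; rewrite mulrBl.
  by apply: integrableB => //; [exact: integrable_moment1|exact: integrable_cstM].
rewrite -c0; apply: le_Rintegral => //; first exact: integrable_cstM.
move=> x _.
have -> : expR ((t - s) * a) * ((x - a) * (expR (s * x) * p x)) =
  (x - a) * (expR (s * x + (t - s) * a) * p x) by rewrite expRD; ring.
rewrite -subr_ge0 -mulrBr -mulrBl mulrA mulr_ge0//.
have [xa|xa] := leP a x.
  by rewrite mulr_ge0 ?subr_ge0// ler_expR; nra.
by rewrite mulr_le0 ?subr_le0 ?(ltW xa)// ler_expR; nra.
Qed.

Context d {T : measurableType d} (P : probability T R) (Y : {RV P >-> R}).
Hypothesis Yp : forall B : set R, measurable B ->
  P (Y @^-1` B) = (\int[mu]_(x in B) (p x)%:E)%E.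

Lemma mgf_laplace t : mgf Y t = laplace t.
Proof.
rewrite /mgf /mmt_gen_fun unlock /laplace /Rintegral; congr fine.
rewrite -(@integral_comp_density _ _ _ P p mp p0 Y Yp (fun x => (expR (t * x))%:E)).
- by apply: eq_integral => w _ /=; rewrite mulrC.
- apply/measurable_EFinP; apply: continuous_measurable_fun.
  by have := @continuous_expR_affine R t 0; under eq_fun do rewrite subr0.
- by move=> x; rewrite lee_fin expR_ge0.
Qed.

Lemma mgf_m_laplace t : mgf_m Y t = laplace1 t / laplace t.
Proof.
rewrite /mgf_m; have -> : (fun u => ln (mgf Y u)) = (fun u => ln (laplace u)).
  by apply/funext => u; rewrite mgf_laplace.
have dL := is_derive_laplace t.
have dl := is_derive1_ln (laplace_gt0 t).
rewrite derive1E; have := @is_derive1_comp _ (@ln R) laplace t _ _ dl dL.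
by case=> _ ->; rewrite /GRing.scale/= mulrC.
Qed.

End exponential_moments.

(** * Regular variation and the saddle point *)

Section regular_variation.
Context {R : realType}.
Notation mu := (@lebesgue_measure R).

Lemma near_pinfty_ge (A : R -> Prop) : (\forall x \near +oo, A x) ->
  exists x0, 1 <= x0 /\ forall x, x0 <= x -> A x.
Proof.
move=> [M [_ MA]]; exists (Num.max 1 (M + 1)); split; first by rewrite le_max lexx.
by move=> x; rewrite ge_max => /andP[_ Mx]; apply: MA; rewrite (lt_le_trans _ Mx)// ltrDl.
Qed.

(* [H = ln h] near infinity; its derivative is [(beta + eps x) / x]. *)
Lemma in_Rbeta_exp (beta : R) (h : R -> R) : 0 < beta -> in_Rbeta beta h ->
  exists (x0 : R) (H dH : R -> R), [/\ 1 <= x0,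
    forall x, x0 <= x -> h x = expR (H x),
    forall x, x0 <= x -> is_derive x 1 H (dH x) &
    forall x, x0 <= x -> beta / 2 <= x * dH x <= 2 * beta].
Proof.
move=> beta0 [l [eps [[deps [ceps lE]] [_ [_ hE]]]]].
have b2 : 0 < beta / 2 by rewrite divr_gt0.
have [x1 [x11 hx1]] := near_pinfty_ge hE.
have [x2 [x21 hx2]] := near_pinfty_ge (cvgr0_norm_le _ ceps _ b2).
pose L x := \int[mu]_(u in `[1, x]) (eps u / u).
pose H x := beta * ln x + L x.
exists (Num.max 2 (Num.max x1 x2)), H, (fun x => (beta + eps x) / x).
have ceu x : 1 <= x -> {for x, continuous (fun u => eps u / u)}.
  move=> x1'; apply: (@continuousM _ R^o).
    have [dx _] := deps x x1'.
    exact/differentiable_continuous/derivable1_diffP.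
  by apply: continuousV => //; rewrite gt_eqF// (lt_le_trans _ x1').
have xs x : Num.max 2 (Num.max x1 x2) <= x -> [/\ 2 <= x, x1 <= x & x2 <= x].
  by rewrite !ge_max => /and3P[].
split.
- by rewrite le_max; apply/orP; left; lra.
- move=> x /xs[x2' xx1 xx2].
  have x0 : 0 < x by lra.
  by rewrite hx1// lE ?(le_trans x11)// /powR gt_eqF// -expRD.
- move=> x /xs[x2' xx1 xx2].
  have x0 : 0 < x by lra.
  have iu : mu.-integrable [set` Interval (BLeft 1) (BRight (x + 1))] (EFin \o (fun u => eps u / u)).
    apply: continuous_compact_integrable; first exact: segment_compact.
    apply: continuous_in_subspaceT => y; rewrite inE/= in_itv/= => /andP[y1 _].
    exact: ceu.
  have xx : x < x + 1 by rewrite ltrDl.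
  have x1' : 1 < x by lra.
  have [dL EL] := @continuous_FTC1_closed R (fun u => eps u / u) 1 x (x + 1) xx iu x1' (ceu x (ltW x1')).
  have dL' : is_derive x 1 L (eps x / x).
    by split; [exact: dL|rewrite -derive1E; exact: EL].
  have dl := is_derive1_ln x0.
  apply: is_derive_eq; rewrite /GRing.scale/=; field.
  by rewrite gt_eqF.
- move=> x /xs[x2' xx1 xx2].
  have x0 : 0 < x by lra.
  have -> : x * ((beta + eps x) / x) = beta + eps x by field; rewrite gt_eqF.
  have := hx2 x xx2; rewrite ler_norml => /andP[e1 e2].
  by apply/andP; split; lra.
Qed.

Lemma ln_ge_sub1V (s : R) : 0 < s -> 1 - s^-1 <= ln s.
Proof.
move=> s0; have := @le_ln1Dx R (s^-1 - 1).
rewrite addrCA subrr addr0 lnV ?posrE//.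
have : -1 < s^-1 - 1 by rewrite -subr_gt0 opprK subrK invr_gt0.
by move=> h /(_ h); lra.
Qed.

Section saddle_point.
Variables (h H dH g : R -> R) (x0 beta : R).
Hypotheses (beta0 : 0 < beta) (x01 : 1 <= x0).
Hypothesis hH : forall x, x0 <= x -> h x = expR (H x).
Hypothesis dHH : forall x, x0 <= x -> is_derive x 1 H (dH x).
Hypothesis dHb : forall x, x0 <= x -> beta / 2 <= x * dH x <= 2 * beta.
Hypothesis dg : forall x : R, 0 < x -> is_derive x 1 g (h x).

(** Potter exponents bracketing the range of [x * dH x]. The lower one is capped at 1 for
    [h_ratio_low']; the upper one is a natural number so that ratios are bounded by integer
    powers. *)
Definition low_exponent := Num.min (beta / 2) 1.
Definition high_exponent := (Num.truncn (2 * beta)).+1.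
Let b := low_exponent.
Let B := high_exponent.

Lemma low_exponent_gt0 : 0 < b.
Proof. by rewrite /b /low_exponent lt_min divr_gt0//=. Qed.

Let b0 : 0 < b := low_exponent_gt0.
Let b1 : b <= 1. Proof. by rewrite ge_min lexx orbT. Qed.

Let x0_gt0 x : x0 <= x -> 0 < x.
Proof. by move=> xx; rewrite (lt_le_trans _ xx)// (lt_le_trans _ x01). Qed.

Lemma potter_low x y : x0 <= x -> x <= y -> b * ln (y / x) <= H y - H x.
Proof.
move=> x0x xy; have xp := x0_gt0 x0x; have yp : 0 < y by exact: lt_le_trans xy.
rewrite ln_div ?posrE//.
suff : H x - b * ln x <= H y - b * ln y by lra.
apply: (@le_is_derive_ge0 R (fun z => H z - b * ln z) (fun z => dH z - b / z) x y xy) => z /andP[].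
  move=> xz _; have x0z := le_trans x0x xz; have zp := x0_gt0 x0z.
  have dz := dHH x0z; have dl := is_derive1_ln zp.
  by apply: is_derive_eq; rewrite /GRing.scale/=; ring.
move=> /ltW xz _; have x0z := le_trans x0x xz; have zp := x0_gt0 x0z.
rewrite subr_ge0 ler_pdivrMr// mulrC; have /andP[hz _] := dHb x0z.
by apply: le_trans hz; rewrite ge_min lexx.
Qed.

Lemma potter_high x y : x0 <= x -> x <= y -> H y - H x <= B%:R * ln (y / x).
Proof.
move=> x0x xy; have xp := x0_gt0 x0x; have yp : 0 < y by exact: lt_le_trans xy.
rewrite ln_div ?posrE//.
suff : B%:R * ln x - H x <= B%:R * ln y - H y by lra.
apply: (@le_is_derive_ge0 R (fun z => B%:R * ln z - H z) (fun z => B%:R / z - dH z) x y xy) => z /andP[].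
  move=> xz _; have x0z := le_trans x0x xz; have zp := x0_gt0 x0z.
  have dz := dHH x0z; have dl := is_derive1_ln zp.
  by apply: is_derive_eq; rewrite /GRing.scale/=; ring.
move=> /ltW xz _; have x0z := le_trans x0x xz; have zp := x0_gt0 x0z.
rewrite subr_ge0 ler_pdivlMr// mulrC; have /andP[_ hz] := dHb x0z.
by apply: le_trans hz _; rewrite ltW// truncnS_gt.
Qed.

Lemma h_gt0 x : x0 <= x -> 0 < h x.
Proof. by move=> xx; rewrite hH// expR_gt0. Qed.

Lemma h_ratio_low x y : x0 <= x -> x <= y -> h x * (1 + b * (1 - x / y)) <= h y.
Proof.
move=> x0x xy; have xp := x0_gt0 x0x; have yp : 0 < y by exact: lt_le_trans xy.
have x0y := le_trans x0x xy.
have -> : h y = h x * expR (H y - H x) by rewrite !hH// -expRD; congr expR; ring.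
rewrite ler_pM2l ?h_gt0//.
apply: (le_trans _ (expR_ge1Dx _)); rewrite lerD2l.
apply: (le_trans _ (potter_low x0x xy)); rewrite ler_pM2l//.
have := ln_ge_sub1V (divr_gt0 yp xp).
by rewrite invf_div.
Qed.

Lemma h_ratio_low' x y : x0 <= x -> x <= y -> h x <= h y * (1 - b / 2 * (1 - x / y)).
Proof.
move=> x0x xy; have xp := x0_gt0 x0x; have yp : 0 < y by exact: lt_le_trans xy.
have hr := h_ratio_low x0x xy.
have hx0 := h_gt0 x0x.
set v := b * (1 - x / y) in hr *.
have r1 : x / y <= 1 by rewrite ler_pdivrMr// mul1r.
have r0 : 0 < x / y by rewrite divr_gt0.
have v0 : 0 <= v by rewrite mulr_ge0 ?subr_ge0// ltW.
have v1 : v <= 1.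
  by rewrite -[1]mulr1 ler_pM// ?subr_ge0 ?(ltW b0)// gerBl ltW.
have -> : b / 2 * (1 - x / y) = v / 2 by rewrite /v; ring.
(* [(1 + v) * (1 - v / 2) >= 1] for [v] between 0 and 1, which is where the cap on [b] enters. *)
have : h x * (1 + v) * (1 - v / 2) <= h y * (1 - v / 2) by rewrite ler_wpM2r// subr_ge0; lra.
apply: le_trans; rewrite -[leLHS]mulr1 -mulrA ler_pM2l//.
have : v * v <= v by rewrite ler_piMr.
by lra.
Qed.

Lemma h_ratio_high x y : x0 <= x -> x <= y -> h y <= h x * (y / x) ^+ B.
Proof.
move=> x0x xy; have xp := x0_gt0 x0x; have yp : 0 < y by exact: lt_le_trans xy.
have x0y := le_trans x0x xy.
have -> : h y = h x * expR (H y - H x) by rewrite !hH// -expRD; congr expR; ring.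
rewrite ler_pM2l ?h_gt0//.
have r0 : 0 < y / x by rewrite divr_gt0.
rewrite -[X in _ <= X ^+ _](lnK (_ : y / x \is Num.pos)) ?posrE// -expRM_natl ler_expR.
exact: potter_high.
Qed.

Lemma saddle_exists t : h x0 <= t -> exists2 x, x0 <= x & h x = t.
Proof.
move=> t0; have hx0 := h_gt0 (lexx x0).
have tp : 0 < t by exact: lt_le_trans t0.
have xp := x0_gt0 (lexx x0).
(* At this point the lower Potter bound already lifts [H] to [ln t], so the intermediate value
   theorem applies on [[x0, X]]. *)
pose X := x0 * expR ((ln t - H x0) / b).
have tH : H x0 <= ln t by rewrite -ler_expR lnK ?posrE// -hH.
have X1 : x0 <= X.
  rewrite ler_peMr ?(ltW xp)// -expR0 ler_expR divr_ge0 ?subr_ge0// ltW//.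
have HX : ln t <= H X.
  have := potter_low (lexx x0) X1.
  have -> : X / x0 = expR ((ln t - H x0) / b) by rewrite /X; field; rewrite gt_eqF.
  by rewrite expRK mulrC divfK ?gt_eqF//; lra.
have cH : {within `[x0, X], continuous H}.
  apply: continuous_in_subspaceT => y; rewrite inE/= in_itv/= => /andP[xy _].
  exact/is_derive_continuous/dHH.
have [|x] := @IVT R H x0 X (ln t) X1 cH.
  by rewrite ge_min tH/= le_max HX orbT.
rewrite in_itv/= => /andP[xx _] Hx; exists x => //.
by rewrite hH// Hx lnK ?posrE.
Qed.

Lemma saddle_large M : exists t0, forall t x, t0 <= t -> x0 <= x -> h x = t -> M <= x.
Proof.
pose X := Num.max x0 M; have X0 : x0 <= X by rewrite le_max lexx.
exists (h X + 1) => t x tt xx hx; rewrite leNgt; apply/negP => xM.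
have xX : x <= X by rewrite le_max (ltW xM) orbT.
have := h_ratio_low xx xX; have hx0 := h_gt0 xx.
have xp := x0_gt0 xx; have Xp := x0_gt0 X0.
have : 0 <= h x * (b * (1 - x / X)).
  by rewrite mulr_ge0 ?(ltW hx0)// mulr_ge0 ?(ltW b0)// subr_ge0 ler_pdivrMr// mul1r.
by rewrite hx in hx0 *; rewrite -hx in tt *; lra.
Qed.

Section gap.
Variables (t xs : R).
Hypotheses (xs0 : 2 * x0 <= xs) (hxs : h xs = t).
(** Up to constants depending on [beta] this is the Laplace scale, one over the root of the
    derivative of [h] at [xs], because [xs * dH xs] is of order [beta]. [D] is the gap between [g]
    and its tangent at [xs], so the tilted density is proportional to [expR (q x - D x)]. *)
Let sg := Num.sqrt (xs / t).
Let D x := g x - g xs - t * (x - xs).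
Let x0xs : x0 <= xs. Proof. by have := x01; have := xs0; lra. Qed.
Let xsp : 0 < xs := x0_gt0 x0xs.
Let tp : 0 < t. Proof. by rewrite -hxs h_gt0. Qed.
Let sg0 : 0 < sg. Proof. by rewrite sqrtr_gt0 divr_gt0. Qed.
Let sg2 : sg ^+ 2 = xs / t. Proof. by rewrite sqr_sqrtr// divr_ge0// ltW. Qed.
Let tsg : t * sg ^+ 2 = xs. Proof. by rewrite sg2; field; rewrite gt_eqF. Qed.

Lemma is_derive_gap x : x0 <= x -> is_derive x 1 D (h x - t).
Proof.
move=> xx; have d := dg (x0_gt0 xx).
by apply: is_derive_eq; rewrite /GRing.scale/=; ring.
Qed.

Let D0 : D xs = 0. Proof. by rewrite /D !subrr mulr0 subr0. Qed.

Let quad_eq x : ((x - xs) / sg) ^+ 2 = t / xs * (x - xs) ^+ 2.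
Proof. by rewrite expr_div_n sg2; field; rewrite !gt_eqF. Qed.

Let is_derive_quad (k x : R) : is_derive x 1 (fun x => k * (x - xs) ^+ 2) (2 * k * (x - xs)).
Proof. by apply: is_derive_eq; rewrite /GRing.scale/=; ring. Qed.

Lemma gap_left x : x0 <= x -> x <= xs -> b / 4 * ((x - xs) / sg) ^+ 2 <= D x.
Proof.
move=> xx xxs; rewrite quad_eq mulrA; set k := b / 4 * (t / xs).
have := @le_is_derive_ge0 R (fun z => k * (z - xs) ^+ 2 - D z)
  (fun z => 2 * k * (z - xs) - (h z - t)) x xs xxs.
rewrite subrr expr0n mulr0 D0 subrr subr_le0; apply.
  move=> z /andP[xz _]; have d1 := is_derive_gap (le_trans xx xz).
  by have d2 := is_derive_quad k z; apply: is_derive_eq.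
move=> z /andP[/ltW xz /ltW zxs].
have := h_ratio_low' (le_trans xx xz) zxs; rewrite hxs => hz.
have -> : 2 * k * (z - xs) = - (t * (b / 2 * (1 - z / xs))).
  by rewrite /k; field; rewrite gt_eqF.
by lra.
Qed.

Lemma gap_right x : xs <= x -> x <= 2 * xs -> b / 4 * ((x - xs) / sg) ^+ 2 <= D x.
Proof.
move=> xx x2; rewrite quad_eq mulrA; set k := b / 4 * (t / xs).
have := @le_is_derive_ge0 R (fun z => D z - k * (z - xs) ^+ 2)
  (fun z => (h z - t) - 2 * k * (z - xs)) xs x xx.
rewrite subrr expr0n mulr0 D0 subrr subr_ge0; apply.
  move=> z /andP[xz _]; have d1 := is_derive_gap (le_trans x0xs xz).
  by have d2 := is_derive_quad k z; apply: is_derive_eq.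
move=> z /andP[/ltW xz /ltW zx].
have zp : 0 < z by exact: lt_le_trans xz.
have := h_ratio_low x0xs xz; rewrite hxs => hz.
have : t * (b * ((z - xs) / (2 * xs))) <= t * (b * (1 - xs / z)).
  rewrite ler_pM2l// ler_pM2l//.
  have -> : 1 - xs / z = (z - xs) / z by field; rewrite gt_eqF.
  rewrite ler_wpM2l ?subr_ge0// lef_pV2 ?posrE ?mulr_gt0//.
  exact: le_trans x2.
have -> : 2 * k * (z - xs) = t * (b * ((z - xs) / (2 * xs))).
  by rewrite /k; field; rewrite gt_eqF.
by lra.
Qed.

(** Quadratic growth can fail here when [beta < 1]. What remains is the slope: [h - t] is at least
    [t * b / 2] beyond [2 * xs]. *)
Lemma gap_far x : 2 * xs <= x -> b / 4 * (t * sg) * ((x - xs) / sg) <= D x.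
Proof.
move=> xx.
have -> : b / 4 * (t * sg) * ((x - xs) / sg) = b / 4 * t * (x - xs).
  by field; rewrite gt_eqF.
have x2 : xs <= 2 * xs by have := xsp; lra.
have := gap_right x2 (lexx _); rewrite quad_eq.
have -> : b / 4 * (t / xs * (2 * xs - xs) ^+ 2) = b / 4 * t * xs.
  by field; rewrite gt_eqF.
move=> D2.
have k0 : 0 <= b / 4 * t * xs by rewrite !mulr_ge0// ltW.
suff : D (2 * xs) - b / 4 * t * (2 * xs - xs) <= D x - b / 4 * t * (x - xs) by lra.
apply: (@le_is_derive_ge0 R (fun z => D z - b / 4 * t * (z - xs))
  (fun z => (h z - t) - b / 4 * t) (2 * xs) x xx).
  move=> z /andP[xz _]; have d1 := is_derive_gap (le_trans x0xs (le_trans x2 xz)).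
  by apply: is_derive_eq; rewrite /GRing.scale/=; ring.
move=> z /andP[/ltW xz _]; have x2z := le_trans x2 xz.
have zp : 0 < z by exact: lt_le_trans x2z.
have := h_ratio_low x0xs x2z; rewrite hxs => hz.
have : t * (b * (1 / 2)) <= t * (b * (1 - xs / z)).
  rewrite ler_pM2l// ler_pM2l//.
  have : xs / z <= 1 / 2 by rewrite ler_pdivrMr//; lra.
  by lra.
have : 0 <= t * b by rewrite mulr_ge0// ltW.
by lra.
Qed.

Lemma gap_ge x : 1 <= t * sg -> x0 <= x -> b / 4 * (`|(x - xs) / sg| - 1) <= D x.
Proof.
move=> ts xx; set y := (x - xs) / sg.
have q : b / 4 * (`|y| - 1) <= b / 4 * y ^+ 2.
  rewrite ler_pM2l ?divr_gt0//; have := sqr_ge0 (`|y| - 1 / 2).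
  by rewrite -[y ^+ 2]real_normK ?num_real//; lra.
have [xl|/ltW xr] := leP x xs; first by rewrite (le_trans q)// gap_left.
have [x2|/ltW x2] := leP x (2 * xs); first by rewrite (le_trans q)// gap_right.
apply: le_trans (gap_far x2); rewrite -/y.
have y0 : 0 <= y by rewrite divr_ge0 ?subr_ge0// ltW.
have -> : b / 4 * (t * sg) * y = b / 4 * (t * sg * y) by ring.
rewrite ger0_norm// ler_pM2l ?divr_gt0//.
have : 1 * y <= t * sg * y by rewrite ler_wpM2r.
by lra.
Qed.

(** Regular variation says nothing below [x0]; a gap of order [(t * sg) ^+ 2] at [x0] compensates
    for the crude bound used there. *)
Lemma gap_at_x0 : b / 16 * (t * sg) ^+ 2 <= D x0.
Proof.
apply: le_trans (gap_left (lexx _) x0xs); rewrite quad_eq.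
have -> : (t * sg) ^+ 2 = t * xs by rewrite -tsg; ring.
have -> : b / 16 * (t * xs) = b / 4 * (t / xs) * (xs / 2) ^+ 2 by field; rewrite gt_eqF.
have -> : b / 4 * (t / xs * (x0 - xs) ^+ 2) = b / 4 * (t / xs) * (x0 - xs) ^+ 2 by ring.
apply: ler_wpM2l; first by rewrite mulr_ge0// divr_ge0// ltW.
rewrite -[leRHS]sqrrN opprB lerXn2r ?nnegrE ?subr_ge0//; first by rewrite divr_ge0// ltW.
by have := xs0; lra.
Qed.

(** Lipschitz constant for the power of exponent [B] on [[1, 2]], as in [pow_sub1]; to the left of
    [xs] Bernoulli's inequality needs only [B%:R]. *)
Definition gap_const : R := B%:R * 2 ^+ B.

Let pow_sub1 (s : R) n : 1 <= s <= 2 -> s ^+ n - 1 <= n%:R * 2 ^+ n * (s - 1).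
Proof.
move=> /andP[s1 s2]; elim: n => [|n ih]; first by rewrite expr0 subrr !mul0r.
have -> : s ^+ n.+1 - 1 = s ^+ n * (s - 1) + (s ^+ n - 1) by rewrite exprS; ring.
have h1 : s ^+ n * (s - 1) <= 2 ^+ n.+1 * (s - 1).
  rewrite ler_wpM2r ?subr_ge0// (@le_trans _ _ (2 ^+ n))//.
    by rewrite lerXn2r ?nnegrE// (le_trans _ s1).
  by rewrite ler_weXn2l ?ler1n.
have h2 : n%:R * 2 ^+ n * (s - 1) <= n%:R * 2 ^+ n.+1 * (s - 1).
  by rewrite ler_wpM2r ?subr_ge0// ler_wpM2l// ler_weXn2l ?ler1n.
rewrite -natr1; apply: (le_trans (lerD h1 (le_trans ih h2))).
by rewrite le_eqVlt; apply/orP; left; apply/eqP; ring.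
Qed.

Lemma gap_le x : xs / 2 <= x <= 2 * xs -> D x <= gap_const * ((x - xs) / sg) ^+ 2.
Proof.
move=> /andP[xl xr]; rewrite quad_eq mulrA; set k := gap_const * (t / xs).
have B1 : (1 : R) <= 2 ^+ B by rewrite exprn_ege1 ?ler1n.
have GB : B%:R <= gap_const by rewrite ler_peMr.
have k0 : 0 <= t * gap_const by rewrite mulr_ge0 ?(ltW tp)// mulr_ge0// exprn_ge0.
have [xxs|/ltW xxs] := leP x xs.
  have xx : x0 <= x by have := xs0; lra.
  have := @le_is_derive_ge0 R (fun z => D z - k * (z - xs) ^+ 2)
    (fun z => (h z - t) - 2 * k * (z - xs)) x xs xxs.
  rewrite subrr expr0n mulr0 D0 subrr subr_le0; apply.
    move=> z /andP[xz _]; have d1 := is_derive_gap (le_trans xx xz).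
    by have d2 := is_derive_quad k z; apply: is_derive_eq.
  move=> z /andP[/ltW xz /ltW zxs]; have x0z := le_trans xx xz; have zp := x0_gt0 x0z.
  have hr := h_ratio_high x0z zxs; rewrite hxs in hr.
  have s01 : 0 <= 1 - z / xs <= 1.
    by rewrite subr_ge0 ler_pdivrMr// mul1r zxs gerBl divr_ge0 ?ltW.
  have : t * (1 - B%:R * (1 - z / xs)) <= h z.
    apply: (@le_trans _ _ (t * (z / xs) ^+ B)).
      rewrite ler_pM2l//; have := bernoulli_ge B s01.
      by rewrite subKr.
    rewrite -(@ler_pM2r _ ((xs / z) ^+ B)) ?exprn_gt0 ?divr_gt0//.
    rewrite -mulrA -exprMn.
    have -> : z / xs * (xs / z) = 1 by field; rewrite !gt_eqF.
    by rewrite expr1n mulr1.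
  have -> : 2 * k * (z - xs) = - (2 * (t * gap_const * (1 - z / xs))).
    by rewrite /k; field; rewrite gt_eqF.
  have : t * (B%:R * (1 - z / xs)) <= t * gap_const * (1 - z / xs).
    by rewrite mulrA ler_wpM2r ?ler_pM2l//; case/andP: s01.
  have : 0 <= t * gap_const * (1 - z / xs) by rewrite mulr_ge0//; case/andP: s01.
  by lra.
have := @le_is_derive_ge0 R (fun z => k * (z - xs) ^+ 2 - D z)
  (fun z => 2 * k * (z - xs) - (h z - t)) xs x xxs.
rewrite subrr expr0n mulr0 D0 subrr subr_ge0; apply.
  move=> z /andP[xz _]; have d1 := is_derive_gap (le_trans x0xs xz).
  by have d2 := is_derive_quad k z; apply: is_derive_eq.
move=> z /andP[/ltW xz /ltW zx].
have hr := h_ratio_high x0xs xz; rewrite hxs in hr.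
have s12 : 1 <= z / xs <= 2.
  by rewrite ler_pdivlMr// mul1r xz ler_pdivrMr//; lra.
have := pow_sub1 B s12; rewrite -/gap_const => hp.
have : t * ((z / xs) ^+ B - 1) <= t * (gap_const * (z / xs - 1)) by rewrite ler_pM2l.
have -> : 2 * k * (z - xs) = 2 * (t * gap_const * (z / xs - 1)).
  by rewrite /k; field; rewrite gt_eqF.
have : 0 <= t * gap_const * (z / xs - 1).
  by rewrite mulr_ge0// subr_ge0; case/andP: s12.
by lra.
Qed.

End gap.
End saddle_point.
End regular_variation.

(** * Tilted densities *)

Section moments_of_exponential_bound.
Context {R : realType}.
Notation mu := (@lebesgue_measure R).

Lemma Rintegral_expR_norm (r b : R) : 0 < r ->
  mu.-integrable setT (EFin \o (fun x => expR (- (r * `|x - b|)))) /\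
  \int[mu]_x expR (- (r * `|x - b|)) = 2 / r.
Proof.
move=> r0; have E := integral_expR_norm b r0; split; last by rewrite /Rintegral E.
apply/integrableP; split.
  apply/measurable_EFinP; apply: continuous_measurable_fun => x.
  apply: continuous_comp; last exact: continuous_expR.
  apply: continuousN; apply: continuousM; first exact: cst_continuous.
  apply: continuous_comp; last exact: norm_continuous.
  by apply: continuousB => //; exact: cst_continuous.
under eq_integral do rewrite /= ger0_norm ?expR_ge0//.
by rewrite E ltry.
Qed.

Variables (w : R -> R) (a sg A c : R).
Hypothesis dw : is_density w.
Hypotheses (sg0 : 0 < sg) (A0 : 0 < A) (c0 : 0 < c).
Hypothesis wb : forall x, w x <= A / sg * expR (- (c * `|(x - a) / sg|)).
Let z x := (x - a) / sg.

(** Half of the decay rate absorbs the fourth power, at the price [(8 / c) ^+ 4]; the other half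
    integrates to [4 / c] in units of [sg]. *)
Definition moment4_const := A * (4 / c) * (8 / c) ^+ 4.

Let w0 x : 0 <= w x. Proof. by case: dw. Qed.

Let mw : measurable_fun setT w.
Proof. by case: dw => _ iw _; apply/measurable_EFinP; exact: measurable_int iw. Qed.

Let mz : measurable_fun setT z.
Proof. by apply: measurable_funM => //; exact: measurable_funB. Qed.

Let dom x := A / sg * (8 / c) ^+ 4 * expR (- ((c / (2 * sg)) * `|x - a|)).

Let idom : mu.-integrable setT (EFin \o dom) /\ \int[mu]_x dom x = moment4_const.
Proof.
have r0 : 0 < c / (2 * sg) by rewrite divr_gt0// mulr_gt0.
have [i E] := Rintegral_expR_norm a r0.
split; first exact: integrable_cstM.
rewrite RintegralZl// E /moment4_const; field.
by rewrite !gt_eqF.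
Qed.

Let normz x : `|z x| = `|x - a| / sg.
Proof. by rewrite normrM normfV (gtr0_norm sg0). Qed.

(* [v^4 <= (8/c)^4 e^(c v / 2)] for [v >= 0]. *)
Let wz4 x : w x * z x ^+ 4 <= dom x.
Proof.
have -> : z x ^+ 4 = `|z x| ^+ 4 by rewrite -normrX ger0_norm// -[4%N]/(2 * 2)%N exprM sqr_ge0.
set v := `|z x|; have v0 : 0 <= v by exact: normr_ge0.
have e1 : v <= 8 / c * expR (c * v / 8).
  rewrite -ler_pdivrMl ?divr_gt0// invf_div.
  by have := expR_ge1Dx (c * v / 8); lra.
have e4 : v ^+ 4 <= (8 / c) ^+ 4 * expR (c * v / 2).
  apply: (@le_trans _ _ ((8 / c * expR (c * v / 8)) ^+ 4)).
    by rewrite lerXn2r ?nnegrE// mulr_ge0 ?expR_ge0// divr_ge0// ltW.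
  rewrite exprMn -expRM_natl ler_pM2l ?exprn_gt0 ?divr_gt0// ler_expR.
  by rewrite le_eqVlt; apply/orP; left; apply/eqP; field.
apply: (@le_trans _ _ (A / sg * expR (- (c * v)) * ((8 / c) ^+ 4 * expR (c * v / 2)))).
  by apply: ler_pM; rewrite ?exprn_ge0//; exact: wb.
have -> : A / sg * expR (- (c * v)) * ((8 / c) ^+ 4 * expR (c * v / 2)) =
  A / sg * (8 / c) ^+ 4 * expR (- (c * v) + c * v / 2) by rewrite expRD; ring.
rewrite /dom ler_pM2l; last by rewrite mulr_gt0 ?exprn_gt0 ?divr_gt0.
rewrite ler_expR le_eqVlt; apply/orP; left; apply/eqP.
by rewrite /v normz; field; rewrite gt_eqF.
Qed.

Let wz4_ge0 x : 0 <= w x * z x ^+ 4.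
Proof. by rewrite mulr_ge0// -[4%N]/(2 * 2)%N exprM sqr_ge0. Qed.

Lemma integrable_wz4 : mu.-integrable setT (EFin \o (fun x => w x * z x ^+ 4)).
Proof.
have [i _] := idom; apply: (le_integrable measurableT _ _ i).
  by apply/measurable_EFinP; apply: measurable_funM => //; exact: measurable_funX.
move=> x _ /=; rewrite lee_fin ger0_norm// (le_trans (wz4 x))// ler_norm//.
Qed.

Lemma moment4_le : \int[mu]_x (w x * z x ^+ 4) <= moment4_const.
Proof.
have [i <-] := idom; apply: le_Rintegral => //; exact: integrable_wz4.
Qed.

Let iw4 : mu.-integrable setT (EFin \o (fun x => w x + w x * z x ^+ 4)).
Proof.
have -> : EFin \o (fun x => w x + w x * z x ^+ 4) =
  ((EFin \o w) \+ (EFin \o (fun x => (w x * z x ^+ 4)%R)))%E by apply/funext.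
by apply: integrableD => //; [case: dw|exact: integrable_wz4].
Qed.

Let z4E x : z x ^+ 4 = (z x ^+ 2) ^+ 2. Proof. by ring. Qed.

Lemma integrable_wz2 : mu.-integrable setT (EFin \o (fun x => w x * z x ^+ 2)).
Proof.
apply: (le_integrable measurableT _ _ iw4).
  by apply/measurable_EFinP; apply: measurable_funM => //; exact: measurable_funX.
move=> x _ /=; rewrite lee_fin ger0_norm; last by apply: mulr_ge0 => //; exact: sqr_ge0.
rewrite (le_trans _ (ler_norm _))// -[X in X + _]mulr1 -mulrDr ler_wpM2l// z4E.
by have := sqr_ge0 (z x ^+ 2 - 1); have := sqr_ge0 (z x); lra.
Qed.

Lemma moment2_le : \int[mu]_x (w x * z x ^+ 2) <= 1 + moment4_const.
Proof.
apply: (@le_trans _ _ (\int[mu]_x (w x + w x * z x ^+ 4))).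
  apply: le_Rintegral => //; first exact: integrable_wz2.
  move=> x _; rewrite -[X in X + _]mulr1 -mulrDr ler_wpM2l// z4E.
  by have := sqr_ge0 (z x ^+ 2 - 1); have := sqr_ge0 (z x); lra.
have [_ iw w1] := dw.
by rewrite RintegralD// ?w1 ?lerD2l; [exact: moment4_le|exact: integrable_wz4].
Qed.

Lemma integrable_wz1 : mu.-integrable setT (EFin \o (fun x => w x * z x)).
Proof.
apply: (le_integrable measurableT _ _ iw4).
  by apply/measurable_EFinP; exact: measurable_funM.
move=> x _ /=; rewrite lee_fin normrM (ger0_norm (w0 x)).
rewrite (le_trans _ (ler_norm _))// -[X in X + _]mulr1 -mulrDr ler_wpM2l// z4E.
have h1 : `|z x| <= 1 + z x ^+ 2.
  by rewrite -[z x ^+ 2]real_normK ?num_real//; have := sqr_ge0 (`|z x| - 1); have := sqr_ge0 (`|z x|); lra.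
have [z1|z1] := leP (`|z x|) 1.
  by rewrite (le_trans z1)// lerDl sqr_ge0.
rewrite (@le_trans _ _ (z x ^+ 2))//.
  by rewrite -[z x ^+ 2]real_normK ?num_real// expr2 ler_peMr// ltW.
by have := sqr_ge0 (z x ^+ 2 - 1); have := sqr_ge0 (z x); lra.
Qed.

(** [|z| <= 1 + z^2] bounds the first absolute moment about [a]. In the application [a] is the
    saddle point and [m] the tilted mean. *)
Lemma mean_close (m : R) : \int[mu]_x (w x * (x - m)) = 0 ->
  mu.-integrable setT (EFin \o (fun x => w x * (x - m))) ->
  `|m - a| <= (2 + moment4_const) * sg.
Proof.
move=> m0 im; have [_ iw w1] := dw.
have E : m - a = sg * \int[mu]_x (w x * z x).
  rewrite -RintegralZl//; last exact: integrable_wz1.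
  transitivity (\int[mu]_x (w x * (x - m) + w x * (m - a))).
    rewrite RintegralD// ?m0 ?add0r ?RintegralZr ?w1 ?mul1r//.
    by have := integrable_mul_bounded iw (bounded_meas_cst (m - a)).
  by apply: eq_Rintegral => x _; rewrite /z; field; rewrite gt_eqF.
rewrite E normrM (gtr0_norm sg0) mulrC ler_pM2r//.
apply: (le_trans (le_normr_Rintegral _ integrable_wz1)) => //.
have iwz : mu.-integrable setT (EFin \o (fun x => w x + w x * z x ^+ 2)).
  have -> : EFin \o (fun x => w x + w x * z x ^+ 2) =
    ((EFin \o w) \+ (EFin \o (fun x => (w x * z x ^+ 2)%R)))%E by apply/funext.
  by apply: integrableD => //; exact: integrable_wz2.
apply: (@le_trans _ _ (\int[mu]_x (w x + w x * z x ^+ 2))).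
  apply: le_Rintegral => //; first exact: (integrable_norm integrable_wz1).
  move=> x _; rewrite normrM (ger0_norm (w0 x)) -[X in X + _]mulr1 -mulrDr ler_wpM2l//.
  by rewrite -[z x ^+ 2]real_normK ?num_real//; have := sqr_ge0 (`|z x| - 1); have := sqr_ge0 (`|z x|); lra.
rewrite RintegralD// ?w1; last exact: integrable_wz2.
by have := moment2_le; lra.
Qed.

Lemma moment2_ge (v0 : R) : 0 <= v0 ->
  (forall x, `|z x| <= 2 -> v0 / sg <= w x) -> v0 <= \int[mu]_x (w x * z x ^+ 2).
Proof.
move=> v00 wl; pose I := `[a + sg, a + 2 * sg]%classic.
have iI : mu.-integrable setT (EFin \o (\1_I : R -> R)) by apply: integrable_indic_itv.
have EI : \int[mu]_x (\1_I x : R) = sg.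
  rewrite /Rintegral integral_indic//; last exact: measurable_itv.
  rewrite (setIT I : I `&` _ = I) /I /= lebesgue_measure_itv/= lte_fin ltrD2l.
  by rewrite ltr_pMl// ltr1n/=; ring.
have -> : v0 = \int[mu]_x (v0 / sg * (\1_I x : R)).
  by rewrite RintegralZl// EI divfK// gt_eqF.
apply: le_Rintegral => //; [exact: integrable_cstM|exact: integrable_wz2|].
move=> x _; rewrite indicE; case: (boolP (x \in I)); last first.
  by move=> _; rewrite mulr0 mulr_ge0// sqr_ge0.
rewrite /I inE/= in_itv/= => /andP[xl xr]; rewrite mulr1.
have z1 : 1 <= z x by rewrite ler_pdivlMr// mul1r; lra.
have z2 : z x <= 2 by rewrite ler_pdivrMr//; lra.
rewrite (le_trans (wl x _))//; first by rewrite ger0_norm// (le_trans _ z1).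
by rewrite ler_peMr// expr_ge1// (le_trans _ z1).
Qed.

End moments_of_exponential_bound.

Section two_sided_bounds.
Context {R : realType}.
Notation mu := (@lebesgue_measure R).
Variables (h H dH g q p : R -> R) (x0 beta c Mp : R).
Hypotheses (beta0 : 0 < beta) (x01 : 1 <= x0).
Hypothesis hH : forall x, x0 <= x -> h x = expR (H x).
Hypothesis dHH : forall x, x0 <= x -> is_derive x 1 H (dH x).
Hypothesis dHb : forall x, x0 <= x -> beta / 2 <= x * dH x <= 2 * beta.
Hypothesis dg : forall x : R, 0 < x -> is_derive x 1 g (h x).
Hypotheses (c0 : 0 < c) (Mp0 : 0 <= Mp).
Hypothesis pE : forall x, 0 <= x -> p x = c * expR (- (g x - q x)).
Hypothesis p_le : forall x, p x <= Mp.
Hypothesis p_ge0 : forall x, 0 <= p x.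
Hypothesis pneg : forall x : R, x < 0 -> p x = 0.
Hypothesis q1 : forall x, x0 <= x -> `|q x| <= 1.
Hypothesis iexp : forall t, mu.-integrable setT (EFin \o (fun x => expR (t * x) * p x)).

Let b := low_exponent beta.
Let G := gap_const beta : R.
Let b0 : 0 < b. Proof. exact: low_exponent_gt0. Qed.

(** The first summand serves [x >= x0], where [q <= 1] and [gap_ge] loses [b / 4]. The second serves
    [[0, x0)], where only [p <= Mp] is available and the gap at [x0] dictates the rate [b / 16]. *)
Definition upper_const := c * expR (1 + b / 4) + Mp * expR (g x0).
Definition upper_rate := b / 16.
Let lowd (L : R) := c * expR (- 1 - G * L ^+ 2).

Let C10 : 0 < upper_const.
Proof. by rewrite ltr_pwDl ?mulr_gt0 ?mulr_ge0 ?expR_gt0 ?expR_ge0. Qed.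
Let c10 : 0 < upper_rate. Proof. by rewrite divr_gt0. Qed.
Let lowd0 L : 0 < lowd L. Proof. by rewrite mulr_gt0 ?expR_gt0. Qed.
Let G0 : 0 <= G. Proof. by rewrite mulr_ge0// exprn_ge0. Qed.

Section at_t.
Variables (t xs L : R).
Hypotheses (xs0 : 2 * x0 <= xs) (hxs : h xs = t) (t1 : 1 <= t).
Hypotheses (L1 : 1 <= L) (xsL : (2 * L) ^+ 2 <= xs).
Let sg := Num.sqrt (xs / t).
Let y x := (x - xs) / sg.
Let E := expR (t * xs - g xs).

Let t0 : 0 < t. Proof. exact: lt_le_trans t1. Qed.
Let xsp : 0 < xs. Proof. by have := x01; have := xs0; lra. Qed.
Let sg0 : 0 < sg. Proof. by rewrite sqrtr_gt0 divr_gt0. Qed.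
Let E0 : 0 < E. Proof. exact: expR_gt0. Qed.

Let tsg2 : (t * sg) ^+ 2 = t * xs.
Proof. by rewrite exprMn sqr_sqrtr ?divr_ge0 ?(ltW xsp) ?(ltW t0)//; field; rewrite gt_eqF. Qed.

(** [t * sg] is the root of [t * xs]. Since [xs = sg * (t * sg)], this keeps the window of radius
    [L * sg] within [xs / 2] of the saddle point, where [gap_le] holds. *)
Let tsgL : 2 * L <= t * sg.
Proof.
rewrite -(@ler_pXn2r _ 2)// ?nnegrE; last 2 first.
- by have := L1; lra.
- by rewrite mulr_ge0 ?(ltW t0) ?(ltW sg0).
by rewrite tsg2 (le_trans xsL)// ler_peMl// ltW.
Qed.

Let tsg1 : 1 <= t * sg. Proof. by have := L1; have := tsgL; lra. Qed.

Let xsE : xs = sg * (t * sg).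
Proof. by rewrite mulrCA -expr2 sqr_sqrtr ?divr_ge0 ?(ltW xsp) ?(ltW t0)//; field; rewrite gt_eqF. Qed.

Let expE x : 0 <= x -> expR (t * x) * p x =
  E * (c * expR (q x - (g x - g xs - t * (x - xs)))).
Proof.
move=> x0'; rewrite pE// mulrCA [RHS]mulrCA; congr (_ * _).
by rewrite /E -!expRD; congr expR; ring.
Qed.

Let upper x : expR (t * x) * p x <= E * (upper_const * expR (- (upper_rate * `|y x|))).
Proof.
have rhs0 : 0 <= E * (upper_const * expR (- (upper_rate * `|y x|))).
  by rewrite mulr_ge0 ?(ltW E0)// mulr_ge0 ?(ltW C10) ?expR_ge0.
have [xn|xn] := ltP x 0; first by rewrite pneg// mulr0.
have [xx|xx] := leP x0 x.
  rewrite expE// ler_pM2l//.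
  have := gap_ge beta0 x01 hH dHH dHb dg xs0 hxs tsg1 xx; rewrite -/b -/sg -/(y x) => gp.
  have := q1 xx; rewrite ler_norml => /andP[_ qx].
  apply: (@le_trans _ _ (c * expR (1 + b / 4) * expR (- (upper_rate * `|y x|)))).
    rewrite -mulrA ler_pM2l// -expRD ler_expR /upper_rate.
    have : 0 <= b * `|y x| by rewrite mulr_ge0// ltW.
    by lra.
  by rewrite ler_wpM2r ?expR_ge0// lerDl mulr_ge0// expR_ge0.
have := gap_at_x0 beta0 x01 hH dHH dHb dg xs0 hxs; rewrite -/b -/sg => g0.
have yx : `|y x| <= (t * sg) ^+ 2.
  have : `|y x| <= t * sg.
    rewrite normrM normfV (gtr0_norm sg0) ler_pdivrMr// mulrC -xsE.
    by rewrite ler0_norm; [lra|have := x01; have := xs0; lra].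
  by move=> h'; rewrite (le_trans h')// expr2 ler_peMl// mulr_ge0 ?(ltW t0) ?(ltW sg0).
apply: (@le_trans _ _ (expR (t * x0) * Mp)).
  by apply: ler_pM => //; rewrite ?expR_ge0// ler_expR ler_pM2l// ltW.
apply: (@le_trans _ _ (E * (Mp * expR (g x0) * expR (- (upper_rate * `|y x|))))).
  have -> : E * (Mp * expR (g x0) * expR (- (upper_rate * `|y x|))) =
     expR (t * xs - g xs + g x0 - upper_rate * `|y x|) * Mp.
    by rewrite /E !expRD; ring.
  rewrite ler_wpM2r// ler_expR.
  have : upper_rate * `|y x| <= upper_rate * (t * sg) ^+ 2 by rewrite ler_pM2l.
  by rewrite /upper_rate; lra.
by rewrite ler_pM2l// ler_wpM2r ?expR_ge0// lerDr mulr_ge0 ?expR_ge0// ltW.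
Qed.

Let lower L' x : L' <= L -> `|y x| <= L' -> E * lowd L' <= expR (t * x) * p x.
Proof.
move=> LL yL; have L'0 : 0 <= L' by rewrite (le_trans _ yL).
have xd : `|x - xs| <= xs / 2.
  have -> : `|x - xs| = sg * `|y x|.
    by rewrite normrM normfV (gtr0_norm sg0) mulrC divfK// gt_eqF.
  rewrite [X in _ <= X / 2]xsE -mulrA ler_pM2l//.
  by have := tsgL; lra.
move: (xd); rewrite ler_norml => /andP[xl xr].
have xx : x0 <= x by have := xs0; lra.
rewrite expE; last by have := x01; lra.
rewrite ler_pM2l// /lowd ler_pM2l// ler_expR.
have /(gap_le x01 hH dHH dHb dg xs0 hxs) : xs / 2 <= x <= 2 * xs.
  by apply/andP; split; [lra|have := xsp; lra].
rewrite -/G -/sg -/(y x) => gp.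
have := q1 xx; rewrite ler_norml => /andP[qx _].
have : G * y x ^+ 2 <= G * L' ^+ 2.
  by rewrite ler_wpM2l// -real_normK ?num_real// lerXn2r ?nnegrE.
by lra.
Qed.

Let r0 : 0 < upper_rate / sg. Proof. by rewrite divr_gt0. Qed.

Let phi := laplace p t.

Let upperE x : expR (- (upper_rate * `|y x|)) = expR (- (upper_rate / sg * `|x - xs|)).
Proof.
congr (expR (- _)); rewrite normrM normfV (gtr0_norm sg0).
by field; rewrite gt_eqF.
Qed.

(** Integrating the pointwise bounds brackets the normalization between multiples of [E * sg]. The
    factor [E] then cancels, so no asymptotics of the Laplace transform enter. *)
Let phi_le : phi <= E * upper_const * (2 * sg / upper_rate).
Proof.
have [i Ei] := Rintegral_expR_norm xs r0.
have -> : 2 * sg / upper_rate = 2 / (upper_rate / sg) by field; rewrite !gt_eqF.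
rewrite -Ei -RintegralZl//; apply: le_Rintegral => //; first exact: integrable_cstM.
by move=> x _; rewrite -upperE -mulrA; exact: upper.
Qed.

Let phi_ge : E * lowd 1 * (2 * sg) <= phi.
Proof.
pose I := `[xs - sg, xs + sg]%classic.
have iI : mu.-integrable setT (EFin \o (\1_I : R -> R)) by apply: integrable_indic_itv.
have EI : \int[mu]_x (\1_I x : R) = 2 * sg.
  rewrite /Rintegral integral_indic//; last exact: measurable_itv.
  rewrite (setIT I : I `&` _ = I) /I /= lebesgue_measure_itv/= lte_fin.
  by rewrite ltrD2l gt0_cp//=; ring.
rewrite -EI -RintegralZl//; apply: le_Rintegral => //; first exact: integrable_cstM.
move=> x _; rewrite indicE; case: (boolP (x \in I)); last first.
  by move=> _; rewrite mulr0 mulr_ge0// expR_ge0.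
rewrite /I inE/= in_itv/= => /andP[xl xr]; rewrite mulr1; apply: lower => //.
rewrite normrM normfV (gtr0_norm sg0) ler_pdivrMr// mul1r ler_norml.
by apply/andP; split; lra.
Qed.

Let phi0 : 0 < phi.
Proof. by apply: lt_le_trans phi_ge; apply: mulr_gt0; exact: mulr_gt0. Qed.

Lemma tilted_upper x : expR (t * x) * p x / phi <=
  upper_const / (2 * lowd 1) / sg * expR (- (upper_rate * `|(x - xs) / sg|)).
Proof.
rewrite ler_pdivrMr//; apply: (le_trans (upper x)).
rewrite -[(x - xs) / sg]/(y x); set e := expR _.
have -> : upper_const / (2 * lowd 1) / sg * e * phi =
  upper_const * e / (2 * lowd 1 * sg) * phi by field; rewrite !gt_eqF.
apply: (@le_trans _ _ (upper_const * e / (2 * lowd 1 * sg) * (E * lowd 1 * (2 * sg)))).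
  by rewrite le_eqVlt; apply/orP; left; apply/eqP; field; rewrite !gt_eqF.
rewrite ler_pM2l//; apply: divr_gt0; first by apply: mulr_gt0 => //; exact: expR_gt0.
by apply: mulr_gt0 => //; exact: mulr_gt0.
Qed.

Lemma tilted_lower L' x : L' <= L -> `|(x - xs) / sg| <= L' ->
  lowd L' * upper_rate / (2 * upper_const) / sg <= expR (t * x) * p x / phi.
Proof.
move=> LL yL; rewrite ler_pdivlMr//; apply: le_trans (lower LL yL).
apply: (le_trans (ler_wpM2l _ phi_le)).
  by apply: ltW; apply: divr_gt0 => //; apply: divr_gt0; exact: mulr_gt0.
by rewrite le_eqVlt; apply/orP; left; apply/eqP; field; rewrite !gt_eqF.
Qed.

Lemma tilted_scale : 0 < sg /\ 1 <= t * sg.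
Proof. by []. Qed.

End at_t.

(** The order of quantifiers matters: [A], [r] and [lo] are fixed before [L], since the window
    needed later is computed from them. Only the threshold for [t] depends on [L]. *)
Lemma tilted_two_sided : exists (A r : R) (lo : R -> R),
  [/\ 0 < A, 0 < r, forall L, 0 < lo L &
   forall L, 1 <= L -> exists T, forall t, T <= t -> exists xs sg,
   [/\ 0 < t, 0 < sg, 1 <= t * sg,
    forall x, expR (t * x) * p x / laplace p t <= A / sg * expR (- (r * `|(x - xs) / sg|)) &
    forall L' x, L' <= L -> `|(x - xs) / sg| <= L' ->
      lo L' / sg <= expR (t * x) * p x / laplace p t]].
Proof.
exists (upper_const / (2 * lowd 1)), upper_rate,
  (fun L => lowd L * upper_rate / (2 * upper_const)); split => //.
- by apply: divr_gt0 => //; exact: mulr_gt0.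
- by move=> L; apply: divr_gt0; exact: mulr_gt0.
move=> L L1.
have [T1 T1P] := saddle_large beta0 x01 hH dHH dHb (Num.max (2 * x0) ((2 * L) ^+ 2)).
exists (Num.max 1 (Num.max (h x0) T1)) => t; rewrite !ge_max => /and3P[t1 th tT].
have [xs xs0 hxs] := saddle_exists beta0 x01 hH dHH dHb th.
have := T1P t xs tT xs0 hxs; rewrite ge_max => /andP[xs2 xsL].
have [s0 ts] := tilted_scale xs2 t1 L1 xsL.
exists xs, (Num.sqrt (xs / t)); split => //.
- exact: lt_le_trans t1.
- by move=> x; exact: (@tilted_upper t xs L).
- by move=> L' x; exact: (@tilted_lower t xs L).
Qed.

End two_sided_bounds.

(** * Conclusion *)

Section limits.
Context {R : realType}.

Lemma limn_einf_gt0 (u : nat -> R) : (0 < limn_einf (fun n => (u n)%:E))%E ->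
  exists e N, 0 < e /\ forall n, (N <= n)%N -> e <= u n.
Proof.
rewrite limn_einf_lim (cvg_lim _ (@cvg_einfs_sup R _))//.
move=> /ereal_sup_gt[_ [N _ <-] eN].
have uN n : (N <= n)%N -> (einfs (fun n => (u n)%:E) N <= (u n)%:E)%E.
  by move=> Nn; apply: ereal_inf_lbound; exists n.
move: eN uN; case: (einfs _ N) => [e| |] //= e0 uN.
  by exists e, N; split=> // n /uN; rewrite lee_fin.
by have := uN N (leqnn N); rewrite leye_eq.
Qed.

Lemma sqrt_large (M : R) : exists N : nat, forall n, (N <= n)%N -> M <= Num.sqrt n%:R.
Proof.
exists (Num.truncn (M ^+ 2)).+1 => n Nn.
have [M0|/ltW M0] := leP 0 M; last by rewrite (le_trans M0)// sqrtr_ge0.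
rewrite -[M]ger0_norm// -sqrtr_sqr ler_wsqrtr//.
by rewrite (le_trans (ltW (truncnS_gt _)))// ler_nat.
Qed.

(** As [u] stays above [e] and the difference vanishes, [v] is eventually above [e / 2], so the
    error can be divided by [v]. *)
Lemma ratio_cvg1 (u v : nat -> R) (K e : R) (N0 N1 : nat) : 0 < e -> 0 <= K ->
  (forall n, (N0 <= n)%N -> e <= u n) ->
  (forall n, (N1 <= n)%N -> (u n - v n) ^+ 2 <= K / Num.sqrt n.-1%:R) ->
  exists r : nat -> R, r n @[n --> \oo] --> 0 /\
    \forall n \near \oo, u n = (1 + r n) * v n.
Proof.
move=> e0 K0 ue uv.
have close d : 0 < d -> exists N, forall n, (N <= n)%N -> e <= u n /\ `|u n - v n| <= d.
  move=> d0; have [N2 hN2] := sqrt_large ((K + 1) / d ^+ 2).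
  exists (maxn N0 (maxn N1 N2.+1)) => n; rewrite !geq_max => /and3P[n0 n1 n2].
  split; first exact: ue.
  have n2' : (N2 <= n.-1)%N by case: n n2 {n0 n1}.
  have h := hN2 _ n2'.
  have s0 : 0 < Num.sqrt (n.-1%:R : R).
    by apply: lt_le_trans h; rewrite divr_gt0 ?exprn_gt0// ltr_wpDl.
  rewrite -(@ler_pXn2r _ 2)// ?nnegrE ?(ltW d0)// real_normK ?num_real//.
  apply: (le_trans (uv n n1)); rewrite ler_pdivrMr//.
  move: h; rewrite ler_pdivrMr ?exprn_gt0// mulrC => h.
  by apply: le_trans h; rewrite lerDl.
have [N hN] := close (e / 2) (divr_gt0 e0 (ltr0n _ 2)).
have vpos n : (N <= n)%N -> e / 2 <= v n.
  by move=> /hN[un]; rewrite ler_norml => /andP[_ h]; lra.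
exists (fun n => u n / v n - 1); split; last first.
  exists N => // n /= /vpos vn.
  have v0 : 0 < v n by rewrite (lt_le_trans _ vn)// divr_gt0.
  by field; rewrite gt_eqF.
apply/cvgrPdist_le => /= d d0.
have [N' hN'] := close (d * (e / 2)) (mulr_gt0 d0 (divr_gt0 e0 (ltr0n _ 2))).
exists (maxn N N') => // n /=; rewrite geq_max => /andP[nN nN'].
have vn := vpos n nN; have [_ h] := hN' n nN'.
have v0 : 0 < v n by rewrite (lt_le_trans _ vn)// divr_gt0.
rewrite sub0r normrN.
have -> : u n / v n - 1 = (u n - v n) / v n by field; rewrite gt_eqF.
rewrite normrM normfV (gtr0_norm v0) ler_pdivrMr// (le_trans h)//.
by rewrite ler_wpM2l// ltW.
Qed.

End limits.

(** * From the saddle point to the tilted mean *)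

Section regular_tilting.
Context {R : realType}.
Notation mu := (@lebesgue_measure R).

Lemma moment4_const_gt0 (A c : R) : 0 < A -> 0 < c -> 0 < moment4_const A c.
Proof. by move=> A0 c0; rewrite /moment4_const mulr_gt0 ?exprn_gt0 ?divr_gt0// mulr_gt0// divr_gt0. Qed.

(* Recentering at the mean: [|y| - m <= |z|] for [y = (x - xs) / sg],
   [z = (x - a) / sg] and [|a - xs| <= m * sg]. *)
Lemma recenter (w : R -> R) (xs a sg A r m : R) : 0 < sg -> 0 < A -> 0 < r ->
  `|a - xs| <= m * sg ->
  (forall x, w x <= A / sg * expR (- (r * `|(x - xs) / sg|))) ->
  forall x, w x <= A * expR (r * m) / sg * expR (- (r * `|(x - a) / sg|)).
Proof.
move=> sg0 A0 r0 am wb x; apply: (le_trans (wb x)).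
have -> : A * expR (r * m) / sg * expR (- (r * `|(x - a) / sg|)) =
  A / sg * expR (r * m - r * `|(x - a) / sg|) by rewrite expRD; ring.
rewrite ler_pM2l ?divr_gt0// ler_expR.
have : `|(x - a) / sg| <= `|(x - xs) / sg| + m.
  have -> : (x - a) / sg = (x - xs) / sg - (a - xs) / sg by ring.
  apply: (le_trans (ler_normB _ _)); rewrite lerD2l.
  by rewrite normrM normfV (gtr0_norm sg0) ler_pdivrMr.
by rewrite -(ler_pM2l r0) mulrDr; lra.
Qed.

Variable p : R -> R.
Hypothesis p0 : forall x : R, 0 <= p x.
Hypothesis pneg : forall x : R, x < 0 -> p x = 0.
Hypothesis p1 : \int[mu]_x p x = 1.
Hypothesis iexp : forall t, mu.-integrable setT (EFin \o (fun x => expR (t * x) * p x)).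

Definition tilt t x := expR (t * x) * p x / laplace p t.

Lemma tilt_density t : is_density (tilt t).
Proof.
have l0 := laplace_gt0 p0 p1 iexp t.
have E : tilt t = (fun x => (laplace p t)^-1 * (expR (t * x) * p x)).
  by apply/funext => x; rewrite /tilt mulrC.
split.
- by move=> x; rewrite divr_ge0 ?(ltW l0)// mulr_ge0 ?expR_ge0.
- by rewrite E; exact: integrable_cstM.
- by rewrite E RintegralZl// mulVf// gt_eqF.
Qed.

Lemma tilt_mean t : mu.-integrable setT
    (EFin \o (fun x => tilt t x * (x - laplace1 p t / laplace p t))) /\
  \int[mu]_x (tilt t x * (x - laplace1 p t / laplace p t)) = 0.
Proof.
have l0 := laplace_gt0 p0 p1 iexp t; set a := laplace1 p t / laplace p t.
have E : (fun x => tilt t x * (x - a)) =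
    (fun x => (laplace p t)^-1 * ((x - a) * (expR (t * x) * p x))).
  by apply/funext => x; rewrite /tilt; ring.
have i : mu.-integrable setT (EFin \o (fun x => (x - a) * (expR (t * x) * p x))).
  have -> : EFin \o (fun x => (x - a) * (expR (t * x) * p x)) =
    ((EFin \o (fun x => (x * (expR (t * x) * p x))%R)) \- (EFin \o (fun x => (a * (expR (t * x) * p x))%R)))%E.
    by apply/funext => x /=; rewrite mulrBl.
  by apply: integrableB => //; [exact: integrable_moment1|exact: integrable_cstM].
rewrite E; split; first exact: integrable_cstM.
by rewrite RintegralZl// centered_moment// /a divfK ?gt_eqF// subrr mulr0.
Qed.

Lemma tilt_regular (A r : R) (lo : R -> R) : 0 < A -> 0 < r -> (forall L, 0 < lo L) ->
  (forall L, 1 <= L -> exists T, forall t, T <= t -> exists xs sg,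
   [/\ 0 < t, 0 < sg, 1 <= t * sg,
    forall x, tilt t x <= A / sg * expR (- (r * `|(x - xs) / sg|)) &
    forall L' x, L' <= L -> `|(x - xs) / sg| <= L' -> lo L' / sg <= tilt t x]) ->
  exists (C C2 C4 v0 c0 T : R), [/\ 0 < C, 0 < C2, 0 < C4, 0 < v0 & 0 < c0] /\
    forall t, T <= t -> exists sg, [/\ 0 < t, 1 <= t * sg &
      regular_density C C2 C4 v0 (window C2 C4 v0) c0 (tilt t)
        (laplace1 p t / laplace p t) sg].
Proof.
move=> A0 r0 lo0 H.
pose m := 2 + moment4_const A r.
have m0 : 2 < m by rewrite ltrDl moment4_const_gt0.
pose A' := A * expR (r * m).
have A'0 : 0 < A' by rewrite mulr_gt0// expR_gt0.
pose C4 := moment4_const A' r.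
have C40 : 0 < C4 by exact: moment4_const_gt0.
pose C2 := 1 + C4.
have C20 : 0 < C2 by rewrite addr_gt0.
(* Passing from the saddle point to the mean costs [m] in units of [sg]: the radius 2 used for the
   variance becomes [2 + m], and the window [W] becomes [W + m]. [W] itself depends on [v0]. *)
pose v0 := lo (2 + m).
pose W := window C2 C4 v0.
have [T HT] : exists T, forall t, T <= t -> exists xs sg,
   [/\ 0 < t, 0 < sg, 1 <= t * sg,
    forall x, tilt t x <= A / sg * expR (- (r * `|(x - xs) / sg|)) &
    forall L' x, L' <= Num.max (2 + m) (W + m) -> `|(x - xs) / sg| <= L' ->
      lo L' / sg <= tilt t x].
  by apply: H; rewrite le_max; apply/orP; left; lra.
exists A', C2, C4, v0, (lo (W + m)), T; split; first by split => //; exact: lo0.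
move=> t /HT[xs [sg [t0 sg0 ts ub lb]]].
exists sg; split => //.
have dt := tilt_density t.
set a := laplace1 p t / laplace p t.
have [im m1] := tilt_mean t.
have am : `|a - xs| <= m * sg := mean_close dt sg0 A0 r0 ub m1 im.
have ub' := recenter sg0 A0 r0 am ub.
have shift x : `|(x - xs) / sg| <= `|(x - a) / sg| + m.
  have -> : (x - xs) / sg = (x - a) / sg + (a - xs) / sg by ring.
  apply: (le_trans (ler_normD _ _)); rewrite lerD2l.
  by rewrite normrM normfV (gtr0_norm sg0) ler_pdivrMr.
have i4 := integrable_wz4 dt sg0 A'0 r0 ub'.
have i2 := integrable_wz2 dt sg0 A'0 r0 ub'.
have i1 := integrable_wz1 dt sg0 A'0 r0 ub'.
split => //.
- move=> x; apply: (le_trans (ub' x)); rewrite ler_piMr ?divr_ge0 ?(ltW A'0) ?(ltW sg0)//.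
  by rewrite -expR0 ler_expR oppr_le0 mulr_ge0// ltW.
- move=> x xW; apply: lb; first by rewrite le_max lexx orbT.
  apply: (le_trans (shift x)); rewrite lerD2r.
  by rewrite normrM normfV (gtr0_norm sg0) ler_pdivrMr.
- transitivity (sg^-1 * \int[mu]_x (tilt t x * (x - a))).
    by rewrite -RintegralZl//; apply: eq_Rintegral => x _; ring.
  by rewrite m1 mulr0.
- rewrite (moment2_le dt sg0 A'0 r0 ub') andbT.
  apply: (moment2_ge dt sg0 A'0 r0 ub'); first exact/ltW/lo0.
  move=> x zx; apply: lb; first by rewrite le_max lexx.
  by apply: (le_trans (shift x)); rewrite lerD2r.
- exact: (moment4_le dt sg0 A'0 r0 ub').
Qed.

End regular_tilting.

(** * Application to the standing setting *)

Section setting.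
Context {R : realType} {d : measure_display} {T : measurableType d}.
Notation mu := (@lebesgue_measure R).
Variables (P : probability T R) (X : nat -> {RV P >-> R}) (p : R -> R) (c : R) (g q : R -> R).
Hypothesis set_std : standing_setting P X p c g q.

(* On [x < 0] the setting gives [p = 0] only almost everywhere. *)
Definition half_line_density := p \_ `[0, +oo[.
Let pp := half_line_density.

Let mp : measurable_fun setT p. Proof. by case: set_std => _ [_ []]. Qed.
Let Xp i (B : set R) : measurable B -> P (X i @^-1` B) = (\int[mu]_(x in B) (p x)%:E)%E.
Proof. by case: set_std => _ [_ [_ [h _]]]; exact: h. Qed.
Let p_ge0 x : 0 <= p x.
Proof. by case: set_std => _ [_ [_ [_ [[M h] _]]]]; case/andP: (h x). Qed.

Lemma half_line_densityE x : pp x = if 0 <= x then p x else 0.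
Proof. by rewrite /pp /half_line_density patchE mem_setE in_itv/= andbT. Qed.

Lemma measurable_half_line_density : measurable_fun setT pp.
Proof. by apply/(measurable_restrict _ (measurable_itv _) measurableT); rewrite ?setTI; exact: measurable_funTS. Qed.

Lemma half_line_density_ge0 x : 0 <= pp x.
Proof. by rewrite half_line_densityE; case: ifP. Qed.

Lemma half_line_density_lt0 (x : R) : x < 0 -> pp x = 0.
Proof. by move=> x0; rewrite half_line_densityE leNgt x0. Qed.

Lemma law_half_line i (B : set R) : measurable B ->
  P (X i @^-1` B) = (\int[mu]_(x in B) (pp x)%:E)%E.
Proof.
move=> mB; have X0 w : 0 <= X i w by case: set_std => _ [h _]; exact: h.
have -> : X i @^-1` B = X i @^-1` (B `&` `[0, +oo[).
  apply/seteqP; split => w /=; first by move=> Bw; split => //; rewrite /= in_itv/= X0.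
  by case.
rewrite Xp; last exact: measurableI.
rewrite integral_mkcondr; apply: eq_integral => x _.
by rewrite /pp /half_line_density !patchE; case: ifP.
Qed.

Lemma half_line_density_int1 : \int[mu]_x pp x = 1.
Proof.
by rewrite /Rintegral -(law_half_line 0 measurableT) preimage_setT probability_setT.
Qed.

Lemma half_line_density_bound : exists2 M, 0 <= M & forall x, pp x <= M.
Proof.
case: set_std => _ [_ [_ [_ [[M h] _]]]].
have M0 : 0 <= M by case/andP: (h 0) => ? ?; exact: le_trans (_ : p 0 <= M).
by exists M => // x; rewrite half_line_densityE; case: ifP => // _; case/andP: (h x).
Qed.

Variable beta : R.
Hypotheses (beta0 : 0 < beta) (hbeta : in_Rbeta beta (derive1 g)).

Lemma setting_regular_variation : exists (x0 : R) (H dH : R -> R), [/\ 1 <= x0,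
  forall x, x0 <= x -> derive1 g x = expR (H x),
  forall x, x0 <= x -> is_derive x 1 H (dH x),
  forall x, x0 <= x -> beta / 2 <= x * dH x <= 2 * beta &
  forall x, x0 <= x -> `|q x| <= 1].
Proof.
have [x0 [H [dH [x01 hH dHH dHb]]]] := in_Rbeta_exp beta0 hbeta.
case: set_std => _ [_ [_ [_ [_ [_ [_ [_ [_ [_ [theta [theta0 nq]]]]]]]]]]].
have [x1 [x11 hx1]] := near_pinfty_ge nq.
have h0 := h_gt0 hH (lexx x0).
pose x2 := Num.max x0 (Num.max x1 (derive1 g x0)^-1).
have x2P x : x2 <= x -> [/\ x0 <= x, x1 <= x & (derive1 g x0)^-1 <= x].
  by rewrite !ge_max => /and3P[].
exists x2, H, dH; split.
- by rewrite le_max x01.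
- by move=> x /x2P[xx _ _]; exact: hH.
- by move=> x /x2P[xx _ _]; exact: dHH.
- by move=> x /x2P[xx _ _]; exact: dHb.
move=> x /x2P[xx xx1 xh].
have xp : 0 < x by rewrite (lt_le_trans _ xx)// (lt_le_trans _ x01).
have := hx1 x xx1 x; rewrite subrr normr0 mulr_gt0// => /(_ isT) /le_trans; apply.
have hx : derive1 g x0 <= derive1 g x.
  apply: le_trans (h_ratio_low beta0 x01 hH dHH dHb (lexx x0) xx).
  rewrite ler_peMr ?(ltW h0)// lerDl mulr_ge0 ?(ltW (low_exponent_gt0 beta0))//.
  by rewrite subr_ge0 ler_pdivrMr// mul1r.
have xh1 : 1 <= x * derive1 g x.
  apply: (@le_trans _ _ (x * derive1 g x0)); last by rewrite ler_pM2l.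
  by rewrite -ler_pdivrMr// div1r.
rewrite ler_pdivrMr ?mul1r; last by rewrite sqrtr_gt0 (lt_le_trans _ xh1).
by rewrite -[X in X <= _]sqrtr1 ler_wsqrtr.
Qed.

Lemma integrable_exp_half_line t :
  mu.-integrable setT (EFin \o (fun x => expR (t * x) * pp x)).
Proof.
have [x0 [H [dH [x01 _ _ _ q1]]]] := setting_regular_variation.
have [M M0 pM] := half_line_density_bound.
case: set_std => _ [_ [_ [_ [_ [c0 [pE [_ [_ [ginf _]]]]]]]]].
have [x1 [x11 hx1]] := near_pinfty_ge (proj1 (cvgryPge _) ginf (`|t| + 1)).
pose x2 := Num.max x0 x1; have x2p : 0 <= x2 by rewrite le_max (le_trans _ x01).
pose K := c * expR 1 + M * expR ((`|t| + 1) * x2).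
have K0 : 0 <= K by rewrite addr_ge0// mulr_ge0 ?expR_ge0// ltW.
have [i _] := @Rintegral_expR_norm R 1 0 ltr01.
apply: (le_integrable measurableT _ _ (integrable_cstM K i)).
  apply/measurable_EFinP; apply: measurable_funM; last exact: measurable_half_line_density.
  apply: continuous_measurable_fun.
  by have := @continuous_expR_affine R t 0; under eq_fun do rewrite subr0.
move=> x _ /=; rewrite lee_fin subr0 mul1r.
rewrite [leLHS]ger0_norm ?mulr_ge0 ?expR_ge0 ?half_line_density_ge0//.
rewrite [leRHS]ger0_norm ?mulr_ge0 ?expR_ge0//.
have [xn|xp] := ltP x 0.
  by rewrite half_line_density_lt0// mulr0 mulr_ge0// expR_ge0.
rewrite ger0_norm//.
have tx : t * x <= `|t| * x by rewrite ler_wpM2r// ler_norm.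
have [xx|xx] := leP x2 x.
  move: (xx); rewrite ge_max => /andP[xx0 xx1].
  have := hx1 x xx1; rewrite ler_pdivlMr; last by rewrite (lt_le_trans _ xx1)// (lt_le_trans _ x11).
  move=> gx; have := q1 x xx0; rewrite ler_norml => /andP[_ qx].
  rewrite half_line_densityE xp pE// mulrCA -expRD.
  apply: (@le_trans _ _ (c * expR 1 * expR (- x))).
    by rewrite -mulrA ler_pM2l// -expRD ler_expR; lra.
  by rewrite ler_wpM2r ?expR_ge0// lerDl mulr_ge0// expR_ge0.
apply: (@le_trans _ _ (M * expR ((`|t| + 1) * x2) * expR (- x))).
  rewrite -mulrA -expRD mulrC ler_pM ?half_line_density_ge0 ?expR_ge0// ler_expR.
  have : `|t| * x <= `|t| * x2 by rewrite ler_wpM2l// ltW.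
  by lra.
by rewrite ler_wpM2r ?expR_ge0// lerDr mulr_ge0 ?expR_ge0// ltW.
Qed.

Let iexp := integrable_exp_half_line.

(** [tilted] also integrates [p] over negative points. Both integrals are the same expectation under
    the law of [X 0], so the values of [p] there do not matter. *)
Lemma tilted_half_line (phi t : R) (B : set R) : measurable B ->
  tilted p phi t B = expect (fun x => expR (t * x) * pp x / phi) \1_B.
Proof.
move=> mB; rewrite /tilted /expect.
have mf : measurable_fun setT (fun x => (expR (t * x) * \1_B x)%:E).
  apply/measurable_EFinP; apply: measurable_funM; last exact: measurable_indic.
  apply: continuous_measurable_fun.
  by have := @continuous_expR_affine R t 0; under eq_fun do rewrite subr0.
have f0 x : (0 <= (expR (t * x) * \1_B x)%:E)%E.
  by rewrite lee_fin mulr_ge0 ?expR_ge0// indicE.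
have E1 := integral_comp_density mp p_ge0 (Xp 0) mf f0.
have E2 := integral_comp_density measurable_half_line_density half_line_density_ge0
  (law_half_line 0) mf f0.
have -> : \int[mu]_(x in B) (expR (t * x) * p x) = \int[mu]_x (expR (t * x) * \1_B x * pp x).
  rewrite Rintegral_mkcond /Rintegral; congr fine.
  transitivity (\int[mu]_x ((expR (t * x) * \1_B x)%:E * (p x)%:E))%E.
    apply: eq_integral => x _; rewrite patchE indicE -EFinM.
    by case: ifP => _; rewrite ?mulr1// mulr0 mul0r.
  by rewrite -E1 E2; apply: eq_integral => x _; rewrite EFinM.
have iB : mu.-integrable setT (EFin \o (fun x => expR (t * x) * \1_B x * pp x)).
  have := integrable_mul_bounded (iexp t) (bounded_meas_indic mB).
  by congr (mu.-integrable _ _); apply/funext => x /=; rewrite mulrAC.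
by rewrite -RintegralZr//; apply: eq_Rintegral => x _; ring.
Qed.

Lemma setting_tilt_regular : exists (C C2 C4 v0 c0 T0 : R),
  [/\ 0 < C, 0 < C2, 0 < C4, 0 < v0 & 0 < c0] /\
    forall t, T0 <= t -> exists sg, [/\ 0 < t, 1 <= t * sg &
      regular_density C C2 C4 v0 (window C2 C4 v0) c0 (tilt pp t)
        (laplace1 pp t / laplace pp t) sg].
Proof.
have [x0 [H [dH [x01 hH dHH dHb q1]]]] := setting_regular_variation.
have [M M0 pM] := half_line_density_bound.
case: set_std => _ [_ [_ [_ [_ [c0 [pE [_ [dg _]]]]]]]].
have dg' (x : R) : 0 < x -> is_derive x 1 g (derive1 g x).
  by move=> x0'; apply: DeriveDef; [exact: dg|rewrite derive1E].
have ppE x : 0 <= x -> pp x = c * expR (- (g x - q x)).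
  by move=> xp; rewrite half_line_densityE xp pE.
have [A [r [lo [A0 r0 lo0 hlo]]]] := tilted_two_sided beta0 x01 hH dHH dHb dg' c0 M0 ppE pM
  half_line_density_ge0 half_line_density_lt0 q1 iexp.
exact: (tilt_regular half_line_density_ge0 half_line_density_lt0
  half_line_density_int1 iexp A0 r0 lo0 hlo).
Qed.

Lemma conditional_tv : exists (K T0 : R) (N0 : nat), 0 <= K /\
  forall n t, (N0 <= n)%N -> T0 <= t -> forall B : set R, measurable B ->
  (cond_law X (event_A X n (laplace1 pp t / laplace pp t)) B
    - tilted p (laplace pp t) t B) ^+ 2 <= K / Num.sqrt n.-1%:R.
Proof.
have [C [C2 [C4 [v0 [c0 [T0 [[C0 C20 C40 v00 c00] reg]]]]]]] := setting_tilt_regular.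
have [N1 hN1] := sqrt_large (min_root C2 C4 v0).
(* At least two variables are required: the first one, whose law is compared, and one averaged into
   [u]. The successor of [N1] is due to the root of [n.-1]. *)
exists (tv_const C c0), T0, (maxn 2 N1.+1).
split; first exact: ltW (tv_const_gt0 C0 c00).
move=> n t; rewrite geq_max => /andP[n2 nN] tT B mB.
have [sg [t0 ts rd]] := reg t tT.
case: n n2 nN => [//|[//|n]] _ nN.
have [E0 tv] := conditional_tilt_tv C0 C20 C40 v00 c00 rd t0 ts (hN1 n.+1 nN).
have dt := reg_dens rd.
have l0 := laplace_gt0 half_line_density_ge0 half_line_density_int1 iexp t.
case: set_std => indX _.
have := cond_law_tilt measurable_half_line_density half_line_density_ge0 indX
  law_half_line l0 (ltW t0) dt n.+1 (laplace1 pp t / laplace pp t) mB.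
by move=> ->; rewrite tilted_half_line//; exact: tv.
Qed.

End setting.

Theorem theorem5p2 (R : realType) (d : measure_display) (T : measurableType d)
  (P : probability T R) (X : nat -> {RV P >-> R}) (p : R -> R) (c : R)
  (g q : R -> R) (k : R) (a t eps : nat -> R) :
  standing_setting P X p c g q ->
  1 < k -> in_Rbeta (k - 1) (derive1 g) ->
  a n @[n --> \oo] --> +oo ->
  (\forall n \near \oo, mgf_m (X 0) (t n) = a n) ->
  (psi (derive1 g) (t n) ^+ 2
     / Num.sqrt (n%:R * derive1 (psi (derive1 g)) (t n))) @[n --> \oo] --> 0 ->
  (exists delta : R, 0 < delta /\
     (delta%:E < limn_einf (fun n => (ln (g (a n)) / ln n%:R)%:E))%E) ->
  (forall n, 0 < eps n) ->
  (n%:R * ln (a n) / (powR (a n) (k - 2) * eps n ^+ 2)) @[n --> \oo] --> 0 ->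
  forall B : nat -> set R, (forall n, measurable (B n)) ->
  (0%:E < limn_einf (fun n => (cond_law X (event_A X n (a n)) (B n))%:E))%E ->
  exists r : nat -> R, r n @[n --> \oo] --> 0 /\
    \forall n \near \oo,
      cond_law X (event_A X n (a n)) (B n)
      = (1 + r n) * tilted p (mgf (X 0) (t n)) (t n) (B n).
Proof.
move=> set_std k1 hbeta aoo ma _ _ _ _ B mB Bpos.
have beta0 : 0 < k - 1 by rewrite subr_gt0.
have [K [T0 [N0 [K0 tv]]]] := conditional_tv set_std beta0 hbeta.
have mpp := measurable_half_line_density set_std.
have pp0 := half_line_density_ge0 set_std.
have ppn := @half_line_density_lt0 _ p.
have pp1 := half_line_density_int1 set_std.
have iexp := integrable_exp_half_line set_std beta0 hbeta.
have lawX C : measurable C -> _ := @law_half_line _ _ _ _ _ _ _ _ _ set_std 0 C.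
set pp := half_line_density p in tv mpp pp0 ppn pp1 iexp lawX.
have l0 s : 0 < laplace pp s := laplace_gt0 pp0 pp1 iexp s.
have mgfE s : mgf (X 0) s = laplace pp s := mgf_laplace mpp pp0 lawX s.
have mE s : mgf_m (X 0) s = laplace1 pp s / laplace pp s :=
  mgf_m_laplace mpp pp0 ppn pp1 iexp lawX s.
have [e [N1 [e0 Be]]] := limn_einf_gt0 Bpos.
have [N2 _ maN] := ma.
have aT : \forall n \near \oo, laplace1 pp T0 / laplace pp T0 + 1 <= a n.
  by move/cvgryPge : aoo; exact.
have [N3 _ aN] := aT.
apply: (ratio_cvg1 e0 K0 Be (N1 := maxn N0 (maxn N2 N3))) => n.
rewrite !geq_max => /and3P[n0 n2 n3].
have anE : a n = laplace1 pp (t n) / laplace pp (t n) by rewrite -mE maN.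
have tT : T0 <= t n.
  (* Otherwise monotonicity of the mean would give [a n] at most the mean at tilt [T0], which [a n]
     eventually exceeds by 1. *)
  rewrite leNgt; apply/negP => /ltW tT.
  have : a n * laplace pp T0 <= laplace1 pp T0.
    apply: (laplace_mean_mono pp0 ppn iexp tT).
    by rewrite anE divfK// gt_eqF.
  rewrite -ler_pdivlMr// => an; have := aN n n3; rewrite /=.
  by move: an; lra.
by rewrite mgfE anE; exact: tv.
Qed.
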